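(* Let $\Omega\subset\mathbb{R}^n$ be an open domain and let $X$, $Y$ be $L^2$ spaces on $\Omega$ (with values in finite-dimensional Euclidean spaces). Let $\alpha>0$, $K\in C^2(X;Y)$, and let $F^*(v)=\int_\Omega f^*(v(x))\,dx$ on $Y$ for a proper, convex, lower semicontinuous $f^*$ with $\partial f^*$ proto-differentiable. Let $\gamma\ge0$ and $F^*_\gamma(v)=F^*(v)+\frac{\gamma}{2}\|v\|^2$, and suppose that for every $(v,\eta)$ with $\eta\in\partial F^*_\gamma(v)$ there is a cone $V(v|\eta)\subset Y$ such that $$\widetilde{D[\partial F^*_\gamma]}(v|\eta)(\Delta v)=\begin{cases}\gamma\Delta v+V(v|\eta)^\circ,&\Delta v\in V(v|\eta),\\ \emptyset,&\Delta v\notin V(v|\eta).\end{cases}$$ For $\Delta y\in Y$, denote by $\hat q_{\Delta y}=(\hat u_{\Delta y},\hat v_{\Delta y})$ a solution to the optimality conditions $$\alpha u+\nabla K(u)^*v=0,\qquad K(u)-\Delta y\in\partial F^*_\gamma(v)$$ of the problem $\min_u\max_v \frac{\alpha}{2}\|u\|^2+\langle K(u)-\Delta y,v\rangle-F^*_\gamma(v)$. Suppose that a solution $\hat q=\hat q_0=(\hat u,\hat v)$ exists, and that there is a constant $c_G>0$ such that $$\alpha\|\xi\|^2+\langle\nabla_u[\nabla K(\hat u)^*\hat v]\xi,\xi\rangle\ge c_G\|\xi\|^2\qquad(\xi\in X).$$ Let $\bar B=\nabla K(\hat u)\bigl(\alpha I+\nabla_u[\nabla K(\hat u)^*\hat v]\bigr)^{-1}\nabla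 K(\hat u)^*$ and $$\bar b=\sup_{t>0}\inf\left\{\frac{\|\bar Bz-\nu\|}{\|z\|}\ \middle|\ \begin{array}{l}0\ne z\in V(v'|\eta'),\ \nu\in V(v'|\eta')^\circ,\ \eta'\in\partial F^*_\gamma(v'),\\ \|v'-\hat v\|<t,\ \|\eta'-K(\hat u)\|<t\end{array}\right\}.$$ If $\gamma>0$ or $\bar b>0$, then for some $\rho,\ell>0$ there exist solutions $\hat q_{\Delta y}$ with $$\|\hat q-\hat q_{\Delta y}\|\le\ell\|\Delta y\|\quad\text{whenever}\quad\|\Delta y\|\le\rho.$$
   Context: Hilbert spaces are identified with their duals; $\nabla K(u)^*$ is the adjoint of the Fréchet derivative and $\nabla_u[\nabla K(\hat u)^*\hat v]$ is the Fréchet derivative at $\hat u$ of $\tilde u\mapsto\nabla K(\tilde u)^*\hat v$; $\partial$ is the convex subdifferential. The polar cone of a cone $V$ is $V^\circ=\{z\mid\langle z,z'\rangle\le0\ \forall z'\in V\}$. Tangent vectors: $T(u;U)=\{z\mid \exists\,\tau^i\searrow 0,\ u^i\in U: z=\lim_i (u^i-u)/\tau^i\}$. For $S:Q\rightrightarrows W$ between Hilbert spaces, $DS(q|w)(\Delta q)=\{\Delta w\mid(\Delta q,\Delta w)\in T((q,w);\operatorname{graph}S)\}$, and $\widetilde{DS}(q|w)$ is defined by $\operatorname{graph}\widetilde{DS}(q|w)=\operatorname{conv}\operatorname{graph}[DS(q|w)]$. A set $U$ is geometrically derivable if for every $u\in U$ and $z\in T(u;U)$ there are $\varepsilon>0$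 and a curve $\xi:[0,\varepsilon]\to U$ with $\xi(0)=u$ and $\lim_{t\searrow0}(\xi(t)-\xi(0))/t=z$; $S$ is proto-differentiable if $\operatorname{graph}S$ is geometrically derivable. $F^*$ is assumed proper. The infimum over an empty set is $+\infty$. *)

(* Defs.v *)
From HB Require Import structures.
From mathcomp Require Import all_boot all_order all_algebra ring_quotient.
From mathcomp Require Import all_classical all_reals all_analysis measurable_realfun ring lra.

Set Implicit Arguments.
Unset Strict Implicit.
Unset Printing Implicit Defensive.

Import Order.TTheory GRing.Theory Num.Theory.
Import numFieldNormedType.Exports.

Local Open Scope classical_set_scope.
Local Open Scope ring_scope.

(* R^n with its Borel sigma-algebra *)
Definition Rn (R : realType) (n : nat) := g_sigma_algebraType (@open 'rV[R]_n).

Lemma open_measurable_Rn (R : realType) (n : nat) (A : set 'rV[R]_n) :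
  open A -> measurable (A : set (Rn R n)).
Proof. by move=> oA; exact: sub_sigma_algebra. Qed.

Lemma measurable_coordP (R : realType) (n : nat) d (T : measurableType d)
    (f : T -> Rn R n) :
  (forall i, measurable_fun setT (fun x => (f x : 'rV[R]_n) 0 i)) ->
  measurable_fun setT f.
Proof.
move=> mf; apply: (@measurability _ _ T (Rn R n) setT f (@open 'rV[R]_n)) => //.
move=> _ [A oA <-]; rewrite setTI.
pose c (p : 'rV[rat]_n * nat) : 'rV[R]_n := \row_i ratr (p.1 0 i).
pose B (p : 'rV[rat]_n * nat) : set 'rV[R]_n :=
  [set y | forall i, ball (c p 0 i) p.2.+1%:R^-1 (y 0 i)].
pose I : set ('rV[rat]_n * nat) := [set p | B p `<=` A].
have -> : f @^-1` A = \bigcup_k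
    (if unpickle k is Some p then if p \in I then f @^-1` B p else set0 else set0).
  apply/seteqP; split => x /=; last first.
    by move=> [k _]; case: unpickle => // p; case: ifPn => // /set_mem; apply.
  move=> Afx.
  have /nbhs_ballP[e /= e0 eA] : nbhs (f x : 'rV[R]_n) A by exact: open_nbhs_nbhs.
  have [k ke] : exists k : nat, k.+1%:R^-1 < e / 2.
    have /ltr_add_invr[k] : 0 < e / 2 by rewrite divr_gt0.
    by rewrite add0r => ?; exists k.
  have /choice[q qP] : forall i, exists q : rat,
      ball ((f x : 'rV[R]_n) 0 i) k.+1%:R^-1 (ratr q).
    move=> i; have [] := @dense_rat R (ball ((f x : 'rV[R]_n) 0 i) k.+1%:R^-1).
    - by exists ((f x : 'rV[R]_n) 0 i); exact: ballxx.
    - exact: ball_open.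
    - by move=> _ [/[swap]] [q _ <-] ?; exists q.
  exists (pickle (\row_i q i, k)) => //; rewrite pickleK ifT.
    by move=> i /=; rewrite !mxE; exact/ball_sym/qP.
  apply/mem_set => y By; apply: eA; split => // i j; rewrite (ord1 i).
  rewrite [e]splitr; apply: (@le_ball _ _ _ (k.+1%:R^-1 + k.+1%:R^-1)).
    by rewrite lerD // ltW.
  by apply: (ball_triangle (qP j)); have := By j; rewrite !mxE.
apply: bigcupT_measurable => k; case: unpickle => // p; case: ifPn => // _.
have -> : f @^-1` B p =
    \bigcap_(i in setT) ((fun x => (f x : 'rV[R]_n) 0 i) @^-1` ball (c p 0 i) p.2.+1%:R^-1).
  by apply/seteqP; split => x /= h i => [_|]; exact: h.
apply: fin_bigcap_measurable => // i _; rewrite -[X in measurable X]setTI.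
by apply: mf => //; rewrite ball_itv; exact: measurable_itv.
Qed.

Lemma measurable_coord (R : realType) (n : nat) (i : 'I_n) :
  measurable_fun setT (fun x : Rn R n => (x : 'rV[R]_n) 0 i).
Proof.
apply: (measurability _ (RGenOpens.measurableE R)).
move=> _ [_ [a [b ->] <-]]; rewrite setTI; apply: open_measurable_Rn.
apply: open_comp; last exact: interval_open.
by move=> x _; exact: coord_continuous.
Qed.

Definition consRn (R : realType) (n : nat) (p : R * Rn R n) : Rn R n.+1 :=
  \row_i (if unlift ord0 i is Some j then (p.2 : 'rV[R]_n) 0 j else p.1).

Lemma measurable_consRn (R : realType) (n : nat) :
  measurable_fun setT (@consRn R n).
Proof.
apply: measurable_coordP => i; rewrite /consRn.
under eq_fun do rewrite mxE.
case: unliftP => [j|] _ /=.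
  by apply: (measurableT_comp (@measurable_coord R n j)); exact: measurable_snd.
exact: measurable_fst.
Qed.

Section prodRn.
Context (R : realType) (n : nat) (mu : {measure set (Rn R n) -> \bar R}).

Definition prodRn : set (Rn R n.+1) -> \bar R :=
  pushforward (product_measure2 (@lebesgue_measure R) mu) (@consRn R n).

HB.instance Definition _ := Measure.copy prodRn
  (measure_function_pushforward__canonical__measure_function_Measure
     (product_measure2 (@lebesgue_measure R) mu) (measurable_consRn (n := n))).

End prodRn.

(* Lebesgue measure on R^n as an iterated product, see lebesgueRn_box *)
Fixpoint lebesgueRn (R : realType) (n : nat) : {measure set (Rn R n) -> \bar R} :=
  if n is k.+1 return {measure set (Rn R n) -> \bar R} then prodRn (lebesgueRn R k)
  else dirac ((0 : 'rV[R]_0) : Rn R 0).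

Definition boxRn (R : realType) (n : nat) (a b : 'rV[R]_n) : set (Rn R n) :=
  [set x | forall i, (x : 'rV[R]_n) 0 i \in `]a 0 i, b 0 i]].

Lemma lebesgueRn_box (R : realType) (n : nat) (a b : 'rV[R]_n) :
  (forall i, a 0 i <= b 0 i) ->
  lebesgueRn R n (boxRn a b) = (\prod_i (b 0 i - a 0 i))%:E.
Proof.
elim: n a b => [|n IHn] a b ab /=.
  by rewrite big_ord0 diracE mem_set// => -[].
rewrite /prodRn /pushforward.
have -> : @consRn R n @^-1` boxRn a b = `]a 0 0, b 0 0] `*`
   boxRn (\row_j a 0 (lift 0 j)) (\row_j b 0 (lift 0 j)).
  apply/seteqP; split => -[x y] /=.
    move=> h; split => [|i /=].
      by have := h ord0; rewrite mxE unlift_none.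
    by have := h (lift 0 i); rewrite !mxE liftK.
  move=> [/= h0 h] i /=; rewrite mxE; case: unliftP => [j ->|-> //].
  by have := h j; rewrite !mxE.
rewrite [LHS]product_measure2E//; last first.
  rewrite (_ : boxRn _ _ = \bigcap_(i in setT) ((fun x : Rn R n => (x : 'rV[R]_n) 0 i)
     @^-1` `]a 0 (lift 0 i), b 0 (lift 0 i)])).
    apply: fin_bigcap_measurable => // i _; rewrite -[X in measurable X]setTI.
    exact: measurable_coord.
  by apply/seteqP; split => x /= h i; have := h i; rewrite /= !mxE; [move=> + _|exact].
rewrite IHn => [|i]; last by rewrite !mxE.
transitivity (lebesgue_measure `]a 0%R 0%R, b 0%R 0%R]%classic *
    (\prod_i (b ord0 (lift ord0 i) - a ord0 (lift ord0 i)))%:E)%E.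
  by congr (_ * _%:E)%E; apply: eq_bigr => i _; rewrite !mxE.
rewrite big_ord_recl EFinM lebesgue_measure_itv /= lte_fin; congr (_ * _)%E.
case: ltP => // ba; rewrite (_ : a 0 0 = b 0 0) ?subrr//.
by apply/le_anti; rewrite ab.
Qed.

(* L^2(Omega) is L^2 of the Lebesgue measure restricted to Omega: classes of
   functions on R^n modulo equality almost everywhere in Omega *)
Definition lebesgue_on (R : realType) (n : nat) (Omega : set 'rV[R]_n)
    (oOmega : open Omega) : {measure set (Rn R n) -> \bar R} :=
  mrestr (lebesgueRn R n) (open_measurable_Rn oOmega).

(* The norm of 'rV[R]_m is the maximum norm, so the Euclidean structure is
   carried by dotv. *)
Definition dotv (R : realType) (m : nat) (a b : 'rV[R]_m) : R :=
  \sum_i a 0 i * b 0 i.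

Section preL2.
Context d (T : measurableType d) (R : realType).
Variables (mu : {measure set T -> \bar R}) (m : nat).

Definition sqint : {pred T -> 'rV[R]_m} :=
  fun f => [forall i, (fun x => f x 0 i) \in Lfun mu 2%:E].

Lemma sqintP (f : T -> 'rV[R]_m) :
  reflect (forall i, (fun x => f x 0 i) \in Lfun mu 2%:E) (f \in sqint).
Proof. by rewrite unfold_in; exact: forallP. Qed.

Lemma sqint_submod_closed : submod_closed sqint.
Proof.
have [h0 hl] := @Lfun_submod_closed _ _ _ mu _ (lee1n 2).
split.
  apply/sqintP => i; rewrite (_ : (fun _ => _) = 0)//.
  by apply/funext => x /=; rewrite mxE.
move=> a f g /sqintP sf /sqintP sg; apply/sqintP => i.
rewrite (_ : (fun _ => _) = a *: (fun x => f x 0 i : R^o) + (fun x => g x 0 i)).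
  exact: hl.
by apply/funext => x; rewrite !fctE !mxE.
Qed.

HB.instance Definition _ := GRing.isSubmodClosed.Build R (T -> 'rV[R]_m) sqint
  sqint_submod_closed.

Record preL2 := PreL2 { preL2_fun :> T -> 'rV[R]_m; _ : preL2_fun \in sqint }.
HB.instance Definition _ := [isSub for preL2_fun].
HB.instance Definition _ := [Choice of preL2 by <:].
HB.instance Definition _ := [SubChoice_isSubLmodule of preL2 by <:].

Definition null : {pred preL2} := fun f => `[< {ae mu, forall x, f x = 0} >].

Lemma null_submod_closed : submod_closed null.
Proof.
split; first by apply/asboolP; apply: aeW.
move=> a f g /asboolP f0 /asboolP g0; apply/asboolP.
by apply: filterS2 f0 g0 => x /= fx gx; rewrite !fctE fx gx scaler0 addr0.
Qed.

HB.instance Definition _ := GRing.isSubmodClosed.Build R preL2 null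
  null_submod_closed.

(* square-integrable functions T -> R^m modulo equality almost everywhere *)
Definition L2 := Quotient.quot null.
HB.instance Definition _ := GRing.Zmodule.on L2.

Definition L2fun (v : L2) : preL2 := repr v.
Coercion L2fun : L2 >-> preL2.

Local Open Scope quotient_scope.

Lemma L2_eqP (f g : preL2) :
  reflect {ae mu, forall x, f x = g x} (\pi_L2 f == \pi_L2 g).
Proof.
rewrite eqmodE /= Quotient.equivE unfold_in.
apply: (iffP (asboolP _)); apply: filterS => x /=; rewrite !fctE.
  by move/eqP; rewrite subr_eq0 => /eqP.
by move=> ->; rewrite subrr.
Qed.

Lemma L2_piE (f : preL2) : {ae mu, forall x, (\pi_L2 f : L2) x = f x}.
Proof. by apply/L2_eqP; rewrite reprK. Qed.

Lemma L2P (v w : L2) : {ae mu, forall x, v x = w x} -> v = w.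
Proof. by move/L2_eqP; rewrite !reprK => /eqP. Qed.

Lemma L2_piD (f g : preL2) : \pi_L2 (f + g) = \pi_L2 f + \pi_L2 g :> L2.
Proof. by rewrite !piE. Qed.

Definition L2scale (a : R) (v : L2) : L2 := \pi_L2 (a *: L2fun v).

Lemma L2_piZ a (f : preL2) : \pi_L2 (a *: f) = L2scale a (\pi_L2 f).
Proof.
apply/esym/eqP/L2_eqP; apply: filterS (L2_piE f) => x.
by rewrite /= !fctE => ->.
Qed.

Lemma L2_reprK (v : L2) : \pi_L2 (L2fun v) = v. Proof. exact: reprK. Qed.

Let L2_scaleA a b v : L2scale a (L2scale b v) = L2scale (a * b) v.
Proof. by rewrite -(L2_reprK v) -!L2_piZ scalerA. Qed.
Let L2_scale1 : left_id 1 L2scale.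
Proof. by move=> v; rewrite -(L2_reprK v) -L2_piZ scale1r. Qed.
Let L2_scaleDr : right_distributive L2scale +%R.
Proof.
move=> a v w; rewrite -(L2_reprK v) -(L2_reprK w) -L2_piD -!L2_piZ.
by rewrite scalerDr L2_piD.
Qed.
Let L2_scaleDl v : {morph L2scale^~ v : a b / a + b}.
Proof. by move=> a b; rewrite -(L2_reprK v) -!L2_piZ scalerDl L2_piD. Qed.

HB.instance Definition _ := GRing.Zmodule_isLmodule.Build R L2
  L2_scaleA L2_scale1 L2_scaleDr L2_scaleDl.

Lemma L2fun0 : {ae mu, forall x, (0 : L2) x = 0}.
Proof.
have -> : 0 = \pi_L2 (0 : preL2) :> L2 by rewrite !piE.
exact: (L2_piE 0).
Qed.

Lemma L2funD (v w : L2) : {ae mu, forall x, (v + w : L2) x = v x + w x}.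
Proof. by have := L2_piE (L2fun v + L2fun w); rewrite L2_piD !reprK. Qed.

Lemma L2funZ a (v : L2) : {ae mu, forall x, (a *: v : L2) x = a *: v x}.
Proof. exact: L2_piE. Qed.

Definition L2dot (v w : L2) : R := \int[mu]_x dotv (v x) (w x).

Lemma integrable_dotv (f g : preL2) :
  mu.-integrable setT (fun x => (dotv (f x) (g x))%:E).
Proof.
rewrite /dotv; under eq_fun do rewrite -sumEFin.
apply: integrable_sum => // i _.
apply/(Lfun1_integrable mu (fun x => f x 0 i * g x 0 i)).
by apply: Lfun2_mul_Lfun1; [case: f|case: g] => h /= /sqintP; exact.
Qed.

Lemma ae_eq_dot (f1 g1 f2 g2 : preL2) :
  {ae mu, forall x, f1 x = f2 x} -> {ae mu, forall x, g1 x = g2 x} ->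
  \int[mu]_x dotv (f1 x) (g1 x) = \int[mu]_x dotv (f2 x) (g2 x).
Proof.
move=> f12 g12; congr fine; apply: ae_eq_integral => //.
- by have /integrableP[] := integrable_dotv f1 g1.
- by have /integrableP[] := integrable_dotv f2 g2.
- by apply: filterS2 f12 g12 => x -> -> _.
Qed.

Lemma L2dotC v w : L2dot v w = L2dot w v.
Proof.
by congr fine; apply: eq_integral => x _; congr EFin; apply: eq_bigr => i _; rewrite mulrC.
Qed.

Lemma L2dotDl u v w : L2dot (u + v) w = L2dot u w + L2dot v w.
Proof.
rewrite -RintegralD//; [|exact: integrable_dotv..].
transitivity (\int[mu]_x dotv ((L2fun u + L2fun v) x) (w x)).
  by apply: ae_eq_dot; [exact: L2funD|exact: aeW].
apply: eq_Rintegral => x _; rewrite -big_split /=; apply: eq_bigr => i _.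
by rewrite [X in X * _]mxE mulrDl.
Qed.

Lemma L2dotZl a v w : L2dot (a *: v) w = a * L2dot v w.
Proof.
rewrite -RintegralZl//; last exact: integrable_dotv.
transitivity (\int[mu]_x dotv ((a *: L2fun v) x) (w x)).
  by apply: ae_eq_dot; [exact: L2funZ|exact: aeW].
apply: eq_Rintegral => x _; rewrite mulr_sumr; apply: eq_bigr => i _.
by rewrite [X in X * _]mxE mulrA.
Qed.

Lemma L2dot_ge0 v : 0 <= L2dot v v.
Proof. by apply: Rintegral_ge0 => x _; apply: sumr_ge0 => i _; exact: sqr_ge0. Qed.

Lemma L2dot_eq0 v : L2dot v v = 0 -> v = 0.
Proof.
move=> v0; have iv := integrable_dotv v v.
have : (\int[mu]_x `|(dotv (v x) (v x))%:E| = 0)%E.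
  transitivity (\int[mu]_x (dotv (v x) (v x))%:E)%E.
    apply: eq_integral => x _; rewrite gee0_abs// lee_fin.
    by apply: sumr_ge0 => i _; exact: sqr_ge0.
  by rewrite -[LHS]fineK ?integrable_fin_num//; congr EFin.
case/integrableP: iv => mv _ /(ae_eq_integral_abs mu measurableT mv) vv0.
apply: L2P; apply: filterS2 vv0 L2fun0 => x /(_ I) /= [] + ->.
move/eqP; rewrite psumr_eq0 => [/allP h|i _]; last exact: sqr_ge0.
apply/rowP => i; have := h i (mem_index_enum i).
by rewrite /= mulf_eq0 orbb mxE => /eqP.
Qed.

Definition L2norm v := Num.sqrt (L2dot v v).

Lemma L2_CauchySchwarz v w : L2dot v w ^+ 2 <= L2dot v v * L2dot w w.
Proof.
have [v0|v0] := eqVneq (L2dot v v) 0.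
  by rewrite (L2dot_eq0 v0) -(scale0r 0) !L2dotZl !mul0r expr0n.
have vgt0 : 0 < L2dot v v by rewrite lt_neqAle eq_sym v0 L2dot_ge0.
have := L2dot_ge0 (- L2dot v w *: v + L2dot v v *: w).
rewrite L2dotDl !L2dotZl ![L2dot _ (_ + _)]L2dotC !L2dotDl !L2dotZl (L2dotC w v).
rewrite (_ : _ + _ = L2dot v v * (L2dot v v * L2dot w w - L2dot v w ^+ 2)); last by ring.
by rewrite pmulr_rge0// subr_ge0.
Qed.

Let L2norm_triangle v w : L2norm (v + w) <= L2norm v + L2norm w.
Proof.
rewrite -ler_sqr ?nnegrE ?addr_ge0 ?sqrtr_ge0// sqrrD !sqr_sqrtr ?L2dot_ge0//.
rewrite L2dotDl ![L2dot _ (_ + _)]L2dotC !L2dotDl (L2dotC w v).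
suff : L2dot v w <= Num.sqrt (L2dot v v) * Num.sqrt (L2dot w w) by rewrite /L2norm; lra.
apply: le_trans (ler_norm _) _.
by rewrite -sqrtr_sqr -sqrtrM ?L2dot_ge0// ler_sqrt ?mulr_ge0 ?L2dot_ge0// L2_CauchySchwarz.
Qed.

Let L2normZ a v : L2norm (a *: v) = `|a| * L2norm v.
Proof.
rewrite /L2norm L2dotZl L2dotC L2dotZl mulrA -expr2 sqrtrM ?sqr_ge0//.
by rewrite sqrtr_sqr.
Qed.

Let L2norm_eq0 v : L2norm v = 0 -> v = 0.
Proof.
by move/eqP; rewrite sqrtr_eq0 => h; apply/L2dot_eq0/le_anti; rewrite h L2dot_ge0.
Qed.

HB.instance Definition _ := Lmodule_isNormed.Build R L2
  L2norm_triangle L2normZ L2norm_eq0.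

Lemma L2_normE (v : L2) : `|v| = Num.sqrt (L2dot v v).
Proof. by []. Qed.

End preL2.

Notation L2_on oOmega m := (L2 (lebesgue_on oOmega) m).

Section extended_real_functions.
Context (R : realType) (W : normedModType R).
Implicit Types (F : W -> \bar R) (ip : W -> W -> R).

Definition proper_fun F := (forall v, F v != -oo%E) /\ exists v, F v != +oo%E.

Definition convex_fun F := forall (v w : W) (t : R), 0 <= t <= 1 ->
  (F (t *: v + (1 - t) *: w)%R <= t%:E * F v + (1 - t)%:E * F w)%E.

Definition subdifferential ip F (v : W) : set W :=
  [set eta | forall w, (F v + (ip eta (w - v)%R)%:E <= F w)%E].

End extended_real_functions.

Section set_valued_derivatives.
Context (R : realType).

Definition tangent (W : normedModType R) (U : set W) (u : W) : set W :=
  [set z | exists (tau : R^nat) (w : W^nat),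
    [/\ forall i, 0 < tau i, tau @ \oo --> (0 : R), forall i, U (w i) &
        (fun i => (tau i)^-1 *: (w i - u)) @ \oo --> z]].

Definition geometrically_derivable (W : normedModType R) (U : set W) :=
  forall u z, U u -> tangent U u z ->
    exists (eps : R) (xi : R -> W),
      [/\ 0 < eps, forall t, 0 <= t <= eps -> U (xi t), xi 0 = u &
          t^-1 *: (xi t - xi 0) @[t --> 0^'+] --> z].

Definition conv_hull (W : lmodType R) (A : set W) : set W :=
  smallest (@convex_set R W) A.

Context (Q W : normedModType R).
Implicit Types S : Q -> set W.

Definition graph S : set (Q * W) := [set qw | S qw.1 qw.2].

Definition proto_differentiable S := geometrically_derivable (graph S).

Definition graph_deriv S (q : Q) (w : W) (dq : Q) : set W :=
  [set dw | tangent (graph S) (q, w) (dq, dw)].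

Definition conv_graph_deriv S (q : Q) (w : W) (dq : Q) : set W :=
  [set dw | conv_hull (graph (graph_deriv S q w)) (dq, dw)].

End set_valued_derivatives.

(* D2 u h k is the second derivative: D2 u h is the increment of the linear
   operator 'd K u in direction h; limits are in the operator norms. *)
Section C2.
Context (R : realType) (X Y : normedModType R).

Definition C2 (K : X -> Y) :=
  (forall u, differentiable K u) /\
  exists D2 : X -> X -> X -> Y,
    [/\ forall u h, linear (D2 u h),
        forall u k, linear (fun h => D2 u h k),
        forall u, exists C : R, forall h k, `|D2 u h k| <= C * `|h| * `|k|,
        forall u (e : R), 0 < e -> \forall h \near (0 : X), forall k,
          `|'d K (u + h) k - 'd K u k - D2 u h k| <= e * `|h| * `|k| &
        forall u (e : R), 0 < e -> \forall u' \near u, forall h k,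
          `|D2 u' h k - D2 u h k| <= e * `|h| * `|k|].

End C2.

Definition cone (R : realType) (W : lmodType R) (V : set W) :=
  forall (t : R) z, 0 < t -> V z -> V (t *: z).

Section L2_operators.
Context d (T : measurableType d) (R : realType).
Variable mu : {measure set T -> \bar R}.

Definition polar m (V : set (L2 mu m)) : set (L2 mu m) :=
  [set z | forall z', V z' -> L2dot z z' <= 0].

(* Well-defined for bounded linear A by the Riesz representation theorem. *)
Definition adjoint m1 m2 (A : L2 mu m1 -> L2 mu m2) (y : L2 mu m2) : L2 mu m1 :=
  xget 0 [set x | forall h, L2dot (A h) y = L2dot h x].

(* The convention of convex analysis is oo - oo = +oo, whereas the library's
   integral, being int f^+ - int f^-, uses oo - oo = -oo. *)
Definition integral_functional m (f : 'rV[R]_m -> \bar R) (v : L2 mu m) : \bar R :=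
  if (\int[mu]_x (fun y => f (v y))^\+ x == +oo)%E then +oo%E
  else (\int[mu]_x f (v x))%E.

Definition regularized m (gamma : R) (F : L2 mu m -> \bar R) (v : L2 mu m) : \bar R :=
  (F v + (gamma / 2 * `|v| ^+ 2)%:E)%E.

Definition subdiff_regularized m (gamma : R) (f : 'rV[R]_m -> \bar R) :
    L2 mu m -> set (L2 mu m) :=
  subdifferential (@L2dot _ _ _ mu m) (regularized gamma (integral_functional f)).

Context (m1 m2 : nat).
Local Notation X := (L2 mu m1).
Local Notation Y := (L2 mu m2).
Implicit Types (K : X -> Y) (dF : Y -> set Y).

Definition optimality_conditions (alpha : R) K dF (dy : Y) (u : X) (v : Y) :=
  alpha *: u + adjoint ('d K u) v = 0 /\ dF v (K u - dy).

Definition adjoint_hessian K (u : X) (v : Y) : X -> X :=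
  'd (fun u' => adjoint ('d K u') v) u.

(* pinv setT G is the inverse of G when G is bijective *)
Definition Bbar (alpha : R) K (u : X) (v : Y) (z : Y) : Y :=
  'd K u (pinv setT (fun xi => alpha *: xi + adjoint_hessian K u v xi)
           (adjoint ('d K u) z)).

Definition bbar (B : Y -> Y) dF (V : Y -> Y -> set Y) (v eta : Y) : \bar R :=
  ereal_sup [set ereal_inf
    [set r | exists z nu v' eta',
       [/\ z != 0 /\ V v' eta' z, polar (V v' eta') nu, dF v' eta',
           `|v' - v| < t /\ `|eta' - eta| < t &
           r = (`|B z - nu| / `|z|)%:E]] | t in [set t : R | 0 < t]].

End L2_operators.

(* Main.v *)
(** Write v = J p and eta = gamma v + (p - v) / l with the pointwise proximal map
    J of l f: then p |-> (v, eta) parametrizes the graph of the subdifferential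
    of F_gamma, and the perturbed optimality conditions say that the residual
    (alpha u + K'(u)^* v, K u - dy - eta) vanishes at (u, p). At the solution
    (uhat, vhat) for dy = 0 it has norm |dy|, so it is enough to find, at each
    nearby (u, p), a direction along which the norm of the residual decreases at
    a rate proportional to itself, with a controlled speed: the Ekeland-Caristi
    argument then gives a zero at a distance at most ell |dy|.

    Since the subdifferential of f is proto-differentiable, J is directionally
    differentiable, pointwise and by dominated convergence in L2. Freezing the
    derivatives at (uhat, vhat) and eliminating u, the direction is the solution
    of w + e z + Bbar z = r with (z, w) tangent to the graph; the small e > 0
    makes this a contraction problem. The bound |z| <= C |r|, uniform in e,
    comes from <w - gamma z, z> >= 0 if gamma > 0. Otherwise, z lies in V, where
    |Bbar z| >= c |z|, hence <Bbar z, z> >= c' |z|^2, because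
    |Bbar z|^2 <= kappa <Bbar z, z>. *)

Require Import Defs.
From HB Require Import structures.
From mathcomp Require Import all_boot all_order all_algebra.
From mathcomp Require Import all_classical all_reals all_analysis.
From mathcomp Require Import measurable_realfun ring lra.

Set Implicit Arguments.
Unset Strict Implicit.
Unset Printing Implicit Defensive.

Import Order.TTheory GRing.Theory Num.Theory.
Import numFieldNormedType.Exports.

Local Open Scope classical_set_scope.
Local Open Scope ring_scope.

(** * Resolvents of subdifferentials in Euclidean space *)

(** [J] is only directionally differentiable: its derivative need be neither linear in the direction
    nor continuous in the base point, which rules out an implicit function theorem. The decrease
    argument asks for the directional derivative at the current [p] alone, while the smooth data
    stay frozen at the solution. The regularization [e] is not sent to zero: it costs an error
    [e |z|] in the residual, and since the bound on [z] is uniform in [e], a fixed small [e] makes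
    this error a small fraction of the residual. This dictates the order of choices: the bounds on
    the direction, then [e], then the parameter [l] of [J], which the contraction requires to be
    small relative to [e]; hence [J] itself depends on [e]. The inequality [<w - gamma z, z> >= 0]
    is the firm nonexpansiveness of [J], inherited by its derivative. *)

Section dotv_theory.
Context (R : realType) (m : nat).
Implicit Types a b c : 'rV[R]_m.

Lemma dotvC a b : dotv a b = dotv b a.
Proof. by apply: eq_bigr => i _; rewrite mulrC. Qed.

Lemma dotvDl a b c : dotv (a + b) c = dotv a c + dotv b c.
Proof. by rewrite -big_split; apply: eq_bigr => i _; rewrite /= mxE mulrDl. Qed.

Lemma dotvDr a b c : dotv c (a + b) = dotv c a + dotv c b.
Proof. by rewrite dotvC dotvDl !(dotvC c). Qed.

Lemma dotvZl k a b : dotv (k *: a) b = k * dotv a b.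
Proof. by rewrite /dotv mulr_sumr; apply: eq_bigr => i _; rewrite mxE mulrA. Qed.

Lemma dotvZr k a b : dotv b (k *: a) = k * dotv b a.
Proof. by rewrite dotvC dotvZl dotvC. Qed.

Lemma dotvNl a b : dotv (- a) b = - dotv a b.
Proof. by rewrite -scaleN1r dotvZl mulN1r. Qed.

Lemma dotvNr a b : dotv b (- a) = - dotv b a.
Proof. by rewrite dotvC dotvNl dotvC. Qed.

Lemma dotvBl a b c : dotv (a - b) c = dotv a c - dotv b c.
Proof. by rewrite dotvDl dotvNl. Qed.

Lemma dotv0l a : dotv 0 a = 0.
Proof. by rewrite -(scale0r 0) dotvZl mul0r. Qed.

Definition dotvE := (dotvDl, dotvDr, dotvZl, dotvZr, dotvNl, dotvNr).

Lemma dotv_ge0 a : 0 <= dotv a a.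
Proof. by apply: sumr_ge0 => i _; exact: sqr_ge0. Qed.

Lemma dotv_eq0 a : dotv a a = 0 -> a = 0.
Proof.
move/eqP; rewrite psumr_eq0 => [/allP h|i _]; last exact: sqr_ge0.
by apply/rowP => i; have := h i (mem_index_enum i); rewrite /= mulf_eq0 orbb mxE => /eqP.
Qed.

Lemma ler_mx_norm_coord a (c : R) : 0 <= c ->
  (`|a| <= c) <-> (forall i, `|a 0 i| <= c).
Proof.
move=> c0; rewrite [`|a|]/Num.norm /= mx_normrE; split => [h i|h].
  by apply: le_trans h; apply/bigmax_geP; right; exists (0, i).
by apply/bigmax_leP; split => // -[i j] _ /=; rewrite (ord1 i).
Qed.

Lemma norm_coord_le a i : `|a 0 i| <= `|a|.
Proof. by have /ler_mx_norm_coord := lexx `|a|; apply. Qed.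

Lemma sqr_norm_le_dotv a : `|a| ^+ 2 <= dotv a a.
Proof.
rewrite -[leRHS]sqr_sqrtr ?dotv_ge0// ler_sqr ?nnegrE ?sqrtr_ge0//.
apply/ler_mx_norm_coord; first exact: sqrtr_ge0.
move=> i; rewrite -sqrtr_sqr ler_sqrt ?dotv_ge0// /dotv (bigD1 i)//= -expr2 lerDl.
by apply: sumr_ge0 => j _; exact: sqr_ge0.
Qed.

Lemma dotv_le_norm a : dotv a a <= m%:R * `|a| ^+ 2.
Proof.
rewrite /dotv -[m in m%:R]card_ord -sum1_card natr_sum mulr_suml.
apply: ler_sum => i _; rewrite mul1r -expr2 -real_normK ?num_real//.
by rewrite lerXn2r ?nnegrE//; exact: norm_coord_le.
Qed.

Lemma dotv_cvg (T : Type) (F : set_system T) {FF : Filter F} (g h : T -> 'rV[R]_m) a b :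
  g x @[x --> F] --> a -> h x @[x --> F] --> b -> dotv (g x) (h x) @[x --> F] --> dotv a b.
Proof.
move=> ga hb; rewrite /dotv.
apply: cvg_big => [|i _]; first exact: add_continuous.
apply: cvgM.
  exact: (cvg_comp _ _ ga (@coord_continuous _ _ _ 0 i a)).
exact: (cvg_comp _ _ hb (@coord_continuous _ _ _ 0 i b)).
Qed.

End dotv_theory.

(** The sublevel sets [B y] are totally ordered by inclusion, hence generate a filter. A cluster
    point of it is a minimizer, since lower semicontinuity keeps a sublevel set away from any point
    of strictly larger value. *)
Lemma lsc_compact_min (R : realType) (T : topologicalType) (g : T -> \bar R) (A : set T) :
  lower_semicontinuous g -> (forall x, g x != -oo%E) -> compact A -> A !=set0 ->
  exists2 p, A p & forall y, A y -> (g p <= g y)%E.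
Proof.
move=> lg gN cA [x0 Ax0].
pose B (y : T) : set T := [set z | A z /\ (g z <= g y)%E].
have FF : ProperFilter (filter_from A B).
  apply: filter_from_proper; last by move=> y Ay; exists y; split.
  apply: filter_from_filter; first by exists x0.
  move=> y z Ay Az; have [yz|/ltW zy] := leP (g y) (g z).
    by exists y => // t [At ty]; split; split => //; exact: le_trans yz.
  by exists z => // t [At tz]; split; split => //; exact: le_trans zy.
have [|p [Ap clp]] := cA _ FF; first by exists x0 => // z [].
exists p => // y Ay; rewrite leNgt; apply/negP => yp.
have [r yr] : exists r : R, g y = r%:E.
  by case: (g y) (gN y) yp => [r||] //; [move=> _ _; exists r|rewrite ltNge leey].
move: yp; rewrite yr => /lg[U pU Ur].
have [z [[_ zy] Uz]] := clp _ _ (ex_intro2 _ _ y Ay (@subset_refl _ (B y))) pU.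
by have := Ur _ Uz; rewrite ltNge -yr zy.
Qed.

Lemma closed_ball_rV_compact (R : realType) (m : nat) (p : 'rV[R]_m) (r : R) :
  compact [set y | `|p - y| <= r].
Proof.
apply: bounded_closed_compact; last exact: closed_closed_ball_.
exists (`|p| + r); split; first exact: num_real.
move=> M hM y /= yp; apply: le_trans (ltW hM).
rewrite -[y](subrK p) addrC; apply: le_trans (ler_normD _ _) _.
by rewrite lerD2l distrC.
Qed.

Section prox.
Context (R : realType) (m : nat).
Local Notation E := 'rV[R]_m.
Variables (f : E -> \bar R).
Hypotheses (pf : proper_fun f) (cf : convex_fun f) (lf : lower_semicontinuous f).
Local Notation sub := (subdifferential (@dotv R m) f).

(** An infinite value at [p] would force [f] to be infinite everywhere. *)
Lemma subdifferential_fin p e : sub p e -> f p \is a fin_num.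
Proof.
move=> h; have [fN [w fw]] := pf; have := h w; move: fw (fN p).
rewrite fin_numE => fw -> /=; apply: contraTneq => ->.
by rewrite addye// leye_eq.
Qed.

Lemma subdifferential_monotone p1 e1 p2 e2 : sub p1 e1 -> sub p2 e2 ->
  0 <= dotv (e1 - e2) (p1 - p2).
Proof.
move=> s1 s2; have := s1 p2; have := s2 p1.
rewrite -(fineK (subdifferential_fin s1)) -(fineK (subdifferential_fin s2)) -!EFinD !lee_fin.
by rewrite !dotvE; lra.
Qed.

(** On the unit ball around a point [p0] of finite value, [f] is bounded below by compactness;
    convexity along segments from [p0] extends the bound outside, with linear growth. This replaces
    an affine minorant and suffices for the coercivity of the proximal problem. *)
Lemma convex_linear_minorant : exists p0 (M : R), f p0 \is a fin_num /\
  forall y, ((- M * Num.max 1 `|p0 - y|)%:E <= f y)%E.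
Proof.
have [fN [p0 fp0]] := pf.
have fp0fin : f p0 \is a fin_num by rewrite fin_numE fN fp0.
have [q _ qmin] : exists2 q, `|p0 - q| <= 1 &
    forall y, `|p0 - y| <= 1 -> (f q <= f y)%E.
  apply: (lsc_compact_min lf fN (@closed_ball_rV_compact _ _ p0 1)).
  by exists p0; rewrite /= subrr normr0.
have [b bq] : exists b : R, (b%:E <= f q)%E.
  by case: (f q) (fN q) => [r||] // _; [exists r|exists 0; exact: leey].
have bmin y : `|p0 - y| <= 1 -> (b%:E <= f y)%E by move=> /qmin; exact: le_trans.
exists p0, (`|b| + `|fine (f p0)|); split => // y.
have [y1|y1] := leP `|p0 - y| 1.
  apply: le_trans (bmin y y1); rewrite lee_fin mulr1.
  by have := ler_norm (- b); rewrite normrN; have := normr_ge0 (fine (f p0)); lra.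
have s0 : 0 < `|p0 - y| by exact: lt_trans ltr01 y1.
set s := `|p0 - y| in y1 s0 *.
(* The weight [s^-1] picks the point of the segment from [p0] to [y] at distance 1 from [p0], where
   the bound [b] applies. *)
have st : 0 <= s^-1 <= 1 by rewrite invr_ge0 ltW//= invf_le1// ltW.
have := @cf y p0 _ st; have := bmin (s^-1 *: y + (1 - s^-1) *: p0).
rewrite (_ : p0 - _ = s^-1 *: (p0 - y)); last first.
  by apply/rowP => i; rewrite !mxE; ring.
rewrite normrZ gtr0_norm ?invr_gt0// mulVf ?gt_eqF// => /(_ (lexx _)).
move=> /le_trans /[apply].
case: (f y) (fN y) => [r||] // _; last by rewrite leey.
rewrite -(fineK fp0fin) -!EFinM -EFinD !lee_fin /=; set g := fine _.
move=> h; have : s * b <= r + (s - 1) * g.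
  have := ler_wpM2l (ltW s0) h; rewrite (_ : s * (_ + _) = r + (s - 1) * g)//.
  by field; rewrite gt_eqF.
have := ler_wpM2l (ltW s0) (ler_norm (- b)); rewrite normrN.
have := ler_wpM2l (ltW s0) (ler_norm g).
have := ler_norm (- g); rewrite normrN.
have := normr_ge0 g.
nra.
Qed.

(** The point is the minimizer of [f + |x - .|^2 / (2 l)]. The quadratic term beats the linear
    minorant of [f], so that a minimizer over a large ball is global. *)
Lemma prox_exists (l : R) (x : E) : 0 < l -> exists p, sub p (l^-1 *: (x - p)).
Proof.
move=> l0; have [fN _] := pf; have [p0 [M [fp0 hM]]] := convex_linear_minorant.
pose q (y : E) : R := (2 * l)^-1 * dotv (x - y) (x - y).
have q0 y : 0 <= q y by rewrite mulr_ge0 ?dotv_ge0// invr_ge0 mulr_ge0// ltW.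
have qc y : q z @[z --> y] --> q y.
  rewrite /q; apply: (@cvgM _ _ (nbhs y) _ (fun=> (2 * l)^-1) (fun z => dotv (x - z) (x - z))).
    exact: cvg_cst.
  by apply: dotv_cvg; apply: cvgB; [exact: cvg_cst|exact: cvg_id|exact: cvg_cst|exact: cvg_id].
pose g (y : E) : \bar R := (f y + (q y)%:E)%E.
have gN y : g y != -oo%E by rewrite /g adde_eq_ninfty negb_or fN.
have lg : lower_semicontinuous g.
  move=> y a; rewrite /g -lteBlDr// => ay.
  have [b /andP[ab bf]] : exists b : R, (a - q y < b) && (b%:E < f y)%E.
    case: (f y) (fN y) ay => [r||]// _; last by exists (a - q y + 1); rewrite ltrDl ltr01 ltry.
    by rewrite lte_fin => h; exists ((a - q y + r) / 2); rewrite lte_fin midf_lt//= midf_lt.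
  have [U yU Ub] := lf bf.
  exists (U `&` [set z | a - b < q z]).
    apply: filterI => //; apply: (cvgr_gt (q y) (qc y)); lra.
  move=> z [/Ub bz /= az]; rewrite -lteBlDr//; apply: le_lt_trans bz.
  by rewrite -EFinB lee_fin; lra.
pose M' := `|M|; pose G := fine (g p0); pose D := `|p0 - x|.
have gp0 : g p0 = G%:E by rewrite /G /g fineK// fin_numD fp0.
(* For [s = |p0 - y| > r], the part [2 * D] gives [|x - y| >= s / 2], so [q y >= s^2 / (8 l)]; the
   last part makes this at least [s (M' + 1)], whence [g y >= s], and [s >= G] by the middle
   part. *)
pose r := 1 + 2 * D + (G + `|G|) + 8 * l * (M' + 1).
have r1 : 1 <= r.
  rewrite /r; have := normr_ge0 (p0 - x); have := ler_norm (- G); rewrite normrN.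
  have : 0 <= l * (M' + 1) by rewrite mulr_ge0 ?(ltW l0)// addr_ge0// normr_ge0.
  rewrite -/D; lra.
have [p _ pmin] : exists2 p, `|p0 - p| <= r & forall y, `|p0 - y| <= r -> (g p <= g y)%E.
  apply: (lsc_compact_min lg gN (@closed_ball_rV_compact _ _ p0 r)).
  by exists p0; rewrite /= subrr normr0; lra.
have {}pmin y : (g p <= g y)%E.
  have [/pmin//|rs] := leP `|p0 - y| r.
  have : (g p <= g p0)%E by apply: pmin; rewrite subrr normr0; lra.
  move=> /le_trans; apply; rewrite gp0 /g; apply: le_trans (leeD2r _ (hM y)).
  rewrite -EFinD lee_fin max_r; last lra.
  have : `|p0 - y| - D <= `|x - y|.
    rewrite lerBlDl (_ : p0 - y = (p0 - x) + (x - y)); last by rewrite subrKA.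
    exact: ler_normD.
  set s := `|p0 - y| in rs *; move=> sD.
  have s2 : s / 2 <= s - D.
    move: rs; rewrite /r; have := ler_norm (- G); rewrite normrN.
    have : 0 <= l * (M' + 1) by rewrite mulr_ge0 ?(ltW l0)// addr_ge0// normr_ge0.
    lra.
  have qs : s ^+ 2 / (8 * l) <= q y.
    rewrite /q mulrC (_ : (8 * l)^-1 = (2 * l)^-1 / 4); last by field; rewrite gt_eqF.
    rewrite -mulrA ler_wpM2l// ?invr_ge0 ?mulr_ge0 ?(ltW l0)//.
    apply: le_trans _ (sqr_norm_le_dotv _).
    have : (s / 2) ^+ 2 <= `|x - y| ^+ 2.
      rewrite lerXn2r ?nnegrE//; last exact: le_trans sD.
      by rewrite divr_ge0// /s.
    by rewrite expr_div_n; lra.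
  have s8 : s * (M' + 1) <= s ^+ 2 / (8 * l).
    rewrite ler_pdivlMr ?mulr_gt0// expr2 -mulrA ler_wpM2l//; first by rewrite /s.
    apply: le_trans (ltW rs); rewrite /r.
    have := ler_norm (- G); rewrite normrN.
    have : 0 <= D by rewrite /D.
    lra.
  have MM : M * s <= M' * s by rewrite ler_wpM2r ?ler_norm// /s.
  have : G <= s.
    have : 0 <= l * (M' + 1) by rewrite mulr_ge0 ?(ltW l0)// addr_ge0// normr_ge0.
    have : 0 <= D by rewrite /D.
    move: rs; rewrite /r; have := normr_ge0 G; have := ler_norm (- G); rewrite normrN; lra.
  lra.
have fp : f p \is a fin_num.
  have := pmin p0; rewrite gp0 /g; move: (fN p); rewrite fin_numE => -> /=.
  by apply: contraTneq => ->; rewrite addye// leye_eq.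
exists p => w; case: (f w) (fN w) (@cf w p) => [fw||]// _ cfw; last by rewrite leey.
rewrite -(fineK fp) -EFinD lee_fin; move: cfw; rewrite -(fineK fp); set fP := fine _ => cfw.
(* Minimality of [p] against [t w + (1 - t) p], divided by [t]; the remainder is linear in [t] and
   disappears as [t] tends to 0. *)
have key t : 0 < t -> t <= 1 ->
    l^-1 * dotv (x - p) (w - p) - t * ((2 * l)^-1 * dotv (w - p) (w - p)) <= fw - fP.
  move=> t0 t1; have := pmin (t *: w + (1 - t) *: p); rewrite /g.
  have := cfw t; rewrite (ltW t0) t1 => /(_ isT) h1 h2.
  have := le_trans h2 (leeD2r _ h1); rewrite -!EFinM -(fineK fp) -!EFinD lee_fin -/fP /q.
  rewrite (_ : x - (_ + _) = (x - p) - t *: (w - p)); last first.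
    by apply/rowP => i; rewrite !mxE; ring.
  move: (x - p) (w - p) => X W; rewrite !dotvE (dotvC W X).
  set a := dotv X W; set b := dotv W W; set c := dotv X X => h.
  rewrite -(ler_pM2l t0).
  have -> : t * (l^-1 * a - t * ((2 * l)^-1 * b)) = (2 * l)^-1 * (2 * t * a - t * (t * b)).
    by field; rewrite gt_eqF.
  move: h; rewrite !mulrBr !mulrDl.
  lra.
rewrite dotvZl -/fP addrC -lerBrDr.
apply/ler_addgt0Pr => e e0; rewrite -lerBlDr.
set b := (2 * l)^-1 * dotv (w - p) (w - p) in key.
have b0 : 0 <= b by rewrite mulr_ge0 ?dotv_ge0// invr_ge0 mulr_ge0// ltW.
have t0 : 0 < Num.min 1 (e / (b + 1)) by rewrite lt_min ltr01 divr_gt0//; lra.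
apply: le_trans (key _ t0 _); last by rewrite ge_min lexx.
rewrite lerD2l lerN2; apply: (@le_trans _ _ (e / (b + 1) * b)).
  by rewrite ler_wpM2r// ge_min lexx orbT.
by rewrite mulrAC ler_pdivrMr ?ler_wpM2l//; lra.
Qed.

End prox.

Lemma cvg_pair_seq (R : realType) (W1 W2 : normedModType R) (u : W1^nat) (v : W2^nat)
    (a : W1) (b : W2) :
  u @ \oo --> a -> v @ \oo --> b -> (fun i => (u i, v i)) @ \oo --> (a, b).
Proof. by move=> ua vb; exact: (@cvg_pair _ _ _ _ (nbhs a) (nbhs b)). Qed.

Lemma harmonic_cvg_right (R : realType) : (fun i => i.+1%:R^-1 : R) @ \oo --> (0 : R)^'+.
Proof.
move=> A [e /= e0 eA]; near_simpl; near=> i; apply: eA; last by rewrite /= invr_gt0.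
rewrite /ball /= sub0r normrN ger0_norm ?invr_ge0//.
by near: i; apply: (near_infty_natSinv_lt (PosNum e0)).
Unshelve. all: by end_near. Qed.

Lemma cvg0_squeeze (R : realType) (W : normedModType R) (u : W^nat) (v : R^nat) :
  (\forall i \near \oo, `|u i| <= v i) -> v @ \oo --> (0 : R) -> u @ \oo --> (0 : W).
Proof.
move=> uv /cvgr0Pnorm_lt v0; apply/cvgr0Pnorm_lt => e e0.
by apply: filterS2 uv (v0 e e0) => i /le_lt_trans uvi /(le_lt_trans (ler_norm _))/uvi.
Qed.

(** The resolvent of [l] times the subdifferential, encoded by its inclusion instead of the
    minimization; by [proxP] the default 0 does not interfere. *)
Definition prox (R : realType) (m : nat) (f : 'rV[R]_m -> \bar R) (l : R) (x : 'rV[R]_m) :=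
  xget 0 [set p | subdifferential (@dotv R m) f p (l^-1 *: (x - p))].

Section prox_theory.
Context (R : realType) (m : nat).
Local Notation E := 'rV[R]_m.
Variables (f : E -> \bar R).
Hypotheses (pf : proper_fun f) (cf : convex_fun f) (lf : lower_semicontinuous f).
Local Notation sub := (subdifferential (@dotv R m) f).
Variable l : R.
Hypothesis l0 : 0 < l.
Local Notation J := (prox f l).

Lemma proxP x : sub (J x) (l^-1 *: (x - J x)).
Proof. by rewrite /prox; case: xgetP => // h; have [p /h] := prox_exists pf cf lf x l0. Qed.

Lemma prox_firm x y : dotv (J x - J y) (J x - J y) <= dotv (x - y) (J x - J y).
Proof.
have := subdifferential_monotone pf (proxP x) (proxP y).
rewrite -scalerBr dotvZl pmulr_rge0 ?invr_gt0//.
rewrite (_ : x - J x - (y - J y) = (x - y) - (J x - J y)) ?dotvBl ?subr_ge0//.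
by rewrite !opprD !opprK addrACA.
Qed.

Lemma prox_nonexpansive x y : dotv (J x - J y) (J x - J y) <= dotv (x - y) (x - y).
Proof.
have := dotv_ge0 (x - y - (J x - J y)); have := prox_firm x y.
by move: (J x - J y) (x - y) => a b; rewrite !dotvE (dotvC a b); lra.
Qed.

(** Nonexpansiveness holds for [dotv]; passing to the maximum norm costs a factor, for which [m + 1]
    is a crude choice that stays invertible when [m = 0]. *)
Lemma prox_lipschitz x y : `|J x - J y| <= m.+1%:R * `|x - y|.
Proof.
rewrite -ler_sqr ?nnegrE ?mulr_ge0//; apply: le_trans (sqr_norm_le_dotv _) _.
apply: le_trans (prox_nonexpansive x y) _; apply: le_trans (dotv_le_norm _) _.
rewrite exprMn ler_wpM2r ?exprn_ge0// -natrX ler_nat.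
by rewrite (leq_trans (leqnSn m))// leq_pmulr.
Qed.

(** By monotonicity, two points [(p, e)] of the graph with the same [p + l *: e] coincide. *)
Lemma prox_unique p e : sub p e -> J (p + l *: e) = p.
Proof.
move=> pe; have := subdifferential_monotone pf (proxP (p + l *: e)) pe.
set q := J _; rewrite (_ : _ - e = - l^-1 *: (q - p)); last first.
  by apply/rowP => i; rewrite !mxE; field; rewrite gt_eqF.
rewrite dotvZl mulNr oppr_ge0 pmulr_rle0 ?invr_gt0// => h.
by apply/eqP; rewrite -subr_eq0; apply/eqP/dotv_eq0/le_anti; rewrite h dotv_ge0.
Qed.

Lemma prox_continuous : continuous J.
Proof.
move=> x; apply/(@cvgrPdist_lt _ _ _ (nbhs x)) => e e0.
have r0 : 0 < m.+1%:R^-1 * e by rewrite mulr_gt0// invr_gt0.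
apply: filterS (nbhsx_ballx x _ r0) => y; rewrite -ball_normE /= => xy.
by apply: le_lt_trans (prox_lipschitz _ _) _; rewrite -ltr_pdivlMl.
Qed.

Hypothesis df : proto_differentiable sub.

(* A cluster point z of the difference quotients gives a tangent vector of the
   graph; the curve provided by proto-differentiability then shows, with the
   Lipschitz continuity of J, that the whole sequence converges to z. *)
Lemma prox_dirdiff x d :
  cvgn (fun i => i.+1%:R *: (J (x + i.+1%:R^-1 *: d) - J x)).
Proof.
pose s i := i.+1%:R *: (J (x + i.+1%:R^-1 *: d) - J x).
have sb i : `|s i| <= m.+1%:R * `|d|.
  rewrite normrZ ger0_norm//; have := prox_lipschitz (x + i.+1%:R^-1 *: d) x.
  rewrite addrAC subrr add0r normrZ ger0_norm ?invr_ge0// => /(ler_wpM2l (ler0n R i.+1)).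
  by move=> /le_trans; apply; rewrite mulrCA mulVKf.
have [|z [_ clz]] := @closed_ball_rV_compact R m 0 (m.+1%:R * `|d|) (s @ \oo) _.
  by exists 0%N => // i _; rewrite /= sub0r normrN; exact: sb.
have /choice[k kP] : forall j, exists i, (j <= i)%N /\ `|z - s i| < j.+1%:R^-1.
  move=> j; have [||y [[i /= ji <-] yz]] := clz [set s i | i in [set i | (j <= i)%N]]
      (ball z j.+1%:R^-1).
  - by exists j => // i /= ji; exists i.
  - exact: nbhsx_ballx.
  - by exists i; split => //; rewrite -ball_normE in yz.
pose tau j : R := (k j).+1%:R^-1.
have tau0 j : 0 < tau j by rewrite invr_gt0.
have tau_le j : tau j <= j.+1%:R^-1.
  by rewrite lef_pV2 ?posrE// ler_nat ltnS; have [] := kP j.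
have tau_cvg : tau @ \oo --> (0 : R).
  apply: (squeeze_cvgr _ (cvg_cst 0) (@cvg_harmonic R)).
  by near=> j; rewrite ltW//= tau_le.
have skz : s (k j) @[j --> \oo] --> z.
  apply/cvgrPdist_lt => e e0; near=> j; apply: lt_trans (proj2 (kP j)) _.
  by near: j; apply: near_infty_natSinv_lt (PosNum e0).
have tgt : tangent (graph sub) (J x, l^-1 *: (x - J x)) (z, l^-1 *: (d - z)).
  exists tau, (fun j => (J (x + tau j *: d), l^-1 *: (x + tau j *: d - J (x + tau j *: d)))).
  split => //; first by move=> j; exact: proxP.
  rewrite (_ : (fun j => _) = fun j => (s (k j), l^-1 *: (d - s (k j)))).
    by apply: cvg_pair_seq => //=; apply: cvgZl_tmp; apply: cvgB => //; exact: cvg_cst.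
  apply/funext => j; congr pair; first by rewrite /= /s /tau invrK.
  rewrite /= /s /tau invrK; apply/rowP => i; rewrite !mxE.
  by field; rewrite nat1r pnatr_eq0 gt_eqF.
have [eps [xi [eps0 xiU xi0 xiz]]] :=
  @df (J x, l^-1 *: (x - J x)) _ (proxP x) tgt.
(* By [prox_unique], [J] maps [w t] to the first component of the curve, whose quotients converge to
   [z]. As [w] leaves [x] in the direction [d], the Lipschitz bound transfers this limit to the
   quotients along [x + t d]. *)
pose w t := (xi t).1 + l *: (xi t).2.
have Jw t : 0 <= t <= eps -> J (w t) = (xi t).1 by move=> /xiU/prox_unique.
have xih : i.+1%:R *: (xi i.+1%:R^-1 - xi 0) @[i --> \oo] --> (z, l^-1 *: (d - z)).
  have := cvg_comp _ _ (@harmonic_cvg_right R) xiz; apply: cvg_trans.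
  by apply: near_eq_cvg; apply: nearW => i; rewrite /= invrK.
have xi1 : i.+1%:R *: ((xi i.+1%:R^-1).1 - J x) @[i --> \oo] --> z.
  have := cvg_comp _ _ xih cvg_fst; rewrite xi0; apply.
have xi2 : i.+1%:R *: ((xi i.+1%:R^-1).2 - l^-1 *: (x - J x)) @[i --> \oo] --> l^-1 *: (d - z).
  have := cvg_comp _ _ xih cvg_snd; rewrite xi0; apply.
have wd : i.+1%:R *: (w i.+1%:R^-1 - x) @[i --> \oo] --> d.
  have {1}-> : d = z + l *: (l^-1 *: (d - z)).
    by rewrite scalerA mulfV ?lt0r_neq0// scale1r addrC subrK.
  rewrite (_ : (fun i => _) = fun i => i.+1%:R *: ((xi i.+1%:R^-1).1 - J x) +
     l *: (i.+1%:R *: ((xi i.+1%:R^-1).2 - l^-1 *: (x - J x)))).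
    by apply: cvgD => //; exact: cvgZl_tmp.
  apply/funext => i; rewrite /w; case: (xi _) => a b /=.
  apply/rowP => j; rewrite !mxE; field; exact: lt0r_neq0.
apply/cvg_ex; exists z.
rewrite -[z]addr0.
rewrite (_ : (fun i => _) = fun i => i.+1%:R *: ((xi i.+1%:R^-1).1 - J x) +
   i.+1%:R *: (J (x + i.+1%:R^-1 *: d) - (xi i.+1%:R^-1).1)); last first.
  by apply/funext => i; rewrite -scalerDr; congr (_ *: _); rewrite [RHS]addrC subrKA.
apply: cvgD => //.
have wd0 : m.+1%:R * `|d - i.+1%:R *: (w i.+1%:R^-1 - x)| @[i --> \oo] --> (0 : R).
  rewrite -[0](mulr0 m.+1%:R) -[X in _ * X](normr0 E) -[X in `|X|](subrr d).
  by apply: cvgM; [exact: cvg_cst|apply: cvg_norm; apply: cvgB => //; exact: cvg_cst].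
apply: cvg0_squeeze wd0.
near=> i; rewrite normrZ ger0_norm//.
have ieps : (i.+1%:R^-1 : R) <= eps.
  by near: i; apply: filterS (near_infty_natSinv_lt (PosNum eps0)) => i /ltW.
rewrite -Jw ?invr_ge0 ?ler0n//; apply: le_trans (ler_wpM2l (ler0n _ _) (prox_lipschitz _ _)) _.
rewrite mulrCA ler_wpM2l//.
rewrite (_ : d - _ = i.+1%:R *: (x + i.+1%:R^-1 *: d - w i.+1%:R^-1)).
  by rewrite normrZ ger0_norm.
move: (w _) => a; apply/rowP => j; rewrite !mxE; field.
by rewrite nat1r pnatr_eq0.
Unshelve. all: by end_near. Qed.

End prox_theory.

(** * Completeness of L2 *)

Section real_geometric.
Context (R : realType).

Lemma geometric_step_cvg (a : R^nat) (C : R) :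
  (forall k, `|a k.+1 - a k| <= C * 2^-1 ^+ k) ->
  cvgn a /\ forall k, `|limn a - a k| <= 2 * C * 2^-1 ^+ k.
Proof.
move=> h; have C0 : 0 <= C by have := h 0%N; rewrite expr0 mulr1; exact: le_trans.
have bnd k n : `|a (k + n)%N - a k| <= C * (2 * 2^-1 ^+ k - 2 * 2^-1 ^+ (k + n)).
  elim: n => [|n IHn]; first by rewrite addn0 !subrr normr0 mulr0.
  rewrite -(subrKA (a (k + n)%N)) addnS; apply: le_trans (ler_normD _ _) _.
  apply: le_trans (lerD (h _) IHn) _; rewrite -mulrDr ler_wpM2l// exprS; lra.
have bnd2 k n : (k <= n)%N -> `|a n - a k| <= 2 * C * 2^-1 ^+ k.
  move=> kn; rewrite -(subnKC kn); apply: le_trans (bnd _ _) _.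
  have q0 : 0 <= 2^-1 ^+ (k + (n - k)) :> R by rewrite exprn_ge0// invr_ge0.
  have := mulr_ge0 C0 q0.
  by rewrite mulrBr; lra.
have small : 2 * C * 2^-1 ^+ k @[k --> \oo] --> (0 : R).
  rewrite -[0](mulr0 (2 * C)); apply: cvgM; first exact: cvg_cst.
  by apply: cvg_expr; rewrite ger0_norm ?invr_ge0// invf_lt1// ltr1n.
have ca : cvgn a.
  apply: R_complete; apply: cauchy_exP => e e0.
  have /cvgr0Pnorm_lt/(_ e e0)[N _ NP] := small.
  exists (a N), N => // n /= Nn; rewrite -ball_normE /= distrC.
  apply: le_lt_trans (bnd2 _ _ Nn) _; apply: le_lt_trans (NP N (leqnn _)).
  exact: ler_norm.
split => // k.
have hl : `|a n - a k| @[n --> \oo] --> `|limn a - a k|.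
  by apply: cvg_norm; apply: cvgB => //; exact: cvg_cst.
rewrite -(cvg_lim _ hl)//; apply: limr_le; first by apply/cvg_ex; eexists; exact: hl.
by exists k => // n /= kn; exact: bnd2.
Qed.

End real_geometric.

Section L2_theory.
Context d (T : measurableType d) (R : realType).
Variable mu : {measure set T -> \bar R}.

Section dim.
Variable m : nat.
Implicit Types (u v w : L2 mu m).

Lemma L2dotDr u v w : L2dot w (u + v) = L2dot w u + L2dot w v.
Proof. by rewrite L2dotC L2dotDl !(L2dotC w). Qed.

Lemma L2dotZr a u v : L2dot v (a *: u) = a * L2dot v u.
Proof. by rewrite L2dotC L2dotZl L2dotC. Qed.

Lemma L2dotNl u v : L2dot (- u) v = - L2dot u v.
Proof. by rewrite -scaleN1r L2dotZl mulN1r. Qed.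

Lemma L2dotNr u v : L2dot v (- u) = - L2dot v u.
Proof. by rewrite L2dotC L2dotNl L2dotC. Qed.

Lemma L2dot0l u : L2dot 0 u = 0.
Proof. by rewrite -(scale0r 0) L2dotZl mul0r. Qed.

Definition L2dotE := (L2dotDl, L2dotDr, L2dotZl, L2dotZr, L2dotNl, L2dotNr).

Lemma L2_sqr_norm v : `|v| ^+ 2 = L2dot v v.
Proof. by rewrite L2_normE sqr_sqrtr ?L2dot_ge0. Qed.

Lemma L2dot_le_norm u v : `|L2dot u v| <= `|u| * `|v|.
Proof.
rewrite !L2_normE -sqrtrM ?L2dot_ge0// -sqrtr_sqr ler_sqrt ?mulr_ge0 ?L2dot_ge0//.
exact: L2_CauchySchwarz.
Qed.

Lemma L2dot_norm_le u v : L2dot u v <= `|u| * `|v|.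
Proof. by apply: le_trans (L2dot_le_norm u v); exact: ler_norm. Qed.

Lemma L2_coord_measurable v i : measurable_fun setT (fun x => v x 0 i).
Proof.
case: (L2fun v) => g /= /sqintP/(_ i); rewrite inE => /andP[+ _].
by rewrite inE.
Qed.

End dim.

Lemma measurable_dotv m (g h : T -> 'rV[R]_m) :
  (forall i, measurable_fun setT (fun x => g x 0 i)) ->
  (forall i, measurable_fun setT (fun x => h x 0 i)) ->
  measurable_fun setT (fun x => dotv (g x) (h x)).
Proof. by move=> mg mh; apply: measurable_sum => i; exact: measurable_funM. Qed.

Lemma sqintI m (g : T -> 'rV[R]_m) (G : T -> R) :
  (forall i, measurable_fun setT (fun x => g x 0 i)) ->
  mu.-integrable setT (EFin \o G) -> (forall x, dotv (g x) (g x) <= G x) ->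
  g \in @sqint _ _ _ mu m.
Proof.
move=> mg iG gG; apply/sqintP => i; rewrite inE; apply/andP; split; rewrite inE//=.
rewrite /finite_norm unlock /=.
rewrite (_ : integral mu _ _ = \int[mu]_x ((g x 0 i) ^+ 2)%:E)%E; last first.
  by apply: eq_integral => x _; rewrite powR_mulrn// real_normK ?num_real.
apply: poweR_lty; apply: integrable_lty => //.
apply: (le_integrable _ _ _ iG) => //.
  by apply/measurable_EFinP; exact: measurable_funX.
move=> x _ /=; rewrite lee_fin ger0_norm ?sqr_ge0//.
apply: le_trans (ler_norm _); apply: le_trans (gG x).
rewrite /dotv (bigD1 i)//= -expr2 lerDl.
by apply: sumr_ge0 => j _; exact: sqr_ge0.
Qed.

Lemma L2B_ae m (v w : L2 mu m) : {ae mu, forall x, (v - w : L2 mu m) x = v x - w x}.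
Proof.
rewrite -scaleN1r; have h1 := L2funD v ((-1) *: w); have h2 := L2funZ (-1) w.
by apply: filterS2 h1 h2 => x -> ->; rewrite scaleN1r.
Qed.

Lemma L2_norm_int m (v : L2 mu m) (g : T -> 'rV[R]_m) :
  {ae mu, forall x, v x = g x} ->
  (forall i, measurable_fun setT (fun x => g x 0 i)) ->
  (`|v| ^+ 2)%:E = (\int[mu]_x (dotv (g x) (g x))%:E)%E.
Proof.
move=> vg mg; rewrite L2_sqr_norm /L2dot /Rintegral fineK; last first.
  by apply: integrable_fin_num => //; exact: integrable_dotv.
apply: ae_eq_integral => //.
- by have /integrableP[] := integrable_dotv v v.
- by apply/measurable_EFinP; exact: measurable_dotv.
- by apply: filterS vg => x -> _.
Qed.

End L2_theory.

Section L2_complete.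
Context d (T : measurableType d) (R : realType).
Variable mu : {measure set T -> \bar R}.

Lemma dotvD_le m (a b : 'rV[R]_m) : dotv (a + b) (a + b) <= 2 * dotv a a + 2 * dotv b b.
Proof. have := dotv_ge0 (a - b); rewrite !dotvE (dotvC b a); lra. Qed.

Lemma measurable_sub_coord m (g h : T -> 'rV[R]_m) i :
  measurable_fun setT (fun x => g x 0 i) -> measurable_fun setT (fun x => h x 0 i) ->
  measurable_fun setT (fun x => (g x - h x) 0 i).
Proof.
move=> mg mh; rewrite (_ : (fun x => _) = (fun x => g x 0 i - h x 0 i)).
  exact: measurable_funB.
by apply/funext => x; rewrite !mxE.
Qed.

Lemma L2_sub_measurable m (v w : L2 mu m) i : measurable_fun setT (fun x => (v x - w x) 0 i).
Proof. by apply: measurable_sub_coord; exact: L2_coord_measurable. Qed.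

(* With |v_(k+1) - v_k|^2 <= 8^-k, the function G = sum_k 4^k |v_(k+1)(x) - v_k(x)|^2
   is integrable, and where it is finite the increments are at most
   2^-k sqrt(G(x)). *)
Lemma L2_fast_cauchy m (v : nat -> L2 mu m) :
  (forall k, `|v k.+1 - v k| ^+ 2 <= 8^-1 ^+ k) -> cvgn v.
Proof.
move=> h.
pose D k x := dotv (v k.+1 x - v k x) (v k.+1 x - v k x).
have D0 k x : 0 <= D k x by exact: dotv_ge0.
have mD k : measurable_fun setT (D k).
  by apply: measurable_dotv => i; exact: L2_sub_measurable.
have iD k : (\int[mu]_x (D k x)%:E = (`|v k.+1 - v k| ^+ 2)%:E)%E.
  by apply/esym/L2_norm_int; [exact: L2B_ae|exact: L2_sub_measurable].
pose G x := (\sum_(0 <= k <oo) (4 ^+ k * D k x)%:E)%E.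
have t0 k x : (0 <= (4 ^+ k * D k x)%:E)%E by rewrite lee_fin mulr_ge0// exprn_ge0.
have mt k : measurable_fun setT (fun x => (4 ^+ k * D k x)%:E).
  by apply/measurable_EFinP; exact: measurable_funM.
have G0 x : (0 <= G x)%E by apply: nneseries_ge0.
have mG : measurable_fun setT G.
  rewrite (_ : G = fun x => (\sum_(0 <= k <oo | k \in xpredT) (4 ^+ k * D k x)%:E)%E)//.
  by apply: ge0_emeasurable_sum.
have iG : mu.-integrable setT G.
  apply/integrableP; split => //.
  rewrite (_ : (\int[mu]_x `|G x|)%E = (\int[mu]_x G x)%E); last first.
    by apply: eq_integral => x _; rewrite gee0_abs.
  rewrite integral_nneseries//.
  (* The majorant [4^k 8^-k = 2^-k], written as a standard geometric series. *)
  apply: (@le_lt_trans _ _ (\sum_(0 <= k <oo) (2 / (2 ^ (k + 1))%:R)%:E)%E).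
    apply: lee_nneseries => [k _ _|k _]; first by apply: integral_ge0.
    under eq_integral do rewrite EFinM.
    rewrite ge0_integralZl_EFin//; last 2 first.
    - by move=> x _; rewrite lee_fin.
    - exact/measurable_EFinP.
    rewrite iD -EFinM lee_fin; apply: le_trans (ler_wpM2l _ (h k)) _.
      by rewrite exprn_ge0.
    rewrite -exprMn addn1 expnS natrM invfM mulrA divff// mul1r natrX -exprVn.
    by rewrite (_ : 4 * 8^-1 = 2^-1)//; lra.
  by rewrite (cvg_lim _ (@cvg_geometric_eseries_half R 2 0))// ltry.
pose gr x := fine (G x).
pose N := [set x | G x = +oo%E].
have mN : measurable N.
  rewrite (_ : N = setT `&` G @^-1` [set +oo%E]) ?setTI//.
  by have := mG measurableT _ (emeasurable_set1 +oo%E); rewrite setTI.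
have Nae : {ae mu, forall x, ~ N x}.
  by apply: filterS (integrable_ae measurableT iG) => x /(_ I) + Nx; rewrite Nx.
have gr0 x : 0 <= gr x by rewrite fine_ge0.
have igr : mu.-integrable setT (EFin \o gr).
  apply: le_integrable iG => //; first by apply/measurable_EFinP; exact: measurableT_comp.
  by move=> x _ /=; rewrite /gr; case: (G x) (G0 x) => [r||]//= _; rewrite normr0 leey.
have Dgr k x : ~ N x -> D k x <= 4^-1 ^+ k * gr x.
  move=> Nx; have Gx : G x = (gr x)%:E.
    by rewrite /gr fineK// ge0_fin_numE// lt_neqAle leey andbT; apply/eqP.
  have := @nneseries_lim_ge R (fun k => (4 ^+ k * D k x)%:E) xpredT 0 k.+1.
  move=> /(_ (fun _ _ _ => t0 _ _)); rewrite -/(G x) Gx big_mkord big_ord_recr/=.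
  move=> hh; have : (((4 ^+ k * D k x)%:E) <= (gr x)%:E)%E.
    by apply: le_trans hh; rewrite leeDr// sume_ge0.
  by rewrite lee_fin exprVn ler_pdivlMl// exprn_gt0.
(* The representatives are cut to 0 on the null set [N], so that the limit exists at every point and
   is measurable as a pointwise limit. *)
pose a i x k : R := \1_(~` N) x * v k x 0 i.
have ma i k : measurable_fun setT (fun x => a i x k).
  apply: measurable_funM; last exact: L2_coord_measurable.
  by apply: measurable_indic; exact: measurableC.
have a_step i x k : `|a i x k.+1 - a i x k| <= Num.sqrt (gr x) * 2^-1 ^+ k.
  rewrite /a -mulrBr indicE; have [xN|xN] := boolP (x \in ~` N); last first.
    by rewrite mul0r normr0 mulr_ge0 ?sqrtr_ge0// exprn_ge0// invr_ge0.
  rewrite mul1r -ler_sqr ?nnegrE ?mulr_ge0 ?sqrtr_ge0// ?exprn_ge0// ?invr_ge0//.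
  rewrite exprMn sqr_sqrtr// -exprM mulnC exprM mulrC.
  rewrite (_ : 2^-1 ^+ 2 = 4^-1); last by rewrite exprVn -natrX.
  apply: le_trans (Dgr k x _); last by move/set_mem : xN.
  apply: le_trans (sqr_norm_le_dotv _).
  rewrite lerXn2r ?nnegrE//; have := norm_coord_le (v k.+1 x - v k x) i.
  by rewrite !mxE.
pose w0 x : 'rV[R]_m := \row_i limn (a i x).
pose ak k x : 'rV[R]_m := \row_i a i x k.
have w0_ak k x : dotv (w0 x - ak k x) (w0 x - ak k x) <= m%:R * 4 * gr x * 4^-1 ^+ k.
  apply: le_trans (dotv_le_norm _) _; rewrite -!mulrA ler_wpM2l//.
  have : `|w0 x - ak k x| <= 2 * Num.sqrt (gr x) * 2^-1 ^+ k.
    apply/ler_mx_norm_coord; first by rewrite !mulr_ge0 ?sqrtr_ge0// exprn_ge0// invr_ge0.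
    by move=> i; rewrite !mxE; have [_] := geometric_step_cvg (a_step i x); exact.
  move=> hle; apply: (@le_trans _ _ ((2 * Num.sqrt (gr x) * 2^-1 ^+ k) ^+ 2)).
    by rewrite lerXn2r// nnegrE// (le_trans _ hle).
  rewrite !exprMn sqr_sqrtr// -exprM (mulnC k) exprM.
  rewrite (_ : 2^-1 ^+ 2 = 4^-1 :> R); last by rewrite exprVn -natrX.
  by rewrite -natrX mulrA.
have mw0 i : measurable_fun setT (fun x => w0 x 0 i).
  apply: (@measurable_fun_cvg _ _ _ setT (fun k x => a i x k)) => // x _.
  by rewrite mxE; have [] := geometric_step_cvg (a_step i x).
have w0_sq : w0 \in @sqint _ _ _ mu m.
  apply: (@sqintI _ _ _ _ _ _ (fun x => 2 * (m%:R * 4 * gr x) + 2 * dotv (v 0%N x) (v 0%N x))) => //.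
    rewrite (_ : _ \o _ = fun x => (2%:E * ((m%:R * 4)%:E * (gr x)%:E) +
       2%:E * (dotv (v 0%N x) (v 0%N x))%:E)%E)//.
    apply: integrableD => //; first by do 2! apply: integrableZl => //.
    by apply: integrableZl => //; exact: integrable_dotv.
  move=> x; rewrite -(subrK (ak 0%N x) (w0 x)).
  apply: le_trans (dotvD_le _ _) _; rewrite lerD// ler_wpM2l//.
    by have := w0_ak 0%N x; rewrite expr0 mulr1.
  apply: ler_sum => i _; rewrite !mxE /a indicE.
  by case: (_ \in _); rewrite ?mul1r// !mul0r -expr2 sqr_ge0.
pose w : L2 mu m := (\pi_(L2 mu m) (PreL2 w0_sq))%qT.
have ww0 : {ae mu, forall x, w x = w0 x} := L2_piE (PreL2 w0_sq).
apply/cvg_ex; exists w; apply/cvgrPdist_lt => e e0.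
pose I := fine (\int[mu]_x (gr x)%:E)%E.
have I0 : 0 <= I by apply: fine_ge0; apply: integral_ge0 => x _; rewrite lee_fin.
have bnd k : `|w - v k| ^+ 2 <= m%:R * 4 * I * 4^-1 ^+ k.
  rewrite -lee_fin (@L2_norm_int _ _ _ _ _ _ (fun x => w0 x - v k x)).
  - rewrite mulrAC EFinM /I fineK; last exact: integrable_fin_num.
    rewrite -ge0_integralZl_EFin//; last 2 first.
    + by move=> x _; rewrite lee_fin.
    + by have /integrableP[] := igr.
    apply: ae_ge0_le_integral => //.
    + by move=> x _; rewrite lee_fin dotv_ge0.
    + apply/measurable_EFinP; apply: measurable_dotv => i;
        by apply: measurable_sub_coord => //; exact: L2_coord_measurable.
    + by move=> x _; rewrite -EFinM lee_fin !mulr_ge0// exprn_ge0// invr_ge0.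
    + apply/measurable_EFinP; apply: measurable_funM => //.
      by have /integrableP[/measurable_EFinP] := igr.
    + apply: filterS Nae => x Nx _; rewrite -EFinM lee_fin mulrAC.
      apply: le_trans (w0_ak k x); rewrite (_ : v k x = ak k x)//.
      apply/rowP => i; rewrite mxE /a indicE mem_set ?mul1r//.
  - have h1 := L2B_ae w (v k).
    by apply: filterS2 ww0 h1 => x <- ->.
  - by move=> i; apply: measurable_sub_coord => //; exact: L2_coord_measurable.
have small : m%:R * 4 * I * 4^-1 ^+ k @[k --> \oo] --> (0 : R).
  rewrite -[0](mulr0 (m%:R * 4 * I)); apply: cvgM; first exact: cvg_cst.
  by apply: cvg_expr; rewrite ger0_norm ?invr_ge0// invf_lt1// ltr1n.
have e20 : 0 < e ^+ 2 by rewrite exprn_gt0.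
have /cvgr0Pnorm_lt/(_ _ e20) := small.
apply: filterS => k /(le_lt_trans (ler_norm _))/(le_lt_trans (bnd k)).
by rewrite ltr_pXn2r ?nnegrE ?normr_ge0 ?(ltW e0)//.
Qed.

Lemma L2_complete m (F : set_system (L2 mu m)) : ProperFilter F -> cauchy F -> cvg F.
Proof.
move=> FF /cauchyP Fc; apply/cvg_ex.
(* Consecutive balls meet, so their centers are within [r k + r k.+1 <= 8^-k]; as this is at most 1,
   its square is no larger. *)
pose r k : R := 4^-1 * 8^-1 ^+ k.
have r0 k : 0 < r k by rewrite mulr_gt0 ?exprn_gt0// invr_gt0.
have /choice[c cP] k : exists c, F (ball c (r k)) by exact: Fc.
have cvgc : cvgn c.
  apply: L2_fast_cauchy => k.
  have [x [xk xk1]] := filter_ex (filterI (cP k) (cP k.+1)).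
  have q0 : 0 < (8^-1 : R) ^+ k by rewrite exprn_gt0// invr_gt0.
  have q1 : (8^-1 : R) ^+ k <= 1 by rewrite exprn_ile1 ?invr_ge0// invf_le1// ler1n.
  move: xk xk1; rewrite -!ball_normE /= => xk xk1.
  have : `|c k.+1 - c k| <= 8^-1 ^+ k.
    rewrite -(subrKA x); apply: le_trans (ler_normD _ _) _.
    apply: le_trans (lerD (ltW xk1) (ltW _)) _; first by rewrite distrC; exact: xk.
    by rewrite /r exprS; lra.
  move=> h; rewrite expr2; apply: le_trans (ler_pM _ _ h h) _ => //.
  by rewrite ler_piMl// ltW.
exists (limn c); apply/cvgrPdist_lt => e e0.
have e20 : 0 < e / 2 by rewrite divr_gt0.
have /cvgrPdist_lt/(_ _ e20) h1 := cvgc.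
have small : r k @[k --> \oo] --> (0 : R).
  rewrite -[0](mulr0 (4^-1)); apply: cvgM; first exact: cvg_cst.
  by apply: cvg_expr; rewrite ger0_norm ?invr_ge0// invf_lt1// ltr1n.
have /cvgr0Pnorm_lt/(_ _ e20) h2 := small.
have [k [/= k1 k2]] := filter_ex (filterI h1 h2).
apply: filterS (cP k) => x; rewrite -ball_normE /= => xk.
rewrite -(subrKA (c k)) [e]splitr; apply: le_lt_trans (ler_normD _ _) _.
rewrite ltrD//; apply: lt_trans xk _; apply: le_lt_trans k2; exact: ler_norm.
Qed.

HB.instance Definition _ m := Uniform_isComplete.Build (L2 mu m) (@L2_complete m).

End L2_complete.

(** * Integral functionals and their resolvents *)

Section measurable_composition.
Context d (T : measurableType d) (R : realType) (m : nat).
Variable g : T -> 'rV[R]_m.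
Hypothesis mg : forall i, measurable_fun setT (fun x => g x 0 i).

Lemma measurable_preimage_open (A : set 'rV[R]_m) : open A -> measurable (g @^-1` A).
Proof.
move=> oA; have := @measurable_coordP R m _ T g mg measurableT A (open_measurable_Rn oA).
by rewrite setTI.
Qed.

Lemma measurable_continuous_coord k (phi : 'rV[R]_m -> 'rV[R]_k) i :
  continuous phi -> measurable_fun setT (fun x => phi (g x) 0 i).
Proof.
move=> cphi; apply: (measurability _ (RGenOpens.measurableE R)).
move=> _ [_ [a [b ->] <-]]; rewrite setTI.
apply: (@measurable_preimage_open ((fun y => phi y 0 i) @^-1` `]a, b[%classic)).
apply: open_comp; last exact: interval_open.
move=> x _; apply: (@cvg_comp _ _ _ phi (fun y : 'rV[R]_k => y 0 i)); first exact: cphi.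
exact: coord_continuous.
Qed.

Lemma measurable_lsc (f : 'rV[R]_m -> \bar R) :
  lower_semicontinuous f -> measurable_fun setT (f \o g).
Proof.
move=> /lower_semicontinuousP lf; apply: (measurability _ (ErealGenOInfty.measurableE R)).
move=> /= _ [_ [a ->]] <-; rewrite setTI preimage_itvoy.
exact: (measurable_preimage_open (lf a)).
Qed.

End measurable_composition.

Section integral_lemmas.
Context d (T : measurableType d) (R : realType).
Variable mu : {measure set T -> \bar R}.
Local Open Scope ereal_scope.

Lemma ae_le_integral (g h : T -> \bar R) : mu.-integrable setT g -> mu.-integrable setT h ->
  {ae mu, forall x, g x <= h x} -> \int[mu]_x g x <= \int[mu]_x h x.
Proof.
move=> ig ih [N [mN N0 Ngh]].
rewrite (negligible_integral mN _ ig)// (negligible_integral mN _ ih)//.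
apply: le_integral.
- exact: measurableD.
- by apply: integrableS ig => //; exact: measurableD.
- by apply: integrableS ih => //; exact: measurableD.
- by move=> x /set_mem[_ /= Nx]; apply: contrapT => h'; apply: Nx; exact: Ngh.
Qed.

Lemma integral_funepos_lty (g h : T -> \bar R) : measurable_fun setT g ->
  mu.-integrable setT h -> {ae mu, forall x, g x <= h x} ->
  (\int[mu]_x g^\+ x < +oo).
Proof.
move=> mg ih gh.
apply: (@le_lt_trans _ _ (\int[mu]_x h^\+ x)); last exact: integral_funepos_lt_pinfty ih.
have mh : measurable_fun setT h by have /integrableP[] := ih.
apply: ae_ge0_le_integral => //; [exact: measurable_funepos|exact: measurable_funepos|].
apply: filterS gh => x gh _; rewrite !funeposE.
by rewrite ge_max !le_max gh lexx !orbT.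
Qed.

Lemma integrable_funepos_lty (g : T -> \bar R) : measurable_fun setT g ->
  \int[mu]_x g^\+ x < +oo -> \int[mu]_x g x != -oo -> mu.-integrable setT g.
Proof.
move=> mg gp; rewrite integralE => gN; apply/integrableP; split => //.
rewrite (_ : \int[mu]_x `|g x| = \int[mu]_x g^\+ x + \int[mu]_x g^\- x); last first.
  rewrite -ge0_integralD//; [|exact: measurable_funepos|exact: measurable_funeneg].
  by apply: eq_integral => x _; rewrite -[LHS]/((abse \o g) x) fune_abse.
apply: lte_add_pinfty => //; rewrite ltey; apply: contraNneq gN => ->.
have : \int[mu]_x g^\+ x \is a fin_num by rewrite ge0_fin_numE//; exact: integral_ge0.
by move=> /fineK <-.
Qed.

End integral_lemmas.

Section integral_functional_theory.
Context d (T : measurableType d) (R : realType) (m : nat).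
Variable mu : {measure set T -> \bar R}.
Variable f : 'rV[R]_m -> \bar R.
Hypotheses (lf : lower_semicontinuous f).
Local Notation F := (integral_functional f : L2 mu m -> \bar R).
Hypothesis pF : proper_fun F.
Implicit Types v w e eta : L2 mu m.
Local Notation sub := (subdifferential (@dotv R m) f).

Lemma measurable_integrand v : measurable_fun setT (fun x => f (v x)).
Proof. by apply: (measurable_lsc _ lf) => i; exact: L2_coord_measurable. Qed.

(** Properness of [F] excludes the value -oo, so a finite positive part makes the integrand
    integrable, and the convention of [integral_functional] agrees with the integral. *)
Lemma integral_functional_lty v :
  (\int[mu]_x (fun y => f (v y))^\+ x < +oo)%E ->
  mu.-integrable setT (fun x => f (v x)) /\ F v = (\int[mu]_x f (v x))%E.
Proof.
move=> h; have FE : F v = (\int[mu]_x f (v x))%E.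
  by rewrite /integral_functional ifF//; apply/negbTE; rewrite -ltey.
split=> //; apply: integrable_funepos_lty => //; first exact: measurable_integrand.
by rewrite -FE; have [+ _] := pF; exact.
Qed.

Lemma integral_functional_integrable v : F v != +oo%E ->
  mu.-integrable setT (fun x => f (v x)) /\ F v = (\int[mu]_x f (v x))%E.
Proof.
move=> Fv; apply: integral_functional_lty; rewrite ltey; apply: contra Fv => h.
by rewrite /integral_functional h.
Qed.

(** At a [w] of finite value, the pointwise inequality bounds [f (v x)] above by an integrable
    function, so it can be integrated. The quadratic terms leave [gamma / 2 |w - v|^2 >= 0]. *)
Lemma subdiff_regularized_pointwise (gamma : R) v e : 0 <= gamma ->
  {ae mu, forall x, sub (v x) (e x)} -> subdiff_regularized gamma f v (e + gamma *: v).
Proof.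
move=> g0 ve; have FN : forall w : L2 mu m, F w != -oo%E := proj1 pF.
suff : forall w : L2 mu m, (regularized gamma F v +
  (L2dot (e + gamma *: v) (w - v))%:E <= regularized gamma F w)%E by [].
move=> w.
suff h : (F v + (L2dot e (w - v))%:E <= F w)%E.
  rewrite /regularized; apply: (@le_trans _ _ (F v + (L2dot e (w - v))%:E +
      (gamma / 2 * `|w| ^+ 2)%:E)%E); last exact: leeD2r.
  rewrite -!addeA; apply: leeD => //; rewrite -!EFinD lee_fin.
  rewrite L2dotDl L2dotZl.
  have : 0 <= gamma / 2 * `|w - v| ^+ 2 by rewrite mulr_ge0 ?divr_ge0// sqr_ge0.
  rewrite !L2_sqr_norm !L2dotE (L2dotC w v).
  move: (L2dot v v) (L2dot v w) (L2dot w w) (L2dot e w) (L2dot e v) => a b c a1 b1.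
  by clear; lra.
have [->|Fw] := eqVneq (F w) +oo%E; first by rewrite leey.
have [iw FwE] := integral_functional_integrable Fw.
pose z : L2 mu m := w - v.
have idot := integrable_dotv e z.
have ae1 : {ae mu, forall x, (f (v x) + (dotv (e x) (z x))%:E <= f (w x))%E}.
  have hB := L2B_ae w v.
  by apply: filterS2 ve hB => x /(_ (w x)) + ->.
have ae2 : {ae mu, forall x, (f (v x) <= f (w x) - (dotv (e x) (z x))%:E)%E}.
  by apply: filterS ae1 => x; rewrite -leeBrDr//.
have iwB := integrableB measurableT iw idot.
have [iv FvE] := integral_functional_lty (integral_funepos_lty (measurable_integrand v) iwB ae2).
rewrite FvE FwE /L2dot /Rintegral fineK; last exact: integrable_fin_num.
rewrite -integralD//; apply: ae_le_integral => //.
exact: integrableD.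
Qed.

Hypotheses (pf : proper_fun f) (cf : convex_fun f).

(* Replacing v by the resolvent value p on sets where p - v is bounded (and of
   finite measure) lowers F_gamma too much, unless p = v; the restriction on l
   makes the gain |p - v|^2 / l win over gamma / 2 |p - v|^2. *)
Lemma pointwise_subdiff_regularized (gamma l : R) v eta : 0 <= gamma -> 0 < l ->
  l * gamma < 2 -> sigma_finite setT mu -> subdiff_regularized gamma f v eta ->
  {ae mu, forall x, prox f l (v x + l *: (eta - gamma *: v : L2 mu m) x) = v x}.
Proof.
move=> g0 l0 lg [S ST Sfin] veta.
pose e0 : L2 mu m := eta - gamma *: v.
pose p x := prox f l (v x + l *: e0 x).
have mp i : measurable_fun setT (fun x => p x 0 i).
  apply: (@measurable_continuous_coord _ _ _ _ (fun x => v x + l *: e0 x)).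
    move=> j; rewrite (_ : (fun x => _) = fun x => v x 0 j + l * e0 x 0 j).
      apply: measurable_funD; first exact: L2_coord_measurable.
      by apply: measurable_funM => //; exact: L2_coord_measurable.
    by apply/funext => x; rewrite !mxE.
  exact: prox_continuous.
pose q x := p x - v x.
have mq i : measurable_fun setT (fun x => q x 0 i).
  by apply: measurable_sub_coord => //; exact: L2_coord_measurable.
suff key i k : {ae mu, forall x, S i x -> dotv (q x) (q x) <= k%:R -> p x = v x}.
  have : {ae mu, forall x, forall i k, S i x -> dotv (q x) (q x) <= k%:R -> p x = v x}.
    by apply: ae_foralln => i; exact: ae_foralln.
  apply: filterS => x h.
  have [i _ Six] : (\bigcup_i S i) x by rewrite -ST.
  have [k qk] : exists k, dotv (q x) (q x) <= k%:R.
    by exists (Num.bound (dotv (q x) (q x))); rewrite ltW// archi_boundP// dotv_ge0.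
  exact: (h i k).
have [mS Slty] := Sfin i.
pose E := S i `&` [set x | dotv (q x) (q x) <= k%:R].
have mE : measurable E.
  apply: measurableI => //; rewrite -[X in measurable X]setTI.
  rewrite (_ : [set x | _] = (fun x => dotv (q x) (q x)) @^-1` `]-oo, k%:R]%classic); last first.
    by apply/seteqP; split => x /=; rewrite in_itv.
  exact: measurable_dotv.
have Elty : (mu E < +oo)%E.
  by apply: le_lt_trans Slty; apply: le_measure; rewrite ?inE//; exact: subIsetl.
pose qE x : 'rV[R]_m := \1_E x *: q x.
have qE_sq : qE \in @sqint _ _ _ mu m.
  apply: (@sqintI _ _ _ _ _ _ (fun x => k%:R * \1_E x)).
  - move=> j; under eq_fun do rewrite mxE.
    by apply: measurable_funM => //; exact: measurable_indic.
  - apply/integrableP; split.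
      by apply/measurable_EFinP; apply: measurable_funM => //; exact: measurable_indic.
    rewrite (eq_integral (fun x => (k%:R%:E * (\1_E x)%:E)%E)); last first.
      by move=> x _; rewrite -EFinM gee0_abs// lee_fin mulr_ge0.
    rewrite ge0_integralZl_EFin// ?integral_indic// ?setIT.
      by apply: lte_mul_pinfty.
    by apply/measurable_EFinP; exact: measurable_indic.
  - move=> x; rewrite /qE dotvZl dotvZr indicE; have [/set_mem[_ /=]|_] := boolP (x \in E).
      by rewrite !mul1r mulr1.
    by rewrite !mul0r mulr0.
pose de : L2 mu m := (\pi_(L2 mu m) (PreL2 qE_sq))%qT.
have deE : {ae mu, forall x, de x = qE x} := L2_piE (PreL2 qE_sq).
(* [c] bounds [f (v + de) - f v] almost everywhere: on [E] this is the subgradient inequality at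
   [p x] tested at [v x], and off [E] the displacement [de] vanishes. *)
pose c x := - l^-1 * dotv (de x) (de x) + dotv (e0 x) (de x).
have cE : (\int[mu]_x (c x)%:E = (- l^-1 * `|de| ^+ 2 + L2dot e0 de)%:E)%E.
  rewrite (_ : (fun x => (c x)%:E) = fun x => ((- l^-1)%:E * (dotv (de x) (de x))%:E
     + (dotv (e0 x) (de x))%:E)%E); last by [].
  rewrite integralD//; [|exact/integrableZl/integrable_dotv|exact: integrable_dotv].
  rewrite integralZl//; last exact: integrable_dotv.
  rewrite EFinD EFinM L2_sqr_norm /L2dot /Rintegral !fineK//;
    by apply: integrable_fin_num => //; exact: integrable_dotv.
have ic : mu.-integrable setT (fun x => (c x)%:E).
  rewrite (_ : (fun x => (c x)%:E) = fun x => ((- l^-1)%:E * (dotv (de x) (de x))%:E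
     + (dotv (e0 x) (de x))%:E)%E); last by [].
  by apply: integrableD => //; [apply: integrableZl => //|]; exact: integrable_dotv.
have Fv : F v != +oo%E.
  have [FN [w Fw]] := pF; have := veta w; rewrite /regularized.
  by apply: contraTneq => ->; rewrite !addye// leye_eq; move: Fw; case: (F w).
have [iv FvE] := integral_functional_integrable Fv.
pose w : L2 mu m := v + de.
have le1 : {ae mu, forall x, (f (w x) <= f (v x) + (c x)%:E)%E}.
  have h := L2funD v de; apply: filterS2 deE h => x /= dex ->.
  rewrite /c dex /qE indicE; have [xE|xE] := boolP (x \in E); last first.
    by rewrite scale0r addr0 !(dotvC _ 0) !dotv0l mulr0 addr0 adde0.
  rewrite scale1r /q addrC subrK.
  have := @proxP R m f pf cf lf l l0 (v x + l *: e0 x) (v x); rewrite -/(p x).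
  rewrite -leeBrDr// => /le_trans; apply; rewrite le_eqVlt; apply/orP; left; apply/eqP.
  rewrite -EFinN; congr (_ + _%:E)%E; move: (p x) (v x) (e0 x) => a b e1.
  rewrite (_ : b + l *: e1 - a = l *: e1 - (a - b)); last first.
    by rewrite opprB addrCA addrA.
  rewrite -(opprB a b); move: (a - b) => a1; rewrite !dotvE; field; exact: lt0r_neq0.
have [iw FwE] := integral_functional_lty (integral_funepos_lty (measurable_integrand _)
   (integrableD measurableT iv ic) le1).
have := ae_le_integral iw (integrableD measurableT iv ic) le1.
rewrite integralD// cE -FwE -FvE => le2.
have := veta w; rewrite /regularized => /le_trans /(_ (leeD2r _ le2)).
have Fvfin : F v \is a fin_num by rewrite FvE; exact: integrable_fin_num.
rewrite -(fineK Fvfin) -!EFinD lee_fin => le3.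
have de0 : de = 0.
  apply/eqP; rewrite -normr_eq0 -sqrf_eq0; apply/eqP/le_anti; rewrite sqr_ge0 andbT.
  (* Testing the subgradient [eta] at [v + de] gives [(l^-1 - gamma / 2) |de|^2 <= 0]. *)
  have lg0 : 0 < l^-1 - gamma / 2.
    by rewrite subr_gt0 ltr_pdivrMr// -[ltLHS](mulKf (lt0r_neq0 l0)) ltr_pM2l// invr_gt0.
  rewrite -(pmulr_rle0 _ lg0).
  move: le3; rewrite /w (addrC v) addrK !L2_sqr_norm /e0 !L2dotE (L2dotC v de).
  move: (L2dot _ _) (L2dot _ _) (L2dot _ _) (L2dot _ _) => a1 a2 a3 a4.
  by clear; lra.
apply: filterS2 deE (L2fun0 mu m) => x; rewrite de0 => -> + Sx qx.
rewrite /qE indicE mem_set// scale1r => /eqP; rewrite subr_eq0 => /eqP; exact.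
Qed.
End integral_functional_theory.

(* The value is 0 when g is not square integrable. Locked, because otherwise
   unification unfolds it into comparisons of representatives. *)
HB.lock Definition toL2 d (T : measurableType d) (R : realType)
    (mu : {measure set T -> \bar R}) m (g : T -> 'rV[R]_m) : L2 mu m :=
  if (insub g : option (preL2 mu m)) is Some h then (\pi_(L2 mu m) h)%qT else 0.

Lemma toL2_ae d (T : measurableType d) (R : realType)
    (mu : {measure set T -> \bar R}) m (g : T -> 'rV[R]_m) :
  g \in @sqint _ _ _ mu m -> {ae mu, forall x, toL2 mu g x = g x}.
Proof.
by rewrite toL2.unlock; case: insubP => [h _ <- _|/negP//]; exact: L2_piE.
Qed.

Lemma cvgn_le (R : realType) (u v : R^nat) (a b : R) :
  u @ \oo --> a -> v @ \oo --> b -> (forall n, u n <= v n) -> a <= b.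
Proof.
move=> ua vb uv; rewrite -(cvg_lim _ ua)// -(cvg_lim _ vb)//.
by apply: ler_lim; [apply/cvg_ex; exists a|apply/cvg_ex; exists b|exact: nearW].
Qed.

Section superposition_prox.
Context d (T : measurableType d) (R : realType) (m : nat).
Variable mu : {measure set T -> \bar R}.
Variables (f : 'rV[R]_m -> \bar R) (l : R).
Hypotheses (pf : proper_fun f) (cf : convex_fun f) (lf : lower_semicontinuous f).
Hypothesis l0 : 0 < l.
Variables p0 v0 : L2 mu m.
Hypothesis base : {ae mu, forall x, prox f l (p0 x) = v0 x}.
Implicit Types p q : L2 mu m.
Local Notation J := (prox f l).

Definition proxL2 p : L2 mu m := toL2 mu (fun x => J (p x)).

Lemma prox_measurable (g : T -> 'rV[R]_m) i :
  (forall i, measurable_fun setT (fun x => g x 0 i)) ->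
  measurable_fun setT (fun x => J (g x) 0 i).
Proof. by move=> mg; apply: measurable_continuous_coord => //; exact: prox_continuous. Qed.

(** Since [J 0] may differ from 0 and [mu] may be infinite, [J] need not preserve square
    integrability. The base point provides one [p0] for which [J (p0 x)] is square integrable, and
    nonexpansiveness transfers this to every [p]. *)
Lemma prox_sqint p : (fun x => J (p x)) \in @sqint _ _ _ mu m.
Proof.
have mJ q i : measurable_fun setT (fun x => J (q x) 0 i).
  by apply: prox_measurable => j; exact: L2_coord_measurable.
apply: (@sqintI _ _ _ _ _ _ (fun x => 2 * dotv (p x - p0 x) (p x - p0 x)
    + 2 * dotv (J (p0 x)) (J (p0 x)))) => //.
  rewrite (_ : _ \o _ = fun x => (2%:E * (dotv (p x - p0 x) (p x - p0 x))%:E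
     + 2%:E * (dotv (J (p0 x)) (J (p0 x)))%:E)%E)//.
  apply: integrableD => //; apply: integrableZl => //.
    exact: (integrable_dotv (L2fun p - L2fun p0) (L2fun p - L2fun p0)).
  have [mv iv] := integrableP _ _ _ (integrable_dotv v0 v0).
  have mJ0 : measurable_fun setT (fun x => (dotv (J (p0 x)) (J (p0 x)))%:E).
    by apply/measurable_EFinP; exact: measurable_dotv.
  apply/integrableP; split => //.
  apply: le_lt_trans iv; apply: ae_ge0_le_integral => //.
  - exact: measurableT_comp.
  - exact: measurableT_comp.
  - by apply: filterS base => x ->.
move=> x; rewrite -[J (p x)](subrK (J (p0 x))).
apply: le_trans (dotvD_le _ _) _; rewrite lerD2r ler_wpM2l//.
exact: prox_nonexpansive.
Qed.

Lemma proxL2_ae p : {ae mu, forall x, proxL2 p x = J (p x)}.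
Proof. exact: toL2_ae (prox_sqint p). Qed.

Lemma ae_le_L2dot m' (u v u' v' : L2 mu m') :
  {ae mu, forall x, dotv (u x) (v x) <= dotv (u' x) (v' x)} -> L2dot u v <= L2dot u' v'.
Proof.
move=> h; rewrite -lee_fin /L2dot /Rintegral !fineK; last 2 first.
- by apply: integrable_fin_num => //; exact: integrable_dotv.
- by apply: integrable_fin_num => //; exact: integrable_dotv.
by apply: ae_le_integral; [exact: integrable_dotv..|apply: filterS h => x; rewrite lee_fin].
Qed.

Lemma proxL2_firm p q :
  L2dot (proxL2 p - proxL2 q) (proxL2 p - proxL2 q) <= L2dot (p - q) (proxL2 p - proxL2 q).
Proof.
apply: ae_le_L2dot.
have h1 := L2B_ae (proxL2 p) (proxL2 q); have h2 := L2B_ae p q.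
have h3 := proxL2_ae p; have h4 := proxL2_ae q.
apply: filterS2 (filterI h1 h2) (filterI h3 h4) => x [e1 e2] [e3 e4].
rewrite e1 e2 e3 e4.
exact: prox_firm.
Qed.

Lemma proxL2_nonexpansive p q : `|proxL2 p - proxL2 q| <= `|p - q|.
Proof.
have := le_trans (proxL2_firm p q) (L2dot_norm_le _ _).
rewrite -L2_sqr_norm expr2; have [->//|Jpq] := eqVneq `|proxL2 p - proxL2 q| 0.
by rewrite ler_pM2r// lt_neqAle eq_sym Jpq normr_ge0.
Qed.

Hypothesis df : proto_differentiable (subdifferential (@dotv R m) f).

(** The directional derivative of [J], taken along the steps [1 / (i + 1)]: a sequence is what
    measurability, dominated convergence and tangent vectors call for. *)
Definition dprox (x a : 'rV[R]_m) : 'rV[R]_m :=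
  limn (fun i => i.+1%:R *: (J (x + i.+1%:R^-1 *: a) - J x)).

Lemma dprox_cvg x a :
  (fun i => i.+1%:R *: (J (x + i.+1%:R^-1 *: a) - J x)) @ \oo --> dprox x a.
Proof. exact: prox_dirdiff. Qed.

Lemma prox_quotient_le x a i :
  dotv (i.+1%:R *: (J (x + i.+1%:R^-1 *: a) - J x))
       (i.+1%:R *: (J (x + i.+1%:R^-1 *: a) - J x)) <= dotv a a.
Proof.
rewrite dotvZl dotvZr mulrA.
apply: le_trans (ler_wpM2l _ (prox_nonexpansive pf cf lf l0 _ _)) _.
  by rewrite mulr_ge0.
by rewrite [x + _]addrC addrK dotvZl dotvZr -!mulrA !mulVKf.
Qed.

Lemma dprox_le x a : dotv (dprox x a) (dprox x a) <= dotv a a.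
Proof.
apply: (cvgn_le (dotv_cvg (@dprox_cvg x a) (@dprox_cvg x a)) (cvg_cst _)) => n.
exact: prox_quotient_le.
Qed.

Definition dproxL2 p (a : L2 mu m) : L2 mu m := toL2 mu (fun x => dprox (p x) (a x)).

Lemma prox_quotient_measurable p (a : L2 mu m) n i : measurable_fun setT
  (fun x => (n.+1%:R *: (J (p x + n.+1%:R^-1 *: a x) - J (p x))) 0 i).
Proof.
rewrite (_ : (fun x => _) = (fun x => n.+1%:R * (J (p x + n.+1%:R^-1 *: a x) 0 i - J (p x) 0 i))).
  apply: measurable_funM => //; apply: measurable_funB; apply: prox_measurable => j.
    rewrite (_ : (fun x => _) = (fun x => p x 0 j + n.+1%:R^-1 * a x 0 j)).
      apply: measurable_funD; first exact: L2_coord_measurable.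
      by apply: measurable_funM => //; exact: L2_coord_measurable.
    by apply/funext => x; rewrite !mxE.
  exact: L2_coord_measurable.
by apply/funext => x; rewrite !mxE.
Qed.

Lemma dprox_measurable p (a : L2 mu m) i : measurable_fun setT (fun x => dprox (p x) (a x) 0 i).
Proof.
apply: (@measurable_fun_cvg _ _ _ setT (fun n x =>
  (n.+1%:R *: (J (p x + n.+1%:R^-1 *: a x) - J (p x))) 0 i)).
  by move=> n; exact: prox_quotient_measurable.
move=> x _; apply: (@cvg_comp _ _ _ _ (fun y : 'rV[R]_m => y 0 i) _ _ _ (@dprox_cvg (p x) (a x))).
exact: coord_continuous.
Qed.

Lemma dprox_sqint p (a : L2 mu m) : (fun x => dprox (p x) (a x)) \in @sqint _ _ _ mu m.
Proof.
apply: (@sqintI _ _ _ _ _ _ (fun x => dotv (a x) (a x))) => [i||x].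
- exact: dprox_measurable.
- exact: integrable_dotv.
- exact: dprox_le.
Qed.

(** Dominated convergence for [|S n - D|^2]: the quotients and their limit are bounded pointwise by
    [a], whence the majorant [4 |a|^2]. *)
Lemma dproxL2_cvg p (a : L2 mu m) :
  (fun n => n.+1%:R *: (proxL2 (p + n.+1%:R^-1 *: a) - proxL2 p)) @ \oo --> dproxL2 p a.
Proof.
pose S n x := n.+1%:R *: (J (p x + n.+1%:R^-1 *: a x) - J (p x)).
pose s n : L2 mu m := n.+1%:R *: (proxL2 (p + n.+1%:R^-1 *: a) - proxL2 p).
pose D x := dprox (p x) (a x).
have sE n : {ae mu, forall x, s n x = S n x}.
  have h1 := L2funZ n.+1%:R (proxL2 (p + n.+1%:R^-1 *: a) - proxL2 p).
  have h2 := L2B_ae (proxL2 (p + n.+1%:R^-1 *: a)) (proxL2 p).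
  have h3 := proxL2_ae (p + n.+1%:R^-1 *: a); have h4 := proxL2_ae p.
  have h5 := L2funD p (n.+1%:R^-1 *: a); have h6 := L2funZ (n.+1%:R^-1) a.
  apply: filterS2 (filterI h1 (filterI h2 h3)) (filterI h4 (filterI h5 h6)) => x.
  by move=> [e1 [e2 e3]] [e4 [e5 e6]]; rewrite /s e1 e2 e3 e4 e5 e6.
have DE : {ae mu, forall x, dproxL2 p a x = D x} := toL2_ae (dprox_sqint p a).
have mSD n i : measurable_fun setT (fun x => (S n x - D x) 0 i).
  by apply: measurable_sub_coord; [exact: prox_quotient_measurable|exact: dprox_measurable].
pose F n x : \bar R := (dotv (S n x - D x) (S n x - D x))%:E.
have normE n : (`|s n - dproxL2 p a| ^+ 2)%:E = (\int[mu]_x F n x)%E.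
  apply: L2_norm_int => //; have h := L2B_ae (s n) (dproxL2 p a).
  by apply: filterS2 (filterI (sE n) DE) h => x [-> ->].
have [_ _ h] : [/\ mu.-integrable setT (cst 0%E),
    [sequence \int[mu]_x `|F n x - (cst 0%E x)|]_n @ \oo --> 0%E &
    [sequence \int[mu]_x F n x]_n @ \oo --> (\int[mu]_x (cst 0 x))%E]%E.
  apply: (@dominated_convergence _ _ _ mu setT measurableT F (cst 0%E)
     (fun x => (4 * dotv (a x) (a x))%:E)) => //.
  - by move=> n; apply/measurable_EFinP; exact: measurable_dotv.
  - apply: aeW => x _; rewrite /F.
    apply/cvg_EFin; first exact: nearW.
    rewrite -(dotv0l (0 : 'rV[R]_m)); apply: dotv_cvg; rewrite -(subrr (D x));
      by apply: cvgB; [exact: dprox_cvg|exact: cvg_cst].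
  - rewrite (_ : (fun x => _) = fun x => (4%:E * (dotv (a x) (a x))%:E)%E)//.
    by apply: integrableZl => //; exact: integrable_dotv.
  - apply: aeW => x n _; rewrite /F lee_fin ger0_norm ?dotv_ge0//.
    apply: le_trans (dotvD_le _ _) _; rewrite dotvNl dotvNr opprK.
    have := prox_quotient_le (p x) (a x) n; have := dprox_le (p x) (a x).
    by rewrite /S /D; lra.
rewrite integral0 in h.
have {}h : `|s n - dproxL2 p a| ^+ 2 @[n --> \oo] --> (0 : R).
  rewrite (_ : (fun n => _) = fine \o (fun n => \int[mu]_x F n x)%E).
    exact: fine_cvg.
  by apply/funext => n; rewrite /= -normE.
apply/cvgrPdist_lt => e e0; have e20 : 0 < e ^+ 2 by rewrite exprn_gt0.
move/cvgr0Pnorm_lt: h => /(_ _ e20); apply: filterS => n.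
rewrite ger0_norm ?sqr_ge0// distrC.
by rewrite ltr_pXn2r ?nnegrE ?normr_ge0 ?(ltW e0)//.
Qed.

Lemma L2dot_cvg m' (u v : nat -> L2 mu m') (a b : L2 mu m') :
  u @ \oo --> a -> v @ \oo --> b -> L2dot (u n) (v n) @[n --> \oo] --> L2dot a b.
Proof.
move=> ua vb.
have polar (x y : L2 mu m') : L2dot x y = 2^-1 * (`|x + y| ^+ 2 - `|x| ^+ 2 - `|y| ^+ 2).
  by rewrite !L2_sqr_norm !L2dotE (L2dotC y x); field.
rewrite polar; under eq_fun do rewrite polar.
apply: cvgM; first exact: cvg_cst.
have sq (w : nat -> L2 mu m') c : w @ \oo --> c -> `|w n| ^+ 2 @[n --> \oo] --> `|c| ^+ 2.
  by move=> wc; apply: (@cvg_comp _ _ _ _ (fun x : R => x ^+ 2) _ _ _ (cvg_norm wc)); exact: exprn_continuous.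
by apply: cvgB; [apply: cvgB|]; apply: sq => //; exact: cvgD.
Qed.

Lemma dproxL2_nonexpansive p a b : `|dproxL2 p a - dproxL2 p b| <= `|a - b|.
Proof.
apply: (cvgn_le (cvg_norm (cvgB (@dproxL2_cvg p a) (@dproxL2_cvg p b))) (cvg_cst _)) => n.
rewrite fctE -scalerBr normrZ ger0_norm// opprB addrA subrK.
apply: le_trans (ler_wpM2l (ler0n _ _) (proxL2_nonexpansive _ _)) _.
rewrite opprD addrACA subrr add0r -scalerBr normrZ ger0_norm ?invr_ge0//.
by rewrite mulVKf.
Qed.

Lemma dproxL2_firm p a : L2dot (dproxL2 p a) (dproxL2 p a) <= L2dot a (dproxL2 p a).
Proof.
apply: (cvgn_le (L2dot_cvg (@dproxL2_cvg p a) (@dproxL2_cvg p a))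
  (L2dot_cvg (cvg_cst a) (@dproxL2_cvg p a))) => n.
rewrite L2dotZl !L2dotZr; apply: ler_wpM2l => //.
apply: le_trans (ler_wpM2l (ler0n _ _) (proxL2_firm _ _)) _.
by rewrite [p + _]addrC addrK L2dotZl mulrA mulfV// mul1r.
Qed.

End superposition_prox.

(** * Fixed points, decreasing steps and duality in L2 *)

Lemma contraction_fixed_point (R : realType) (W : completeNormedModType R) (g : W -> W) (q : R) :
  0 <= q < 1 -> (forall x y, `|g x - g y| <= q * `|x - y|) -> exists x, g x = x.
Proof.
move=> /andP[q0 q1] h.
have gT : {homo g : x / (setT : set W) x >-> (setT : set W) x} by [].
pose F : {fun (setT : set W) >-> (setT : set W)} := mkfun gT.
have [|||p _ pE] := @banach_fixed_point R W setT F.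
- by exists (NngNum q0); split => // -[x y] _; exact: h.
- exact: closedT.
- by exists 0.
by exists p; rewrite [RHS]pE.
Qed.

(* Steps that almost minimize phi over the admissible ones form a Cauchy
   sequence, because phi dominates the length of the path; a further step from
   the limit would contradict the almost minimality. *)
Lemma caristi (R : realType) (S : Type) (d : S -> S -> R) (phi : S -> R) (c : R) (x0 : S) :
  0 < c -> (forall x, d x x = 0) -> (forall x y, 0 <= d x y) ->
  (forall x y z, d x z <= d x y + d y z) ->
  (forall x : nat -> S,
     (forall e, 0 < e -> exists N, forall k n, (N <= k)%N -> (k <= n)%N ->
        d (x k) (x n) < e) ->
     exists y, d (x n) y @[n --> \oo] --> (0 : R) /\ phi (x n) @[n --> \oo] --> phi y) ->
  (forall x, 0 <= phi x) ->
  (forall x, c * d x0 x <= phi x0 -> 0 < phi x ->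
     exists y, phi y < phi x /\ c * d x y <= phi x - phi y) ->
  exists x, phi x = 0 /\ c * d x0 x <= phi x0.
Proof.
move=> c0 dxx d0 dtri complete phi0 step.
pose less x y := c * d x y <= phi x - phi y.
have less_refl x : less x x by rewrite /less dxx mulr0 subrr.
have less_trans y x z : less x y -> less y z -> less x z.
  by rewrite /less => xy yz; have := ler_wpM2l (ltW c0) (dtri x y z); lra.
have less_phi x y : less x y -> phi y <= phi x.
  by rewrite /less => xy; have := mulr_ge0 (ltW c0) (d0 x y); lra.
(* [z] brings [phi] at least halfway down to its infimum over the admissible points; when [phi x] is
   already this infimum, [z = x]. *)
have /choice[next nextP] : forall x, exists z, less x z /\
    forall y, less x y -> phi z <= (phi x + phi y) / 2.
  move=> x; pose A := [set phi y | y in less x].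
  have A0 : has_inf A by split; [exists (phi x), x|exists 0 => _ [y _ <-]].
  have infx : inf A <= phi x by apply: ge_inf; [exact: A0.2|exists x].
  have infy y : less x y -> inf A <= phi y by move=> xy; apply: ge_inf; [exact: A0.2|exists y].
  have [xA|Ax] := eqVneq (phi x) (inf A).
    by exists x; split => // y /infy; rewrite -xA; lra.
  have gap : 0 < (phi x - inf A) / 2 by rewrite divr_gt0// subr_gt0 lt_neqAle eq_sym Ax.
  have [_ [z xz <-] hz] := inf_adherent gap A0.
  exists z; split => // y /infy; lra.
pose x n := iter n next x0.
have xS n : less (x n) (x n.+1) by have [] := nextP (x n).
have xle k n : (k <= n)%N -> less (x k) (x n).
  by move=> /subnKC <-; elim: (n - k)%N => [|j IHj]; rewrite ?addn0// addnS; exact: less_trans (xS _).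
have phi_cvg : cvgn (phi \o x).
  apply: nonincreasing_is_cvgn; first by move=> k n /xle/less_phi.
  by exists 0 => _ [n _ <-] /=.
have [|y [xy phiy]] := complete x.
  move=> e e0; have ce0 : 0 < c * e by rewrite mulr_gt0.
  have /cvgrPdist_lt/(_ _ ce0)[N _ NP] := phi_cvg.
  exists N => k n Nk kn; rewrite -(ltr_pM2l c0).
  have := xle _ _ kn; rewrite /less => /le_lt_trans; apply.
  have /= := NP k Nk; rewrite ltr_distlC => /andP[_].
  have : limn (phi \o x) <= phi (x n).
    by apply: (nonincreasing_cvgn_ge _ phi_cvg n) => i j /xle/less_phi.
  lra.
have ly n : less (x n) y.
  have h1 : c * (d (x n) y - d (x k) y) @[k --> \oo] --> c * (d (x n) y - 0).
    by apply: cvgM; [exact: cvg_cst|apply: cvgB => //; exact: cvg_cst].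
  have h2 : phi (x n) - phi (x k) @[k --> \oo] --> phi (x n) - phi y.
    by apply: cvgB => //; exact: cvg_cst.
  rewrite /less -[d (x n) y]subr0 -(cvg_lim _ h1)// -(cvg_lim _ h2)//.
  apply: ler_lim; [by apply/cvg_ex; eexists; exact: h1|by apply/cvg_ex; eexists; exact: h2|].
  exists n => // k /= nk; have := xle _ _ nk; rewrite /less => /(le_trans _); apply.
  by rewrite ler_wpM2l ?(ltW c0)// lerBlDr.
exists y; have ly0 := ly 0%N; split; last first.
  by move: ly0; rewrite /less /=; have := phi0 y; lra.
apply/eqP; rewrite eq_le phi0 andbT leNgt; apply/negP => y0.
have [|z [zy lyz]] := step y _ y0.
  by move: ly0; rewrite /less /=; have := phi0 y; lra.
(* [z] is admissible from every iterate, so halving applies to it; the limit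
   [phi y <= (phi y + phi z) / 2] contradicts [phi z < phi y]. *)
have hz n : phi (x n.+1) <= (phi (x n) + phi z) / 2.
  by have [_] := nextP (x n); apply; exact: less_trans (ly n) lyz.
have : phi y <= (phi y + phi z) / 2.
  apply: (@cvgn_le R (fun n => phi (x n.+1)) (fun n => (phi (x n) + phi z) / 2)) => //.
  - by move: phiy; rewrite -cvg_shiftS.
  - by apply: cvgM; [apply: cvgD => //; exact: cvg_cst|exact: cvg_cst].
lra.
Qed.

Section hilbert.
Context d (T : measurableType d) (R : realType).
Variable mu : {measure set T -> \bar R}.

Lemma L2dot_inj m (x y : L2 mu m) : (forall h, L2dot h x = L2dot h y) -> x = y.
Proof.
move=> h; apply/eqP; rewrite -subr_eq0; apply/eqP/L2dot_eq0.
by rewrite L2dotDr L2dotNr h subrr.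
Qed.

(** Minimize [|x|^2 / 2 - phi x]: the parallelogram identity makes a minimizing sequence Cauchy, and
    stationarity at its limit [y] reads [phi h = L2dot h y]. *)
Lemma riesz m (phi : L2 mu m -> R) (C : R) :
  (forall a x y, phi (a *: x + y) = a * phi x + phi y) -> (forall x, phi x <= C * `|x|) ->
  exists x, forall h, phi h = L2dot h x.
Proof.
move=> lin bnd; pose g x := 2^-1 * `|x| ^+ 2 - phi x.
have g_lb x : - (C ^+ 2 / 2) <= g x.
  by rewrite /g; have := sqr_ge0 (`|x| - C); have := bnd x; rewrite sqrrB; lra.
pose A := range g.
have A0 : has_inf A.
  by split; [exists (g 0), 0|exists (- (C ^+ 2 / 2)) => _ [x _ <-]].
have infg x : inf A <= g x by apply: ge_inf; [exact: A0.2|exists x].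
have /choice[x xP] n : exists x, g x < inf A + n.+1%:R^-1.
  have n0 : 0 < n.+1%:R^-1 :> R by rewrite invr_gt0.
  by have [_ [x _ <-]] := inf_adherent n0 A0; exists x.
have phi2 y z : phi (2^-1 *: (y + z)) = 2^-1 * (phi y + phi z).
  have phi00 : phi 0 = 0 by have := lin (-1) 0 0; rewrite scaler0 addr0; lra.
  by rewrite -[2^-1 *: _]addr0 lin phi00 addr0 -[y]scale1r lin mul1r scale1r.
have close y z e : g y < inf A + e -> g z < inf A + e -> `|y - z| ^+ 2 <= 8 * e.
  have := infg (2^-1 *: (y + z)); rewrite /g phi2 normrZ exprMn !L2_sqr_norm !L2dotE.
  rewrite (L2dotC z y) ger0_norm ?invr_ge0//.
  move: (L2dot y z) (L2dot y y) (L2dot z z) (phi y) (phi z) (inf A) => a1 a2 a3 a4 a5 a6.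
  by clear; rewrite expr2; lra.
have cx : cvgn x.
  apply: cauchy_cvg; apply: cauchy_exP => e e0.
  have e8 : 0 < e ^+ 2 / 9 by rewrite divr_gt0// exprn_gt0.
  have [N _ NP] := near_infty_natSinv_lt (PosNum e8).
  exists (x N); exists N => // n /= Nn; rewrite -ball_normE /=.
  have hN k : (N <= k)%N -> g (x k) < inf A + e ^+ 2 / 9.
    by move=> Nk; apply: lt_trans (xP k) _; rewrite ltrD2l; exact: NP.
  have := close _ _ _ (hN _ (leqnn N)) (hN _ Nn).
  move=> h; rewrite -(@ltr_pXn2r _ 2)// ?nnegrE ?(ltW e0)//; apply: le_lt_trans h _.
  have := exprn_gt0 2 e0; lra.
pose y := limn x; exists y => h.
have phic : phi (x n) @[n --> \oo] --> phi y.
  have phiB a b : phi a - phi b = phi (a - b).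
    have -> : a - b = (-1) *: b + a by rewrite scaleN1r addrC.
    by rewrite lin mulN1r addrC.
  have phiN a b : `|phi a - phi b| <= C * `|a - b|.
    by rewrite ler_norml phiB bnd andbT lerNl -phiB opprB phiB distrC bnd.
  have h1 : C * `|y - x n| @[n --> \oo] --> (0 : R).
    rewrite -[0](mulr0 C) -[X in C * X](normr0 (L2 mu m)) -[X in `|X|](subrr y).
    by apply: cvgM; [exact: cvg_cst|apply: cvg_norm; apply: cvgB => //; exact: cvg_cst].
  apply/cvgrPdist_lt => e e0; move/cvgr0Pnorm_lt: h1 => /(_ e e0); apply: filterS => n.
  by move=> /(le_lt_trans (ler_norm _)); exact: le_lt_trans.
have gy : g y <= inf A.
  have h1 : g (x n) @[n --> \oo] --> g y.
    apply: cvgB => //; apply: cvgM; first exact: cvg_cst.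
    by apply: (@cvg_comp _ _ _ _ (fun x : R => x ^+ 2) _ _ _ (cvg_norm cx)); exact: exprn_continuous.
  have h2 : inf A + n.+1%:R^-1 @[n --> \oo] --> inf A + 0.
    by apply: cvgD; [exact: cvg_cst|exact: cvg_harmonic].
  by rewrite -[inf A]addr0; apply: (cvgn_le h1 h2) => n; exact: ltW.
have key t : 0 <= t * (L2dot h y - phi h) + t ^+ 2 * (2^-1 * L2dot h h).
  have := le_trans gy (infg (t *: h + y)); rewrite /g lin !L2_sqr_norm !L2dotE (L2dotC y h).
  move: (L2dot h y) (L2dot y y) (L2dot h h) (phi y) (phi h) => a1 a2 a3 a4 a5.
  by clear; rewrite expr2; lra.
have b0 : 0 <= 2^-1 * L2dot h h by rewrite mulr_ge0 ?invr_ge0 ?L2dot_ge0.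
move: (2^-1 * L2dot h h) b0 key => b b0 key; apply/eqP; rewrite eq_sym -subr_eq0.
move: (L2dot h y - phi h) key => a key.
have b1 : 0 < b + 1 by lra.
(* A nearly optimal [t]; [b + 1] in place of [2 b] avoids a division by 0 and turns the expression
   into minus a square. *)
have := key (- a / (b + 1)); rewrite (_ : _ + _ = - (a / (b + 1)) ^+ 2); last first.
  by field; exact: lt0r_neq0.
rewrite oppr_ge0 => h0; have : (a / (b + 1)) ^+ 2 == 0 by rewrite eq_le h0 sqr_ge0.
by rewrite sqrf_eq0 mulf_eq0 invr_eq0 (gt_eqF b1) orbF.
Qed.

End hilbert.

(** * Adjoints, the Lax-Milgram lemma and the derivative of the adjoint term *)

Section L2_linear_operators.
Context d (T : measurableType d) (R : realType).
Variable mu : {measure set T -> \bar R}.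

Lemma linear_bounded (V W : normedModType R) (A : {linear V -> W}) :
  continuous A -> exists2 C : R, 0 <= C & forall x, `|A x| <= C * `|x|.
Proof.
move=> /linear_bounded_continuous/linear_boundedP [M [_ hM]].
exists (`|M| + 1); first by rewrite addr_ge0.
by apply: hM; rewrite ltr_pwDr// ler_norm.
Qed.

Section adjoint.
Variables (m1 m2 : nat).
Implicit Types (A B : L2 mu m1 -> L2 mu m2).

Lemma adjointP A C y : linear A -> (forall x, `|A x| <= C * `|x|) ->
  forall h, L2dot (A h) y = L2dot h (adjoint A y).
Proof.
move=> lA bA; apply: (@xgetPex _ 0 [set x | forall h, L2dot (A h) y = L2dot h x]).
apply: (@riesz _ _ _ mu _ (fun h => L2dot (A h) y) (C * `|y|)).
- by move=> a x z; rewrite lA L2dotDl L2dotZl.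
- move=> x; apply: le_trans (L2dot_norm_le _ _) _.
  by rewrite mulrAC ler_wpM2r.
Qed.

Lemma L2_norm_le_dot m (x : L2 mu m) c : 0 <= c ->
  (forall h, L2dot h x <= c * `|h|) -> `|x| <= c.
Proof.
move=> c0 /(_ x); rewrite -L2_sqr_norm expr2.
by have [->//|x0] := eqVneq `|x| 0; rewrite ler_pM2r// lt_neqAle eq_sym x0 normr_ge0.
Qed.

Lemma adjoint_norm A C y : 0 <= C -> linear A -> (forall x, `|A x| <= C * `|x|) ->
  `|adjoint A y| <= C * `|y|.
Proof.
move=> C0 lA bA; apply: L2_norm_le_dot; first by rewrite mulr_ge0.
move=> h; rewrite -(adjointP y lA bA); apply: le_trans (L2dot_norm_le _ _) _.
by rewrite mulrAC ler_wpM2r.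
Qed.

Lemma adjoint_linear A C : linear A -> (forall x, `|A x| <= C * `|x|) -> linear (adjoint A).
Proof.
move=> lA bA a y z; apply: L2dot_inj => h.
by rewrite -(adjointP _ lA bA) !L2dotDr !L2dotZr -!(adjointP _ lA bA).
Qed.

End adjoint.

(* Lax-Milgram: x |-> x - tau (G x - b) is a contraction for tau = c / M^2. *)
Lemma lax_milgram m (G : L2 mu m -> L2 mu m) (M c : R) : linear G ->
  (forall x, `|G x| <= M * `|x|) -> 0 < c -> (forall x, c * `|x| ^+ 2 <= L2dot (G x) x) ->
  forall b, exists x, G x = b.
Proof.
move=> lG bG c0 cG b.
(* Adding [c] gives [N > 0] and [c / N <= 1], so that the root [q] below is taken of a nonnegative
   number. *)
pose N := `|M| + c; have N0 : 0 < N by rewrite ltr_wpDl.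
have NG x : `|G x| <= N * `|x|.
  apply: le_trans (bG x) _; rewrite ler_wpM2r//.
  by have := ler_norm M; rewrite /N; lra.
pose t := c / N ^+ 2; have t0 : 0 < t by rewrite divr_gt0// exprn_gt0.
have GB x y : G (x - y) = G x - G y.
  by rewrite -scaleN1r addrC lG scaleN1r addrC.
pose q := Num.sqrt (1 - (c / N) ^+ 2).
have cN : c / N <= 1 by rewrite ler_pdivrMr// mul1r /N lerDr.
have cN2 : (c / N) ^+ 2 <= 1 by rewrite exprn_ile1// divr_ge0// ltW.
have key (z : L2 mu m) : `|z - t *: G z| <= q * `|z|.
  rewrite -ler_sqr ?nnegrE ?mulr_ge0 ?sqrtr_ge0//.
  have q2 : q ^+ 2 = 1 - (c / N) ^+ 2 by rewrite sqr_sqrtr// subr_ge0.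
  rewrite exprMn q2 !L2_sqr_norm !L2dotE (L2dotC z (G z)).
  have h1 := cG z; have h2 : L2dot (G z) (G z) <= N ^+ 2 * L2dot z z.
    by rewrite -!L2_sqr_norm -exprMn lerXn2r ?nnegrE// mulr_ge0// ltW.
  rewrite L2_sqr_norm in h1.
  move: (L2dot z z) (L2dot (G z) z) (L2dot (G z) (G z)) h1 h2 => a1 a2 a3 h1 h2.
  have k1 := ler_wpM2l (ltW t0) h1.
  have k2 := ler_wpM2l (sqr_ge0 t) h2.
  have e1 : t * (c * a1) = (c / N) ^+ 2 * a1 by rewrite /t; field; exact: lt0r_neq0.
  have e2 : t ^+ 2 * (N ^+ 2 * a1) = (c / N) ^+ 2 * a1 by rewrite /t; field; exact: lt0r_neq0.
  rewrite e1 in k1; rewrite e2 expr2 in k2.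
  move: ((c / N) ^+ 2) k1 k2 => s; clear; lra.
have [||x xE] := @contraction_fixed_point R (L2 mu m) (fun x => x - t *: (G x - b)) q.
- rewrite sqrtr_ge0 /= -[ltRHS]sqrtr1 ltr_sqrt// ltrBlDr ltrDl.
  by rewrite exprn_gt0// divr_gt0.
- move=> x y; rewrite (_ : _ - _ = (x - y) - t *: G (x - y)); last first.
    rewrite GB (_ : t *: (G x - G y) = t *: (G x - b) - t *: (G y - b)); last first.
      by rewrite -scalerBr opprB addrA subrK.
    move: (t *: _) (t *: _) => a a'.
    by rewrite !opprB addrACA [RHS]addrACA; congr (_ + _); rewrite addrC.
  exact: key.
exists x; move/eqP: xE; rewrite -subr_eq0 addrAC subrr add0r oppr_eq0 scaler_eq0.
by rewrite (gt_eqF t0)/= subr_eq0 => /eqP.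
Qed.

End L2_linear_operators.

Section adjoint_hessian.
Context d (T : measurableType d) (R : realType).
Variable mu : {measure set T -> \bar R}.
Variables (m1 m2 : nat) (K : L2 mu m1 -> L2 mu m2).
Local Notation X := (L2 mu m1).
Local Notation Y := (L2 mu m2).
Hypothesis dK : forall u, differentiable K u.

Lemma diff_bounded u : exists2 C : R, 0 <= C & forall x, `|'d K u x| <= C * `|x|.
Proof. exact: linear_bounded (diff_continuous (dK u)). Qed.

Lemma diff_linear u : linear ('d K u).
Proof. by move=> a x y; rewrite linearP. Qed.

Lemma diff_adjointP u y h : L2dot ('d K u h) y = L2dot h (adjoint ('d K u) y).
Proof. by have [C _ bC] := diff_bounded u; exact: (adjointP y (@diff_linear u) bC). Qed.

Variable D2 : X -> X -> X -> Y.
Hypotheses (D2_lin_r : forall u h, linear (D2 u h))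
  (D2_lin_l : forall u k, linear (fun h => D2 u h k))
  (D2_bnd : forall u, exists C : R, forall h k, `|D2 u h k| <= C * `|h| * `|k|)
  (D2_diff : forall u (e : R), 0 < e -> \forall h \near (0 : X), forall k,
          `|'d K (u + h) k - 'd K u k - D2 u h k| <= e * `|h| * `|k|).

Lemma D2_adjointP u h v k : L2dot (D2 u h k) v = L2dot k (adjoint (D2 u h) v).
Proof. by have [C bC] := D2_bnd u; exact: (adjointP v (@D2_lin_r u h) (bC h)). Qed.

(** By uniqueness of the derivative: [h |-> adjoint (D2 u h) v] is linear and bounded, and pairing
    its remainder with any [w] turns it into the remainder of ['d K], applied to [w] and paired with
    [v]. *)
Lemma adjoint_hessian_dot u v h k :
  L2dot (adjoint_hessian K u v h) k = L2dot (D2 u h k) v.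
Proof.
pose Hs h := adjoint (D2 u h) v.
have Hs_lin : linear Hs.
  move=> a x y; apply: L2dot_inj => z; rewrite L2dotDr L2dotZr -!D2_adjointP.
  by rewrite (@D2_lin_l u z a x y) L2dotDl L2dotZl.
pose L : {linear X -> X} := HB.pack Hs (GRing.isLinear.Build _ _ _ _ Hs Hs_lin).
suff : adjoint_hessian K u v = L :> (X -> X).
  by move=> ->; rewrite D2_adjointP L2dotC.
apply: diff_unique.
  apply/linear_bounded_continuous/linear_boundedP; have [C bC] := D2_bnd u.
  exists (`|C| * `|v|); split; first exact: num_real.
  move=> M CM x; apply: (@le_trans _ _ (`|C| * `|v| * `|x|)); last by rewrite ler_wpM2r// ltW.
  rewrite mulrAC; apply: (adjoint_norm _ _ (@D2_lin_r u x)); first by rewrite mulr_ge0.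
  by move=> z; apply: le_trans (bC x z) _; rewrite !ler_wpM2r// ler_norm.
apply/eqaddoP => e e0; have e1 : 0 < e / (`|v| + 1) by rewrite divr_gt0// ltr_wpDl.
apply: filterS (D2_diff u e1) => z zP.
rewrite /= !fctE; apply: L2_norm_le_dot; first by rewrite mulr_ge0// ltW.
move=> w; rewrite [z + u]addrC opprD addrA.
rewrite (_ : L2dot w _ = L2dot ('d K (u + z) w - 'd K u w - D2 u z w) v); last first.
  rewrite [LHS]L2dotDr [L2dot w (_ - _)]L2dotDr !L2dotNr [RHS]L2dotDl [L2dot (_ - _) v]L2dotDl !L2dotNl.
  rewrite (diff_adjointP (u + z) v w) (diff_adjointP u v w).
  congr (_ - _).
  by rewrite (D2_adjointP u z v w).
apply: le_trans (L2dot_norm_le _ _) _; apply: le_trans (ler_wpM2r _ (zP w)) _ => //.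
rewrite -!mulrA (mulrC `|z|) (mulrC `|z|) !mulrA ler_wpM2r// mulrAC ler_wpM2r//.
by rewrite -mulrA ler_piMr// ?(ltW e0)// mulrC ler_pdivrMr ?mul1r ?lerDl//.
Qed.

End adjoint_hessian.

(** * Sigma-finiteness of the Lebesgue measure on an open set *)

Lemma measurable_boxRn (R : realType) (n : nat) (a b : 'rV[R]_n) : measurable (boxRn a b).
Proof.
rewrite (_ : boxRn _ _ = \bigcap_(i in setT) ((fun x : Rn R n => (x : 'rV[R]_n) 0 i)
     @^-1` `]a 0 i, b 0 i])).
  apply: fin_bigcap_measurable => // i _; rewrite -[X in measurable X]setTI.
  exact: measurable_coord.
by apply/seteqP; split => x /= h i => [_|]; exact: h.
Qed.

Lemma lebesgue_on_sigma_finite (R : realType) (n : nat) (Omega : set 'rV[R]_n)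
  (oOmega : open Omega) : sigma_finite setT (lebesgue_on oOmega).
Proof.
exists (fun k => boxRn (const_mx (- k%:R)) (const_mx k%:R)).
  apply/seteqP; split => // x _.
  pose k := Num.bound `|(x : 'rV[R]_n)|.
  exists k => // i; rewrite /= !mxE in_itv /=.
  have xk : `|(x : 'rV[R]_n) 0 i| < k%:R.
    by apply: le_lt_trans (archi_boundP (normr_ge0 _)); exact: norm_coord_le.
  by move: xk; rewrite ltr_norml => /andP[-> /ltW].
move=> k; split; first exact: measurable_boxRn.
rewrite /lebesgue_on /= /mrestr.
apply: (@le_lt_trans _ _ (lebesgueRn R n (boxRn (const_mx (- k%:R)) (const_mx k%:R)))).
  apply: le_measure; rewrite ?inE.
  - by apply: measurableI; [exact: measurable_boxRn|exact: open_measurable_Rn].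
  - exact: measurable_boxRn.
  - exact: subIsetl.
rewrite lebesgueRn_box ?ltry// => i.
by rewrite !mxE -subr_ge0 opprK addr_ge0.
Qed.

(** * The linearized system *)

Section linearized_system.
Context d (T : measurableType d) (R : realType).
Variable mu : {measure set T -> \bar R}.

Lemma linearB_fun (U W : lmodType R) (G : U -> W) : linear G ->
  forall x y, G (x - y) = G x - G y.
Proof. by move=> lG x y; rewrite -scaleN1r addrC lG scaleN1r addrC. Qed.

(* The scaling l of the resolvent turns the strongly monotone linear part into
   a contraction, as the equation reads D (z + l (r - C z)) = z. *)
Lemma resolvent_equation m (D B : L2 mu m -> L2 mu m) (M c e l : R) (r : L2 mu m) :
  (forall a b, `|D a - D b| <= `|a - b|) -> linear B ->
  (forall z, `|B z| <= M * `|z|) -> (forall z, 0 <= L2dot (B z) z) ->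
  0 <= c -> 0 < e -> 0 <= M -> l = e / (M + c + e + 1) ^+ 2 ->
  exists z, D (z + l *: (r - (B z + (c + e) *: z))) = z.
Proof.
move=> neD lB bB B0 c0 e0 M0 lE.
pose N := M + c + e + 1; have N0 : 0 < N by rewrite /N; lra.
have l0 : 0 < l by rewrite lE divr_gt0// exprn_gt0.
have le1 : l * e <= 1.
  rewrite lE mulrAC -expr2 -expr_div_n exprn_ile1// ?divr_ge0 ?(ltW e0) ?(ltW N0)//.
  by rewrite ler_pdivrMr// mul1r /N; lra.
have [C CE] : exists C : L2 mu m -> L2 mu m, forall z, C z = B z + (c + e) *: z by eexists.
have bC z : `|C z| <= N * `|z|.
  rewrite CE; apply: le_trans (ler_normD _ _) _; rewrite normrZ ger0_norm ?addr_ge0// ?(ltW e0)//.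
  by have := bB z; have := normr_ge0 z; rewrite /N; lra.
have C1 z : e * L2dot z z <= L2dot (C z) z.
  rewrite CE L2dotDl L2dotZl; have := B0 z; have := mulr_ge0 c0 (L2dot_ge0 z).
  by move: (L2dot z z) (L2dot (B z) z) => a1 a2; clear; lra.
(* The squared contraction factor [1 - 2 l e + l^2 N^2] is minimal at [l = e / N^2], with value
   [1 - l e]. *)
pose q := Num.sqrt (1 - l * e).
have q2 : q ^+ 2 = 1 - l * e by rewrite sqr_sqrtr// subr_ge0.
have key (z : L2 mu m) : `|z - l *: C z| <= q * `|z|.
  rewrite -ler_sqr ?nnegrE ?mulr_ge0 ?sqrtr_ge0//.
  rewrite exprMn q2 !L2_sqr_norm !L2dotE (L2dotC z (C z)).
  have h1 := ler_wpM2l (ltW l0) (C1 z).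
  have h2 : l ^+ 2 * L2dot (C z) (C z) <= l * e * L2dot z z.
    rewrite (_ : l * e = l ^+ 2 * N ^+ 2); last first.
      by rewrite lE -/N; field; exact: lt0r_neq0.
    rewrite -mulrA ler_wpM2l ?sqr_ge0// -!L2_sqr_norm -exprMn lerXn2r ?nnegrE//.
    by rewrite mulr_ge0// ltW.
  move: (L2dot z z) (L2dot (C z) z) (L2dot (C z) (C z)) h1 h2 => a1 a2 a3.
  by rewrite expr2; clear; lra.
have [||z zE] := @contraction_fixed_point R (L2 mu m)
    (fun z => D (z + l *: (r - C z))) q.
- rewrite sqrtr_ge0 /= -[ltRHS]sqrtr1 ltr_sqrt// ltrBlDr ltrDl.
  by rewrite mulr_gt0.
- move=> x y; apply: le_trans (neD _ _) _.
  rewrite (_ : _ - _ = (x - y) - l *: C (x - y)); first exact: key.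
  have -> : C (x - y) = C x - C y.
    by rewrite !CE linearB_fun// scalerBr opprD addrACA.
  rewrite opprD addrACA -scalerBr -scalerN; congr (_ + l *: _).
  by rewrite !opprB addrC subrKA.
by exists z; rewrite -CE.
Qed.

End linearized_system.

Section Bbar_theory.
Context d (T : measurableType d) (R : realType).
Variable mu : {measure set T -> \bar R}.
Variables (m1 m2 : nat) (K : L2 mu m1 -> L2 mu m2).
Local Notation X := (L2 mu m1).
Local Notation Y := (L2 mu m2).
Hypothesis dK : forall u, differentiable K u.
Variable D2 : X -> X -> X -> Y.
Hypotheses (D2_lin_r : forall u h, linear (D2 u h))
  (D2_lin_l : forall u k, linear (fun h => D2 u h k))
  (D2_bnd : forall u, exists C : R, forall h k, `|D2 u h k| <= C * `|h| * `|k|)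
  (D2_diff : forall u (e : R), 0 < e -> \forall h \near (0 : X), forall k,
          `|'d K (u + h) k - 'd K u k - D2 u h k| <= e * `|h| * `|k|).
Variables (alpha cG : R) (uhat : X) (vhat : Y).
Hypotheses (alpha0 : 0 < alpha) (cG0 : 0 < cG)
  (coercive : forall xi, alpha * `|xi| ^+ 2 + L2dot (adjoint_hessian K uhat vhat xi) xi
              >= cG * `|xi| ^+ 2).
Local Notation H := (adjoint_hessian K uhat vhat).

(** Coercivity and Lax-Milgram make [alpha + H] bijective, so the [pinv] in [Bbar] is a genuine
    inverse, bounded by [cG^-1]. The boundedness of [H] is read off from [D2]. *)
Lemma Bbar_factor : exists (Ainv : X -> X) (CL : R), [/\ 0 <= CL,
  linear Ainv,
  forall b, alpha *: Ainv b + H (Ainv b) = b,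
  forall b, `|Ainv b| <= cG^-1 * `|b| &
  [/\ forall x, `|'d K uhat x| <= CL * `|x|,
      forall y, `|adjoint ('d K uhat) y| <= CL * `|y| &
      forall z, Bbar alpha K uhat vhat z = 'd K uhat (Ainv (adjoint ('d K uhat) z)) ]].
Proof.
have [CL CL0 bL] := diff_bounded dK uhat.
pose A xi := alpha *: xi + H xi.
have lH : linear H by move=> a x y; rewrite /adjoint_hessian linearP.
have lA : linear A.
  by move=> a x y; rewrite /A lH !scalerDr !scalerA (mulrC alpha) addrACA.
have [C bC] := D2_bnd uhat.
have bA x : `|A x| <= (alpha + `|C| * `|vhat|) * `|x|.
  apply: le_trans (ler_normD _ _) _; rewrite normrZ (gtr0_norm alpha0) mulrDl lerD2l.
  apply: L2_norm_le_dot; first by rewrite !mulr_ge0.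
  move=> k; rewrite L2dotC (adjoint_hessian_dot dK D2_lin_r D2_lin_l D2_bnd D2_diff).
  apply: le_trans (L2dot_norm_le _ _) _.
  rewrite (_ : _ * _ * `|k| = `|C| * `|x| * `|k| * `|vhat|); last first.
    by rewrite (mulrAC _ `|vhat| `|x|) (mulrAC _ `|vhat| `|k|).
  rewrite ler_wpM2r//.
  by apply: le_trans (bC x k) _; rewrite !ler_wpM2r// ler_norm.
have cA x : cG * `|x| ^+ 2 <= L2dot (A x) x.
  by rewrite /A L2dotDl L2dotZl -L2_sqr_norm; exact: coercive.
have nA x : cG * `|x| <= `|A x|.
  have [->|x0] := eqVneq `|x| 0; first by rewrite mulr0.
  have x1 : 0 < `|x| by rewrite lt_neqAle eq_sym x0 normr_ge0.
  by rewrite -(ler_pM2r x1) -mulrA -expr2; apply: le_trans (cA x) (L2dot_norm_le _ _).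
have injA : injective A.
  move=> x y xy; apply/eqP; rewrite -subr_eq0 -normr_eq0; apply/eqP.
  have := nA (x - y); rewrite (linearB_fun lA) xy subrr normr0 => h.
  by apply/le_anti; rewrite normr_ge0 andbT -(ler_pM2l cG0) mulr0.
pose Ainv b := pinv setT A b.
have AinvK b : A (Ainv b) = b.
  have [x <-] := lax_milgram lA bA cG0 cA b.
  by rewrite /Ainv pinvKV ?inE// => y z _ _; exact: injA.
exists Ainv, CL; split => //.
- by move=> a x y; apply: injA; rewrite lA !AinvK.
- by move=> b; rewrite mulrC ler_pdivlMr// mulrC -{2}[b]AinvK; exact: nA.
- split => //.
  by move=> y; apply: (adjoint_norm _ CL0 (@diff_linear _ _ _ _ _ _ K uhat)).
Qed.

End Bbar_theory.

Section tangent_estimate.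
Context d (T : measurableType d) (R : realType).
Variable mu : {measure set T -> \bar R}.

(* If (z, w) is tangent then z lies in V, as the convexified derivative is empty
   elsewhere; there nu = 0 in bbar > 0 gives |B z| >= c |z|, so that B is elliptic
   along z. *)
Lemma tangent_estimate m (B : L2 mu m -> L2 mu m) (dF : L2 mu m -> set (L2 mu m))
    (V : L2 mu m -> L2 mu m -> set (L2 mu m)) (gamma kappa : R) (vhat etahat : L2 mu m) :
  0 <= gamma -> 0 < kappa ->
  (forall z, `|B z| ^+ 2 <= kappa * L2dot (B z) z) ->
  (forall v eta, dF v eta -> forall dv, conv_graph_deriv dF v eta dv =
       if dv \in V v eta then [set gamma *: dv + w | w in polar (V v eta)] else set0) ->
  0 < gamma \/ (0 < bbar B dF V vhat etahat)%E ->
  exists C t : R, [/\ 0 < C, 0 < t & forall v eta z w e, dF v eta ->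
    `|v - vhat| < t -> `|eta - etahat| < t -> tangent (graph dF) (v, eta) (z, w) ->
    0 <= L2dot (w - gamma *: z) z -> 0 <= e ->
    `|z| <= C * `|w + e *: z + B z| ].
Proof.
move=> g0 k0 kB hV gb.
have B0 z : 0 <= L2dot (B z) z.
  by rewrite -(pmulr_rge0 _ k0); apply: le_trans (kB z); rewrite sqr_ge0.
have red z r (c : R) : 0 < c -> c * `|z| ^+ 2 <= L2dot r z -> `|z| <= c^-1 * `|r|.
  move=> c0 h; rewrite mulrC ler_pdivlMr// mulrC.
  have [->|z0] := eqVneq `|z| 0; first by rewrite mulr0.
  have z1 : 0 < `|z| by rewrite lt_neqAle eq_sym z0 normr_ge0.
  by rewrite -(ler_pM2r z1) -mulrA -expr2; apply: le_trans h (L2dot_norm_le _ _).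
have lower z w e : 0 <= L2dot (w - gamma *: z) z -> 0 <= e ->
    gamma * `|z| ^+ 2 + L2dot (B z) z <= L2dot (w + e *: z + B z) z.
  rewrite !L2dotE L2_sqr_norm => h e0; have := mulr_ge0 e0 (L2dot_ge0 z).
  move: (L2dot z z) (L2dot w z) (L2dot (B z) z) h => a1 a2 a3; clear; lra.
case: gb => [gp|].
  exists gamma^-1, 1; split => //; first by rewrite invr_gt0.
  move=> v eta z w e _ _ _ _ wz e0; apply: red => //; apply: le_trans (lower _ _ _ wz e0).
  by rewrite lerDl.
move=> /ereal_sup_gt[_ [t /= t0 <-]] inf0.
set I := ereal_inf _ in inf0.
(* The infimum may be +oo, for instance over an empty set, so a positive real below it is
   extracted. *)
have [c c0 cI] : exists2 c : R, 0 < c & (c%:E <= I)%E.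
  case: I inf0 => [r||]//; first by rewrite lte_fin => r0; exists r.
  by exists 1; rewrite ?leey.
exists (c ^+ 2 / kappa)^-1, t; split => //; first by rewrite invr_gt0 divr_gt0// exprn_gt0.
move=> v eta z w e veta vt et zw wz e0; apply: red; first by rewrite divr_gt0// exprn_gt0.
apply: le_trans (lower _ _ _ wz e0); apply: (@le_trans _ _ (L2dot (B z) z)); last first.
  by rewrite lerDr mulr_ge0// sqr_ge0.
have [->|z0] := eqVneq z 0; first by rewrite normr0 expr0n mulr0 B0.
have zV : z \in V v eta.
  have : conv_graph_deriv dF v eta z w by apply: sub_smallest zw.
  by rewrite (hV _ _ veta); case: ifP.
have zp : 0 < `|z| by rewrite normr_gt0.
have : (c%:E <= (`|B z - 0| / `|z|)%:E)%E.
  apply: le_trans cI _; apply: ereal_inf_lbound.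
  exists z, 0, v, eta; split => //; first by split => //; exact/set_mem.
  by move=> z' _; rewrite L2dot0l.
rewrite subr0 lee_fin ler_pdivlMr// => cz.
rewrite mulrAC ler_pdivrMr// mulrC (mulrC _ kappa); apply: le_trans (kB z).
by rewrite mulrC -exprMn lerXn2r ?nnegrE// mulr_ge0// ltW.
Qed.

End tangent_estimate.

(** * First-order expansions with frozen derivatives *)

Section bilinear_splitting.
Context d (T : measurableType d) (R : realType) (m : nat).
Variable mu : {measure set T -> \bar R}.
Implicit Types a b x y : L2 mu m.

Lemma L2dot_sub_split x1 x0 v b :
  L2dot x1 v - L2dot x0 b = L2dot (x1 - x0) v + L2dot x0 (v - b) :> R.
Proof. by rewrite L2dotDl L2dotNl L2dotDr L2dotNr addrA subrK. Qed.

(** Meant for [x1], [x0], [xL] the values of ['d K] at the moved point, at [u] and at [uhat], and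
    [Du], [Dh] those of [D2] at [u] and [uhat]. The error splits into the remainder of ['d K] and,
    with the factor [t], the freezing of [D2], [v] and ['d K], the variation of ['d K] along the
    step, and the distance from [s] to [z]. *)
Lemma L2dot_telescope x1 x0 xL Du Dh v vh s z (t : R) :
  L2dot x1 (v + t *: s) - L2dot x0 v - t * (L2dot Dh vh + L2dot xL z) =
  L2dot (x1 - x0 - t *: Du) v + t * (L2dot (Du - Dh) v + L2dot Dh (v - vh)
    + L2dot (x1 - x0) s + L2dot (x0 - xL) s + L2dot xL (s - z)).
Proof.
rewrite !L2dotE.
move: (L2dot x1 v) (L2dot x1 s) (L2dot x0 v) (L2dot x0 s) (L2dot Du v) (L2dot Dh v)
  (L2dot Dh vh) (L2dot xL z) (L2dot xL s) => a1 a2 a3 a4 a5 a6 a7 a8 a9; ring.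
Qed.

End bilinear_splitting.

Section residual_expansion.
Context d (T : measurableType d) (R : realType).
Variable mu : {measure set T -> \bar R}.
Variables (m1 m2 : nat) (K : L2 mu m1 -> L2 mu m2).
Local Notation X := (L2 mu m1).
Local Notation Y := (L2 mu m2).
Hypothesis dK : forall u, differentiable K u.
Variable D2 : X -> X -> X -> Y.
Hypotheses (D2_lin_r : forall u h, linear (D2 u h))
  (D2_lin_l : forall u k, linear (fun h => D2 u h k))
  (D2_bnd : forall u, exists C : R, forall h k, `|D2 u h k| <= C * `|h| * `|k|)
  (D2_diff : forall u (e : R), 0 < e -> \forall h \near (0 : X), forall k,
          `|'d K (u + h) k - 'd K u k - D2 u h k| <= e * `|h| * `|k|).

Lemma near_harmonic_scale (du : X) (P : X -> Prop) :
  (\forall h \near (0 : X), P h) -> \forall n \near \oo, P (n.+1%:R^-1 *: du).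
Proof.
move=> nP; have : n.+1%:R^-1 *: du @[n --> \oo] --> (0 : X).
  by rewrite -(scale0r du); apply: cvgZr_tmp; exact: cvg_harmonic.
by move=> /(_ _ nP).
Qed.

Lemma near_harmonic_le (c e : R) : 0 < e -> \forall n \near \oo, c * n.+1%:R^-1 <= e.
Proof.
move=> e0; have h : c * n.+1%:R^-1 @[n --> \oo] --> (0 : R).
  by rewrite -(mulr0 c); apply: cvgM; [exact: cvg_cst|exact: cvg_harmonic].
move/cvgr0Pnorm_lt: h => /(_ e e0); apply: filterS => n.
by move=> /(le_lt_trans (ler_norm _))/ltW.
Qed.

Lemma K_expansion u du e : 0 < e -> \forall n \near \oo,
  `|K (u + n.+1%:R^-1 *: du) - K u - n.+1%:R^-1 *: 'd K u du| <= n.+1%:R^-1 * e.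
Proof.
move=> e0; have e1 : 0 < e / (`|du| + 1) by rewrite divr_gt0// ltr_wpDl.
have /eqaddoP/(_ _ e1)/(near_harmonic_scale du) := diff_locally (dK u).
apply: filterS => n; rewrite /= !fctE opprD addrA linearZ/= [_ *: du + u]addrC.
move=> /le_trans; apply; rewrite normrZ ger0_norm ?invr_ge0// mulrCA ler_wpM2l ?invr_ge0//.
rewrite mulrAC ler_pdivrMr ?ltr_wpDl// ler_wpM2l ?(ltW e0)//.
by rewrite lerDl.
Qed.

Lemma diff_locally_lipschitz u : exists2 C : R, 0 <= C & \forall h \near (0 : X), forall k,
  `|'d K (u + h) k - 'd K u k| <= C * `|h| * `|k|.
Proof.
have [C bC] := D2_bnd u; exists (`|C| + 1); first by rewrite addr_ge0.
apply: filterS (D2_diff u ltr01) => h hP k.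
rewrite -[X in `|X|](subrK (D2 u h k)); apply: le_trans (ler_normD _ _) _.
rewrite !mulrDl addrC lerD//.
by apply: le_trans (bC h k) _; rewrite !ler_wpM2r// ler_norm.
Qed.

(** Provides the continuity of the residual required for the limit point in [caristi]. *)
Lemma adjoint_diff_cvg (u : nat -> X) (v : nat -> Y) a b :
  u @ \oo --> a -> v @ \oo --> b ->
  adjoint ('d K (u n)) (v n) @[n --> \oo] --> adjoint ('d K a) b.
Proof.
move=> ua vb; have [C C0 nC] := diff_locally_lipschitz a.
have [CL CL0 bL] := diff_bounded dK a.
have h1 : (C * `|u n - a| * (`|v n|) + CL * `|v n - b|) @[n --> \oo]
     --> C * `|a - a| * `|b| + CL * `|b - b|.
  apply: cvgD.
    apply: cvgM; last exact: cvg_norm.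
    by apply: cvgM; [exact: cvg_cst|apply: cvg_norm; apply: cvgB => //; exact: cvg_cst].
  by apply: cvgM; [exact: cvg_cst|apply: cvg_norm; apply: cvgB => //; exact: cvg_cst].
rewrite !subrr !normr0 !mulr0 mul0r addr0 in h1.
have ua0 : u n - a @[n --> \oo] --> (0 : X).
  by rewrite -(subrr a); apply: cvgB => //; exact: cvg_cst.
have {ua0}nC : \forall n \near \oo, forall k,
    `|'d K (a + (u n - a)) k - 'd K a k| <= C * `|u n - a| * `|k| := ua0 _ nC.
apply/cvgrPdist_lt => e e0; move/cvgr0Pnorm_lt: h1 => /(_ e e0) h1.
apply: filterS2 nC h1 => n /= hn /(le_lt_trans (ler_norm _)); apply: le_lt_trans.
rewrite distrC; apply: L2_norm_le_dot; first by rewrite addr_ge0// !mulr_ge0.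
move=> k; rewrite L2dotDr L2dotNr.
rewrite -(diff_adjointP dK (u n) (v n) k) -(diff_adjointP dK a b k).
rewrite L2dot_sub_split.
have {hn} := hn k; rewrite [a + _]addrC subrK => hn.
rewrite mulrDl lerD//; apply: le_trans (L2dot_norm_le _ _) _.
  by rewrite (mulrAC _ `|v n|) ler_wpM2r.
by rewrite mulrAC ler_wpM2r.
Qed.

Variables (uhat : X) (vhat : Y).
Local Notation H := (adjoint_hessian K uhat vhat).

(** The direction [s n] varies with [n] because the increment of [J] is only asymptotically [z].
    Freezing errors are proportional to [del] and do not vanish with [n]; those that vanish are
    collected in [e]. *)
Lemma adjoint_expansion (u du : X) (v z : Y) (s : nat -> Y) (del Nv C2 e : R) :
  s @ \oo --> z -> 0 <= del -> 0 <= Nv -> 0 <= C2 -> 0 < e ->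
  (forall h k, `|D2 uhat h k| <= C2 * `|h| * `|k|) ->
  (forall h k, `|D2 u h k - D2 uhat h k| <= del * `|h| * `|k|) ->
  `|v - vhat| <= del -> `|v| <= Nv ->
  (forall k, `|'d K u k - 'd K uhat k| <= del * `|k|) ->
  \forall n \near \oo,
    `|adjoint ('d K (u + n.+1%:R^-1 *: du)) (v + n.+1%:R^-1 *: s n) - adjoint ('d K u) v
      - n.+1%:R^-1 *: (H du + adjoint ('d K uhat) z)|
    <= n.+1%:R^-1 * (del * ((Nv + C2) * `|du| + `|z|) + e).
Proof.
move=> sz del0 Nv0 C20 e0 bD2 dD2 vv vN dKu.
have [C C0 nC] := diff_locally_lipschitz u.
have [CL CL0 bL] := diff_bounded dK uhat.
(* One quarter of [e] goes to each vanishing error: the remainder of ['d K] ([b1]), its variation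
   along the step ([b4]), the distance from [s n] to [z] ([b7]). *)
have e4 : 0 < e / 4 by rewrite divr_gt0.
have e1 : 0 < e / 4 / (`|du| * Nv + 1) by rewrite divr_gt0// ltr_wpDl// mulr_ge0.
have h1 := near_harmonic_scale du (D2_diff u e1).
have h2 := near_harmonic_scale du nC.
have h3 := near_harmonic_le (C * `|du| * (`|z| + 1)) e4.
have e5 : 0 < Num.min 1 (e / 4 / (del + CL + 1)).
  by rewrite lt_min ltr01 divr_gt0// ltr_wpDl// addr_ge0.
have h4 : \forall n \near \oo, `|z - s n| < Num.min 1 (e / 4 / (del + CL + 1)).
  by move/cvgrPdist_lt: sz => /(_ _ e5).
apply: filterS2 (filterI h1 h2) (filterI h3 h4) => n [k1 k2] [k3].
rewrite lt_min => /andP[k4 k5]; move: k1 k2 k3.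
set t := n.+1%:R^-1 => k1 k2 k3; have t0 : 0 <= t by rewrite invr_ge0.
have sn : `|s n| <= `|z| + 1.
  by rewrite -[s n](subrK z) addrC; apply: le_trans (ler_normD _ _) _; rewrite lerD2l distrC ltW.
have sn2 : `|s n - z| * (del + CL) <= e / 4.
  rewrite distrC; apply: (@le_trans _ _ (`|z - s n| * (del + CL + 1))).
    by rewrite ler_wpM2l// lerDl.
  by rewrite -ler_pdivlMr ?ltW// ltr_wpDl// addr_ge0.
apply: L2_norm_le_dot.
  by rewrite mulr_ge0// addr_ge0 ?(ltW e0)// mulr_ge0// addr_ge0// mulr_ge0// addr_ge0.
move=> k; rewrite [L2dot k _]L2dotDr L2dotNr L2dotZr (L2dotDr (H du)).
rewrite [L2dot k (_ - _)]L2dotDr L2dotNr.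
rewrite -(diff_adjointP dK _ (v + t *: s n) k) -(diff_adjointP dK u v k).
rewrite -(diff_adjointP dK uhat z k) (L2dotC k).
rewrite (adjoint_hessian_dot dK D2_lin_r D2_lin_l D2_bnd D2_diff).
have D2t : D2 u (t *: du) k = t *: D2 u du k.
  have := @D2_lin_l u k t du 0; have := @D2_lin_l u k (-1) 0 0.
  by rewrite /= scaler0 addr0 scaleN1r addNr => ->; rewrite !addr0.
have {}k1 := k1 k; have {}k2 := k2 k; rewrite D2t in k1.
rewrite normrZ ger0_norm// in k1 k2.
move: k1 k2; move: ('d K (u + t *: du) k) => x1 k1 k2.
have b1 : L2dot (x1 - 'd K u k - t *: D2 u du k) v <= t * (e / 4) * `|k|.
  apply: le_trans (L2dot_norm_le _ _) _; apply: le_trans (ler_pM _ _ k1 vN) _ => //.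
  have Q0 : 0 <= `|du| * Nv by rewrite mulr_ge0.
  have q1 : e / 4 / (`|du| * Nv + 1) * (`|du| * Nv) <= e / 4.
    by rewrite mulrAC ler_pdivrMr ?ltr_wpDl// ler_wpM2l ?(ltW e4)// lerDl.
  have := ler_wpM2r (mulr_ge0 t0 (normr_ge0 k)) q1.
  move: (e / 4 / (`|du| * Nv + 1)) => a1; move: `|du| `|k| => a3 a4.
  rewrite (_ : a1 * (a3 * Nv) * (t * a4) = a1 * (t * a3) * a4 * Nv); last by ring.
  by rewrite (mulrCA (e / 4)) mulrA.
have b2 : L2dot (D2 u du k - D2 uhat du k) v <= del * Nv * `|du| * `|k|.
  apply: le_trans (L2dot_norm_le _ _) _; apply: le_trans (ler_pM _ _ (dD2 du k) vN) _ => //.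
  by rewrite mulrC !mulrA (mulrC Nv).
have b3 : L2dot (D2 uhat du k) (v - vhat) <= del * C2 * `|du| * `|k|.
  apply: le_trans (L2dot_norm_le _ _) _; apply: le_trans (ler_pM _ _ (bD2 du k) vv) _ => //.
  by rewrite mulrC !mulrA.
have b4 : L2dot (x1 - 'd K u k) (s n) <= e / 4 * `|k|.
  apply: le_trans (L2dot_norm_le _ _) _; apply: le_trans (ler_pM _ _ k2 sn) _ => //.
  rewrite [leLHS](_ : _ = C * `|du| * (`|z| + 1) * t * `|k|); first by rewrite ler_wpM2r.
  by move: `|du| `|k| `|z| => a1 a2 a3; ring.
have b5 : L2dot ('d K u k - 'd K uhat k) (s n) <= del * (`|z| + `|s n - z|) * `|k|.
  apply: le_trans (L2dot_norm_le _ _) _; apply: le_trans (ler_wpM2r _ (dKu k)) _ => //.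
  rewrite mulrAC ler_wpM2r// ler_wpM2l// -[X in `|X| <= _](subrK z) addrC.
  exact: ler_normD.
have b6 : L2dot ('d K uhat k) (s n - z) <= CL * `|s n - z| * `|k|.
  apply: le_trans (L2dot_norm_le _ _) _; apply: le_trans (ler_wpM2r _ (bL k)) _ => //.
  by rewrite mulrAC.
have b7 : (del * `|s n - z| + CL * `|s n - z|) * `|k| <= e / 4 * `|k|.
  by rewrite -mulrDl ler_wpM2r// mulrC.
have ek : 0 <= e / 4 * `|k| by rewrite mulr_ge0// ltW.
rewrite (L2dot_telescope _ _ _ (D2 u du k)).
have := lerD (lerD (lerD (lerD b2 b3) b4) b5) b6; move/(ler_wpM2l t0) => b.
apply: le_trans (lerD b1 b) _.
move: b7 ek t0; clear.
move: `|du| `|k| `|z| `|s n - z| => n1 n2 n3 n4 b7 ek t0.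
have S : e / 4 * n2 + (del * Nv * n1 * n2 + del * C2 * n1 * n2 + e / 4 * n2
    + del * (n3 + n4) * n2 + CL * n4 * n2) <= (del * ((Nv + C2) * n1 + n3) + e) * n2.
  by lra.
have := ler_wpM2l t0 S; lra.
Qed.

End residual_expansion.

(** * The residual and its decrease *)

Lemma cauchy_seq_cvg (R : realType) (W : completeNormedModType R) (x : nat -> W) :
  (forall e, 0 < e -> exists N, forall k n, (N <= k)%N -> (k <= n)%N -> `|x k - x n| < e) ->
  cvgn x.
Proof.
move=> h; apply: cauchy_cvg; apply: cauchy_exP => e /h [N NP].
by exists (x N), N => // n /= Nn; rewrite -ball_normE /=; exact: NP.
Qed.

Section residual.
Context d (T : measurableType d) (R : realType).
Variable mu : {measure set T -> \bar R}.

Lemma residual1_split m (a0 a1 du u H LT : L2 mu m) (al h : R) :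
  al *: du + H = - (al *: u + a0) - LT ->
  al *: (u + h *: du) + a1 = (1 - h) *: (al *: u + a0) + (a1 - a0 - h *: (H + LT)).
Proof.
move=> E; apply: L2dot_inj => k; have := congr1 (L2dot k) E; rewrite !L2dotE.
move: (L2dot k a0) (L2dot k a1) (L2dot k u) (L2dot k du) (L2dot k H) (L2dot k LT).
move=> b1 b2 b3 b4 b5 b6 E5; have -> : b5 = - (al * b3 + b1) - b6 - al * b4.
  by move: E5; clear; lra.
by clear; ring.
Qed.

(** The same for the second component, where the graph moves along [nun] instead of its limit [nu],
    and the regularization leaves the extra error [e *: z]. *)
Lemma residual2_split m (z nu nun Ldu g Kn Ku dy eta : L2 mu m) (e h : R) :
  Ku - dy - eta = nu - Ldu + e *: z ->
  Kn - dy - (eta + h *: nun) = (1 - h) *: (Ku - dy - eta) +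
    ((Kn - Ku - h *: g) + h *: ((g - Ldu) + (nu - nun) + e *: z)).
Proof.
move=> E; have -> : eta = Ku - dy - (nu - Ldu + e *: z).
  by rewrite -E opprB addrC subrK.
apply: L2dot_inj => k; rewrite !L2dotE.
move: (L2dot k z) (L2dot k nu) (L2dot k nun) (L2dot k Ldu) (L2dot k g) (L2dot k Kn)
  (L2dot k Ku) (L2dot k dy) => b1 b2 b3 b4 b5 b6 b7 b8.
by clear; ring.
Qed.

End residual.

Section resolvent_graph.
Context d (T : measurableType d) (R : realType) (m : nat).
Variable mu : {measure set T -> \bar R}.
Variables (f : 'rV[R]_m -> \bar R) (l gamma : R).
Hypotheses (pf : proper_fun f) (cf : convex_fun f) (lf : lower_semicontinuous f).
Hypotheses (l0 : 0 < l) (g0 : 0 <= gamma).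
Hypothesis pF : proper_fun (integral_functional f : L2 mu m -> \bar R).
Variables p0 v0 : L2 mu m.
Hypothesis base : {ae mu, forall x, prox f l (p0 x) = v0 x}.
Local Notation J := (proxL2 f l).

(* Minty parametrization of the graph: p |-> (J p, minty p). *)
Definition minty p : L2 mu m := l^-1 *: (p - J p) + gamma *: J p.

Lemma minty_graph p : subdiff_regularized gamma f (J p) (minty p).
Proof.
apply: subdiff_regularized_pointwise => //.
have h1 := L2funZ l^-1 (p - J p); have h2 := L2B_ae p (J p).
have h3 := proxL2_ae pf cf lf l0 base p.
apply: filterS2 (filterI h1 h2) h3 => x [e1 e2] e3.
rewrite e1 e2 e3; exact: proxP.
Qed.

Lemma proxL2_base : J p0 = v0.
Proof.
apply: L2P; have h3 := proxL2_ae pf cf lf l0 base p0.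
by apply: filterS2 h3 base => x -> ->.
Qed.

Lemma minty_lipschitz p q : `|minty p - minty q| <= (2 / l + gamma) * `|p - q|.
Proof.
have nJ := proxL2_nonexpansive pf cf lf l0 base p q.
rewrite /minty opprD addrACA -!scalerBr; apply: le_trans (ler_normD _ _) _.
rewrite !normrZ !ger0_norm ?invr_ge0 ?(ltW l0)// mulrDl lerD//; last by rewrite ler_wpM2l.
rewrite (mulrC 2) -mulrA ler_wpM2l ?invr_ge0 ?(ltW l0)//.
rewrite (_ : p - J p - (q - J q) = (p - q) - (J p - J q)); last first.
  by rewrite !opprD !opprK addrACA.
by apply: le_trans (ler_normB _ _) _; rewrite mulr_natl mulr2n lerD2l.
Qed.

Hypothesis df : proto_differentiable (subdifferential (@dotv R m) f).

(** The Minty parametrization maps the points [p + h n *: a] into the graph, so its directional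
    derivative along [a] is a tangent vector. *)
Lemma minty_tangent (p a z : L2 mu m) : dproxL2 f l p a = z ->
  tangent (graph (subdiff_regularized gamma f)) (J p, minty p)
    (z, l^-1 *: (a - z) + gamma *: z).
Proof.
move=> zE; pose h n : R := n.+1%:R^-1.
have sz : n.+1%:R *: (J (p + h n *: a) - J p) @[n --> \oo] --> z.
  by rewrite -zE; exact: (dproxL2_cvg pf cf lf l0 base df).
exists h, (fun n => (J (p + h n *: a), minty (p + h n *: a))); split => //.
- by move=> n; rewrite invr_gt0.
- exact: cvg_harmonic.
- by move=> n; exact: minty_graph.
rewrite (_ : (fun n => _) = fun n => (n.+1%:R *: (J (p + h n *: a) - J p),
    l^-1 *: (a - n.+1%:R *: (J (p + h n *: a) - J p)) +
    gamma *: (n.+1%:R *: (J (p + h n *: a) - J p)))).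
  apply: cvg_pair_seq => //; apply: cvgD; apply: cvgZl_tmp => //.
  by apply: cvgB => //; exact: cvg_cst.
apply/funext => n; congr pair; rewrite /= /h invrK//.
rewrite /minty; move: (J _) (J _) => b c; apply: L2dot_inj => k; rewrite !L2dotE.
move: (L2dot k a) (L2dot k b) (L2dot k c) (L2dot k p) => b1 b2 b3 b4.
by field; rewrite nat1r pnatr_eq0 /= lt0r_neq0.
Qed.

(** The vector paired with [z] is [(a - z) / l], and [L2dot z z <= L2dot a z] by firm
    nonexpansiveness of the derivative. *)
Lemma minty_monotone (p a z : L2 mu m) : dproxL2 f l p a = z ->
  0 <= L2dot (l^-1 *: (a - z) + gamma *: z - gamma *: z) z.
Proof.
move=> <-; rewrite addrK L2dotZl mulr_ge0 ?invr_ge0 ?(ltW l0)//.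
rewrite L2dotDl L2dotNl subr_ge0.
exact: (dproxL2_firm pf cf lf l0 base df).
Qed.

End resolvent_graph.

Section stability.
Context d (T : measurableType d) (R : realType).
Variable mu : {measure set T -> \bar R}.

(* (du, a) solves the linear system with the derivatives frozen at (uhat, vhat);
   del bounds the error of the freezing, and e is the regularization. *)
Lemma residual_decrease (m1 m2 : nat) (K : L2 mu m1 -> L2 mu m2)
    (D2 : L2 mu m1 -> L2 mu m1 -> L2 mu m1 -> L2 mu m2)
    (uhat : L2 mu m1) (vhat dy : L2 mu m2) (alpha l gamma e del Nv C2 Cu Cz Cd : R)
    (f : 'rV[R]_m2 -> \bar R) (p0 v0 : L2 mu m2)
    (u du : L2 mu m1) (p a z : L2 mu m2) :
  let L := 'd K uhat in
  let H := adjoint_hessian K uhat vhat in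
  let J := proxL2 f l in
  let r1 u p := alpha *: u + adjoint ('d K u) (J p) in
  let r2 u p := K u - dy - minty f l gamma p in
  let phi u p := `|r1 u p| + `|r2 u p| in
  (forall u, differentiable K u) ->
  (forall u h, linear (D2 u h)) ->
  (forall u k, linear (fun h => D2 u h k)) ->
  (forall u, exists C : R, forall h k, `|D2 u h k| <= C * `|h| * `|k|) ->
  (forall u (e : R), 0 < e -> \forall h \near (0 : L2 mu m1), forall k,
          `|'d K (u + h) k - 'd K u k - D2 u h k| <= e * `|h| * `|k|) ->
  proper_fun f -> convex_fun f -> lower_semicontinuous f -> 0 < l ->
  {ae mu, forall x, prox f l (p0 x) = v0 x} ->
  proto_differentiable (subdifferential (@dotv R m2) f) ->
  0 <= del -> 0 <= Nv -> 0 <= C2 -> 0 <= Cu -> 0 <= Cz -> 0 < Cd -> 0 <= e ->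
  (forall h k, `|D2 uhat h k| <= C2 * `|h| * `|k|) ->
  (forall h k, `|D2 u h k - D2 uhat h k| <= del * `|h| * `|k|) ->
  `|J p - vhat| <= del -> `|J p| <= Nv ->
  (forall k, `|'d K u k - L k| <= del * `|k|) ->
  alpha *: du + H du = - r1 u p - adjoint L z ->
  dproxL2 f l p a = z ->
  r2 u p = (l^-1 *: (a - z) + gamma *: z) - L du + e *: z ->
  `|du| <= Cu * phi u p -> `|z| <= Cz * phi u p -> `|du| + `|a| <= Cd * phi u p ->
  del * ((Nv + C2 + 1) * Cu + Cz) <= 8^-1 -> e * Cz <= 8^-1 ->
  0 < phi u p ->
  exists u' p', phi u' p' < phi u p /\
    (2 * Cd)^-1 * (`|u - u'| + `|p - p'|) <= phi u p - phi u' p'.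
Proof.
move=> L H J r1 r2 phi dK D2r D2l D2b D2d pf cf lf l0 base df del0 Nv0 C20 Cu0 Cz0 Cd0 e0.
move=> bD2 dD2 vv vN dKu lin1 zE lin2 nu nz nd delC eC phi0.
pose h n : R := n.+1%:R^-1.
pose s n := n.+1%:R *: (J (p + h n *: a) - J p).
have sz : s @ \oo --> z by rewrite -zE; exact: (dproxL2_cvg pf cf lf l0 base df).
have Js n : J (p + h n *: a) = J p + h n *: s n.
  by rewrite /s scalerA mulVf// scale1r [RHS]addrC subrK.
pose w n := l^-1 *: (a - s n) + gamma *: s n.
set w0 := l^-1 *: (a - z) + gamma *: z in lin2.
have ww0 : w @ \oo --> w0.
  by apply: cvgD; apply: cvgZl_tmp => //; apply: cvgB => //; exact: cvg_cst.
have Mw n : minty f l gamma (p + h n *: a) = minty f l gamma p + h n *: w n.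
  rewrite /minty -/J Js /w; move: (J p) (s n) (h n) => b c t.
  apply: L2dot_inj => k; rewrite !L2dotE.
  move: (L2dot k a) (L2dot k b) (L2dot k c) (L2dot k p) => b1 b2 b3 b4.
  by field; exact: lt0r_neq0.
(* Shares of [phi]: the vanishing errors get [1/16 + 1/32 + 1/32], freezing [1/8] and regularization
   [1/8]. The total stays below [1/2], so half of the ideal decrease [h phi] survives. *)
have c0 : 0 < phi u p / 16 by rewrite divr_gt0.
have h1 := adjoint_expansion dK D2r D2l D2b D2d du sz del0 Nv0 C20 c0 bD2 dD2 vv vN dKu.
have c1 : 0 < phi u p / 32 by rewrite divr_gt0.
have h2 := K_expansion dK u du c1.
have h3 : \forall n \near \oo, `|w0 - w n| <= phi u p / 32.
  by move/cvgrPdist_lt: ww0 => /(_ _ c1); apply: filterS => n /ltW.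
have [n [k1 [k2 k3]]] := filter_ex (filterI h1 (filterI h2 h3)).
rewrite -/(h n) in k1 k2; exists (u + h n *: du), (p + h n *: a).
have hn0 : 0 < h n by rewrite invr_gt0.
have hn1 : h n <= 1 by rewrite invf_le1// ler1n.
have b1 : `|r1 (u + h n *: du) (p + h n *: a)| <= (1 - h n) * `|r1 u p| +
    h n * (del * ((Nv + C2) * `|du| + `|z|) + phi u p / 16).
  rewrite /r1 Js (residual1_split _ _ lin1); apply: le_trans (ler_normD _ _) _.
  by rewrite normrZ ger0_norm ?subr_ge0// lerD2l.
have b2 : `|r2 (u + h n *: du) (p + h n *: a)| <= (1 - h n) * `|r2 u p| +
    h n * (phi u p / 32 + (del * `|du| + phi u p / 32 + e * `|z|)).
  rewrite /r2 Mw (residual2_split _ ('d K u du) _ _ lin2).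
  apply: le_trans (ler_normD _ _) _.
  rewrite normrZ ger0_norm ?subr_ge0// lerD2l mulrDr.
  apply: le_trans (ler_normD _ _) _; apply: lerD => //.
  rewrite normrZ (gtr0_norm hn0) ler_wpM2l ?(ltW hn0)//.
  apply: le_trans (ler_normD _ _) _; rewrite normrZ (ger0_norm e0) lerD2r.
  by apply: le_trans (ler_normD _ _) _; apply: lerD.
have step : phi (u + h n *: du) (p + h n *: a) <= phi u p - h n * (phi u p / 2).
  rewrite /phi; apply: le_trans (lerD b1 b2) _.
  rewrite -/(phi u p); have : phi u p = `|r1 u p| + `|r2 u p| by [].
  have q1 : del * ((Nv + C2 + 1) * `|du| + `|z|) <= phi u p / 8.
    apply: (@le_trans _ _ (del * ((Nv + C2 + 1) * Cu + Cz) * phi u p)).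
      rewrite -mulrA ler_wpM2l// [leRHS]mulrDl -mulrA lerD// ler_wpM2l//.
      by rewrite !addr_ge0.
    by rewrite mulrC ler_wpM2l// ltW.
  have q2 : e * `|z| <= phi u p / 8.
    apply: (@le_trans _ _ (e * Cz * phi u p)); first by rewrite -mulrA ler_wpM2l.
    by rewrite mulrC ler_wpM2l// ltW.
  move: (h n) hn0 hn1 q1 q2 => t t0 t1; clear -t0 phi0.
  move: (phi u p) `|r1 u p| `|r2 u p| `|du| `|z| phi0 => P n1 n2 n3 n4 P0 q1 q2 PE.
  have Q : del * ((Nv + C2) * n3 + n4) + P / 16 + (P / 32 + (del * n3 + P / 32 + e * n4)) <= P / 2.
    by move: q1 q2; lra.
  by have := ler_wpM2l (ltW t0) Q; rewrite PE; lra.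
split.
  by apply: le_lt_trans step _; rewrite ltrBlDr ltrDl mulr_gt0// divr_gt0.
(* The step has length at most [h Cd phi] and lowers [phi] by at least [h phi / 2], whence the ratio
   [(2 Cd)^-1]. *)
apply: (@le_trans _ _ (h n * (phi u p / 2))); last by rewrite lerBrDr addrC -lerBrDr.
rewrite !opprD !addrA !subrr !add0r !normrN !normrZ (gtr0_norm hn0) -mulrDr.
rewrite mulrCA ler_wpM2l ?(ltW hn0)// ler_pdivrMl ?mulr_gt0//.
apply: le_trans nd _; rewrite le_eqVlt; apply/orP; left; apply/eqP.
by move: (phi u p) => P; field.
Qed.

End stability.

(** * Choice of the constants and conclusion *)

Lemma near_ball (R : realType) (W : normedModType R) (x : W) (P : W -> Prop) :
  (\forall y \near x, P y) -> exists2 r : R, 0 < r & forall y, `|y - x| < r -> P y.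
Proof.
move=> /nbhs_ballP[r /= r0 rP]; exists r => // y yx; apply: rP.
by rewrite -ball_normE /= distrC.
Qed.

Lemma lipschitz_seq_cvg (R : realType) (W1 W2 : normedModType R) (G : W1 -> W2) (C : R)
    (x : nat -> W1) (a : W1) :
  (forall p q, `|G p - G q| <= C * `|p - q|) -> x @ \oo --> a -> G (x n) @[n --> \oo] --> G a.
Proof.
move=> GL xa; have h : C * `|a - x n| @[n --> \oo] --> (0 : R).
  rewrite -[0](mulr0 C) -[X in C * X](normr0 W1) -[X in `|X|](subrr a).
  by apply: cvgM; [exact: cvg_cst|apply: cvg_norm; apply: cvgB => //; exact: cvg_cst].
apply/cvgrPdist_lt => e e0; move/cvgr0Pnorm_lt: h => /(_ e e0); apply: filterS => n.
by move=> /(le_lt_trans (ler_norm _)); exact: le_lt_trans.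
Qed.

Lemma small_constant (R : realFieldType) (C : R) : 0 <= C ->
  exists e : R, [/\ 0 < e, e <= 1 & e * C <= 8^-1].
Proof.
move=> C0; have C1 : 0 < C + 1 by rewrite ltr_wpDl.
exists (8 * (C + 1))^-1; split; first by rewrite invr_gt0 mulr_gt0.
  by rewrite invf_le1 ?mulr_gt0//; lra.
rewrite invfM -mulrA ger_pMr ?invr_gt0// mulrC ler_pdivrMr// mul1r.
by rewrite lerDl.
Qed.

(** The [l] imposed by [resolvent_equation] must also meet [l * gamma < 2], for the pointwise
    inclusion, and [l <= 1], for the bound on [a]; both come from the denominator being at least [1]
    and at least [gamma]. *)
Lemma resolvent_parameter (R : realFieldType) (CB gamma e : R) :
  0 <= CB -> 0 <= gamma -> 0 < e -> e <= 1 ->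
  let l := e / (CB + gamma + e + 1) ^+ 2 in [/\ 0 < l, l <= 1 & l * gamma < 2].
Proof.
move=> CB0 g0 e0 e1 /=; set N := CB + gamma + e + 1.
have N1 : 1 <= N by rewrite /N; lra.
have N0 : 0 < N ^+ 2 by rewrite exprn_gt0//; lra.
have N2 : N <= N ^+ 2 by rewrite expr2 ler_peMl//; lra.
split; first exact: divr_gt0.
  by rewrite ler_pdivrMr// mul1r; lra.
rewrite mulrAC ltr_pdivrMr//; have : e * gamma <= gamma by rewrite ler_piMl.
by rewrite /N in N2 *; lra.
Qed.

(** The domain enters through sigma-finiteness, used in [pointwise_subdiff_regularized]. The sum of
    the norms is the metric in which the decrease argument runs. *)
Theorem saddle_point_stability d (T : measurableType d) (R : realType)
    (mu : {measure set T -> \bar R}) (m1 m2 : nat)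
    (alpha : R) (K : L2 mu m1 -> L2 mu m2) (f : 'rV[R]_m2 -> \bar R) (gamma : R)
    (V : L2 mu m2 -> L2 mu m2 -> set (L2 mu m2))
    (uhat : L2 mu m1) (vhat : L2 mu m2) (cG : R) :
  sigma_finite setT mu ->
  0 < alpha -> C2 K ->
  proper_fun f -> convex_fun f -> lower_semicontinuous f ->
  proto_differentiable (subdifferential (@dotv R m2) f) ->
  proper_fun (integral_functional f : L2 mu m2 -> \bar R) ->
  0 <= gamma ->
  (forall v eta, subdiff_regularized gamma f v eta ->
     forall dv, conv_graph_deriv (subdiff_regularized gamma f) v eta dv =
       if dv \in V v eta then [set gamma *: dv + w | w in polar (V v eta)]
       else set0) ->
  optimality_conditions alpha K (subdiff_regularized gamma f) 0 uhat vhat ->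
  0 < cG ->
  (forall xi, alpha * `|xi| ^+ 2 + L2dot (adjoint_hessian K uhat vhat xi) xi
              >= cG * `|xi| ^+ 2) ->
  0 < gamma \/
  (0 < bbar (Bbar alpha K uhat vhat) (subdiff_regularized gamma f) V
         vhat (K uhat))%E ->
  exists rho ell : R, [/\ 0 < rho, 0 < ell &
    forall dy, `|dy| <= rho ->
      exists u v,
        optimality_conditions alpha K (subdiff_regularized gamma f) dy u v /\
        `|uhat - u| + `|vhat - v| <= ell * `|dy|].
Proof.
move=> sf alpha0 [dK [D2 [D2r D2l D2b D2d D2c]]] pf cf lf df pF g0 hV [opt1 opt2] cG0 coer gb.
rewrite subr0 in opt2.
have [Ainv [CL [CL0 lAi AiK nAi [bL bLT BE]]]] :=
  Bbar_factor dK D2r D2l D2b D2d alpha0 cG0 coer.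
move: BE gb; set L := 'd K uhat; set LT := adjoint L.
move: (Bbar alpha K uhat vhat) => B BE gb.
set H := adjoint_hessian K uhat vhat in coer AiK.
have lL : linear L by exact: diff_linear.
have lLT : linear LT := adjoint_linear lL bL.
have adjL y h : L2dot (L h) y = L2dot h (LT y) := adjointP y lL bL h.
have lB : linear B by move=> a x y; rewrite !BE lLT lAi lL.
have i0 : 0 <= cG^-1 by rewrite invr_ge0 ltW.
have bB z : `|B z| <= CL * (cG^-1 * CL) * `|z|.
  rewrite BE; apply: le_trans (bL _) _; rewrite -!mulrA ler_wpM2l//.
  by apply: le_trans (nAi _) _; rewrite ler_wpM2l.
(* With [x = Ainv (LT z)], [B z = L x] and [L2dot (B z) z = L2dot x (LT z)] is the quadratic form of
   [alpha + H] at [x]. *)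
have Bz z : cG * `|Ainv (LT z)| ^+ 2 <= L2dot (B z) z.
  rewrite BE adjL; have := AiK (LT z); move: (Ainv (LT z)) => x <-.
  by rewrite L2dotC L2dotDl L2dotZl -L2_sqr_norm; exact: coer.
pose kappa := (CL ^+ 2 + 1) / cG.
have kappa0 : 0 < kappa by rewrite divr_gt0// ltr_wpDl// sqr_ge0.
have kB z : `|B z| ^+ 2 <= kappa * L2dot (B z) z.
  apply: (@le_trans _ _ ((CL ^+ 2 + 1) * `|Ainv (LT z)| ^+ 2)); last first.
    rewrite /kappa -mulrA ler_wpM2l ?addr_ge0 ?sqr_ge0//.
    by rewrite mulrC ler_pdivlMr// mulrC.
  apply: (@le_trans _ _ (CL ^+ 2 * `|Ainv (LT z)| ^+ 2)); last first.
    by rewrite ler_wpM2r ?sqr_ge0// lerDl.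
  by rewrite BE -exprMn lerXn2r ?nnegrE// mulr_ge0.
have B0 z : 0 <= L2dot (B z) z.
  by apply: le_trans (Bz z); rewrite mulr_ge0 ?(ltW cG0)// sqr_ge0.
have [C1 [t [C10 t0 EST]]] := tangent_estimate g0 kappa0 kB hV gb.
have [C2' bD2'] := D2b uhat; pose C2 := `|C2'|.
have C20 : 0 <= C2 by exact: normr_ge0.
have bD2 h k : `|D2 uhat h k| <= C2 * `|h| * `|k|.
  by apply: le_trans (bD2' h k) _; rewrite !ler_wpM2r// ler_norm.
pose CB := CL * (cG^-1 * CL); have CB0 : 0 <= CB by rewrite !mulr_ge0.
(* [Cr], [Cz], [Cu], [Ca] will bound [r], [z], [du], [a] in terms of the residual. None involves [e]
   or [l] ([Ca] uses [e <= 1] and [l <= 1]), so that [e] may be chosen after them. *)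
pose Cr := 1 + CL * cG^-1; have Cr0 : 0 <= Cr by rewrite addr_ge0// mulr_ge0.
pose Cz := C1 * Cr; have Cz0 : 0 <= Cz by rewrite mulr_ge0// ltW.
pose Cu := cG^-1 * (1 + CL * Cz).
have Cu0 : 0 <= Cu by rewrite mulr_ge0// addr_ge0// mulr_ge0.
pose Ca := Cz + (Cr + CB * Cz + (gamma + 1) * Cz).
have Ca0 : 0 <= Ca.
  apply: addr_ge0 => //; apply: addr_ge0; last by apply: mulr_ge0 => //; exact: addr_ge0.
  by apply: addr_ge0 => //; exact: mulr_ge0.
pose Cd := Cu + Ca + 1; have Cd0 : 0 < Cd by rewrite ltr_wpDl// addr_ge0.
pose Nv := `|vhat| + 1; have Nv0 : 0 <= Nv by rewrite addr_ge0.
have [e [e0 e1 eC]] := small_constant Cz0.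
pose D := (Nv + C2 + 1) * Cu + Cz.
have D0 : 0 <= D by rewrite addr_ge0// mulr_ge0// !addr_ge0.
have [del [del0 del1 delD]] := small_constant D0.
have [l0 l1 lg] := resolvent_parameter CB0 g0 e0 e1.
set l := e / _ in l0 l1 lg.
(* The Minty parameter of the graph point [(vhat, K uhat)], which also serves as the base point for
   the square integrability of [J]. *)
pose phat : L2 mu m2 := vhat + l *: (K uhat - gamma *: vhat).
have base : {ae mu, forall x, prox f l (phat x) = vhat x}.
  have h1 := pointwise_subdiff_regularized lf pF pf cf g0 l0 lg sf opt2.
  have h2 := L2funD vhat (l *: (K uhat - gamma *: vhat)).
  have h3 := L2funZ l (K uhat - gamma *: vhat).
  by apply: filterS2 h1 (filterI h2 h3) => x e1' [-> ->].
pose J : L2 mu m2 -> L2 mu m2 := proxL2 f l.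
have Jphat : J phat = vhat := proxL2_base pf cf lf l0 base.
have neJ p q : `|J p - J q| <= `|p - q| := proxL2_nonexpansive pf cf lf l0 base p q.
pose M : L2 mu m2 -> L2 mu m2 := minty f l gamma.
have Mphat : M phat = K uhat.
  rewrite /M /minty -/J Jphat /phat addrAC subrr add0r scalerA mulVf ?lt0r_neq0//.
  by rewrite scale1r subrK.
have MG p : subdiff_regularized gamma f (J p) (M p) := minty_graph pf cf lf l0 g0 pF base p.
have MLip p q : `|M p - M q| <= (2 / l + gamma) * `|p - q|
  := minty_lipschitz pf cf lf l0 g0 base p q.
have [r0 r00 r0P] := near_ball (D2c uhat del del0).
have [Cl Cl0 /near_ball[r1 r10 r1P]] := diff_locally_lipschitz D2b D2d uhat.
(* Within [s0], the radius [r0] controls [D2], [r1] and [del / (Cl + 1)] control ['d K], [del]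
   controls [J p], and the last bound keeps the graph point in the neighborhood of size [t] where
   the estimate on [z] holds. *)
pose s0 := Num.min (Num.min r0 (Num.min r1 (del / (Cl + 1))))
   (Num.min del (t / (2 / l + gamma + 1))).
have lg0 : 0 <= 2 / l + gamma by rewrite addr_ge0// divr_ge0// ltW.
have s00 : 0 < s0.
  by rewrite !lt_min r00 r10 del0 !divr_gt0// ltr_wpDl.
pose c := (2 * Cd)^-1; have c0 : 0 < c by rewrite invr_gt0 mulr_gt0.
(* A point whose distance to the start is at most [|dy| / c] is then within [s0 / 2] of it, so a
   decreasing step is available there. *)
exists (c * s0 / 2), c^-1; split; [by rewrite divr_gt0// mulr_gt0|by rewrite invr_gt0|].
move=> dy dyle.
pose res1 u p := alpha *: u + adjoint ('d K u) (J p).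
pose res2 u p := K u - dy - M p.
pose phi (x : L2 mu m1 * L2 mu m2) := `|res1 x.1 x.2| + `|res2 x.1 x.2|.
pose dist (x y : L2 mu m1 * L2 mu m2) := `|x.1 - y.1| + `|x.2 - y.2|.
have phi_hat : phi (uhat, phat) = `|dy|.
  rewrite /phi /res1 /res2 /= Jphat opt1 normr0 add0r Mphat.
  by rewrite addrAC subrr add0r normrN.
have [||||||[u p] [phi_up dist_up]] := @caristi R (L2 mu m1 * L2 mu m2)%type dist phi c (uhat, phat) c0.
- by move=> x; rewrite /dist !subrr !normr0 addr0.
- by move=> x y; rewrite addr_ge0.
- move=> x y z; rewrite /dist addrACA lerD//.
    by rewrite -(subrKA y.1); exact: ler_normD.
  by rewrite -(subrKA y.2); exact: ler_normD.
- move=> x hx.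
  have c1 : cvgn (fun n => (x n).1).
    apply: cauchy_seq_cvg => e' e'0; have [N NP] := hx e' e'0.
    by exists N => k n Nk kn; apply: le_lt_trans (NP k n Nk kn); rewrite /dist lerDl.
  have c2 : cvgn (fun n => (x n).2).
    apply: cauchy_seq_cvg => e' e'0; have [N NP] := hx e' e'0.
    by exists N => k n Nk kn; apply: le_lt_trans (NP k n Nk kn); rewrite /dist lerDr.
  pose a := limn (fun n => (x n).1); pose b := limn (fun n => (x n).2).
  have {c1}xa : (x n).1 @[n --> \oo] --> a by exact: c1.
  have {c2}xb : (x n).2 @[n --> \oo] --> b by exact: c2.
  have Jb : J (x n).2 @[n --> \oo] --> J b.
    by apply: (@lipschitz_seq_cvg _ _ _ J 1) => // p q; rewrite mul1r.
  have Mb : M (x n).2 @[n --> \oo] --> M b by exact: lipschitz_seq_cvg MLip xb.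
  have Ka : K (x n).1 @[n --> \oo] --> K a.
    by apply: (@cvg_comp _ _ _ _ K _ _ _ xa); exact: differentiable_continuous (dK a).
  exists (a, b); split.
    rewrite /dist /= -[0]addr0; apply: cvgD.
      by rewrite -(normr0 (L2 mu m1)) -[X in `|X|](subrr a);
        apply: cvg_norm; apply: cvgB => //; exact: cvg_cst.
    by rewrite -(normr0 (L2 mu m2)) -[X in `|X|](subrr b);
      apply: cvg_norm; apply: cvgB => //; exact: cvg_cst.
  rewrite /phi /=; apply: cvgD; apply: cvg_norm.
    apply: cvgD; first by apply: cvgZl_tmp.
    exact: (adjoint_diff_cvg dK D2b D2d xa Jb).
  by apply: cvgB => //; apply: cvgB => //; exact: cvg_cst.
- by move=> x; rewrite addr_ge0.
- move=> [u p]; rewrite phi_hat /dist /= => near_hat phi0.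
  have near_s0 : `|u - uhat| + `|p - phat| < s0.
    rewrite (distrC u) (distrC p) -(ltr_pM2l c0); apply: le_lt_trans near_hat _.
    apply: le_lt_trans dyle _; rewrite ltr_pdivrMr// ltr_pMr ?mulr_gt0//.
    by rewrite ltr1n.
  have us0 : `|u - uhat| < s0 by apply: le_lt_trans near_s0; rewrite lerDl.
  have ps0 : `|p - phat| < s0 by apply: le_lt_trans near_s0; rewrite lerDr.
  move: us0; rewrite !lt_min => /andP[/andP[ur0 /andP[ur1 ucl]] _].
  move: ps0; rewrite !lt_min => /andP[_ /andP[pdel pt]].
  have vvp : `|J p - vhat| <= `|p - phat| by rewrite -Jphat.
  have vv : `|J p - vhat| <= del by apply: le_trans vvp _; exact: ltW.
  have vN : `|J p| <= Nv.
    rewrite -[J p](subrK vhat) addrC; apply: le_trans (ler_normD _ _) _.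
    by rewrite lerD2l; exact: le_trans del1.
  have lg1 : 0 < 2 / l + gamma + 1 by rewrite ltr_wpDl.
  have pt' : (2 / l + gamma + 1) * `|p - phat| < t by rewrite mulrC -ltr_pdivlMr.
  have vt : `|J p - vhat| < t.
    apply: le_lt_trans vvp _; apply: le_lt_trans pt'.
    by rewrite ler_peMl// lerDr.
  have et : `|M p - K uhat| < t.
    rewrite -Mphat; apply: le_lt_trans (MLip _ _) _; apply: le_lt_trans pt'.
    by rewrite ler_wpM2r// lerDl.
  have dKu k : `|'d K u k - L k| <= del * `|k|.
    have := r1P (u - uhat); rewrite subr0 => /(_ ur1 k).
    rewrite [uhat + _]addrC subrK => /le_trans; apply; rewrite ler_wpM2r//.
    rewrite mulrC; apply: (@le_trans _ _ (`|u - uhat| * (Cl + 1))).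
      by rewrite ler_wpM2l// lerDl.
    by rewrite -ler_pdivlMr ?ltW// ltr_wpDl.
  have dD2 := r0P u ur0.
  pose R1 := res1 u p; pose R2 := res2 u p; pose F := phi (u, p).
  have F1 : `|R1| <= F by rewrite /F /phi lerDl.
  have F2 : `|R2| <= F by rewrite /F /phi lerDr.
  have F0 : 0 <= F by exact: ltW.
  (* Elimination of [du = Ainv (- R1 - LT z)]: the second equation [R2 = w - L du + e *: z] becomes
     [w + e *: z + B z = r]. *)
  pose r := R2 + L (Ainv (- R1)).
  have neD a b : `|dproxL2 f l p a - dproxL2 f l p b| <= `|a - b|.
    exact: (dproxL2_nonexpansive pf cf lf l0 base df).
  have [z zE] := resolvent_equation r neD lB bB B0 g0 e0 CB0 (erefl l).
  set a := z + _ in zE.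
  pose w := l^-1 *: (a - z) + gamma *: z.
  have wE : w = r - B z - e *: z.
    rewrite /w /a [z + _]addrC addrK scalerA mulVf ?lt0r_neq0// scale1r.
    by rewrite scalerDl !opprD !addrA addrAC subrK.
  have wr : w + e *: z + B z = r by rewrite wE subrK subrK.
  have wz := minty_tangent pf cf lf l0 g0 pF base df zE.
  have wm := minty_monotone gamma pf cf lf l0 base df zE.
  have := EST _ _ _ _ e (MG p) vt et wz wm (ltW e0).
  rewrite -/w wr => nz.
  have nAR : `|Ainv (- R1)| <= cG^-1 * F.
    by apply: le_trans (nAi _) _; rewrite normrN ler_wpM2l.
  have nr : `|r| <= Cr * F.
    apply: le_trans (ler_normD _ _) _; rewrite /Cr mulrDl mul1r lerD//.
    by apply: le_trans (bL _) _; rewrite -mulrA ler_wpM2l.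
  have {}nz : `|z| <= Cz * F.
    by apply: le_trans nz _; rewrite /Cz -mulrA ler_wpM2l// ltW.
  pose du := Ainv (- R1 - LT z).
  have ndu : `|du| <= Cu * F.
    apply: le_trans (nAi _) _; rewrite /Cu -mulrA ler_wpM2l//.
    apply: le_trans (ler_normB _ _) _; rewrite normrN mulrDl mul1r lerD//.
    by apply: le_trans (bLT _) _; rewrite -mulrA ler_wpM2l.
  have lin2 : R2 = w - L du + e *: z.
    rewrite wE /du (linearB_fun lAi) (linearB_fun lL) -BE /r.
    move: (L (Ainv (- R1))) (B z) (e *: z) => x y x'.
    by rewrite opprB (addrAC _ (- x')) subrK addrA subrK addrK.
  have na : `|a| <= Ca * F.
    apply: le_trans (ler_normD _ _) _; rewrite /Ca mulrDl lerD//.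
    rewrite normrZ gtr0_norm//; apply: le_trans (ler_piMl _ l1) _ => //.
    apply: le_trans (ler_normB _ _) _; rewrite mulrDl mulrDl -addrA lerD//.
    apply: le_trans (ler_normD _ _) _; apply: lerD.
      by apply: le_trans (bB z) _; rewrite -/CB -(mulrA CB) ler_wpM2l.
    rewrite normrZ ger0_norm ?addr_ge0 ?(ltW e0)// -mulrA.
    by apply: ler_pM => //; rewrite ?addr_ge0 ?(ltW e0)// lerD2l.
  have nd : `|du| + `|a| <= Cd * F.
    apply: le_trans (lerD ndu na) _; rewrite -mulrDl ler_wpM2r//.
    by rewrite /Cd lerDl.
  have [u' [p' [dec len]]] := residual_decrease dK D2r D2l D2b D2d pf cf lf l0 base df
    (ltW del0) Nv0 C20 Cu0 Cz0 Cd0 (ltW e0) bD2 dD2 vv vN dKu (AiK _) zE lin2 ndu nz nd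
    delD eC phi0.
  by exists (u', p').
exists u, (J p); split.
  move: phi_up; rewrite /phi /= => /eqP; rewrite paddr_eq0// !normr_eq0.
  move=> /andP[/eqP R1 /eqP R2]; split; first exact: R1.
  by rewrite (_ : K u - dy = M p)//; apply/eqP; rewrite -subr_eq0; exact/eqP.
rewrite phi_hat in dist_up.
(* The decrease argument controls [p]; nonexpansiveness of [J] and [J phat = vhat] carry the bound
   over to [v = J p]. *)
apply: (@le_trans _ _ (dist (uhat, phat) (u, p))).
  by rewrite /dist /= lerD2l -Jphat neJ.
by rewrite ler_pdivlMl.
Qed.

Theorem proposition4p9 (R : realType) (n m1 m2 : nat)
    (Omega : set 'rV[R]_n) (oOmega : open Omega)
    (alpha : R) (K : L2_on oOmega m1 -> L2_on oOmega m2)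
    (f : 'rV[R]_m2 -> \bar R) (gamma : R)
    (V : L2_on oOmega m2 -> L2_on oOmega m2 -> set (L2_on oOmega m2))
    (uhat : L2_on oOmega m1) (vhat : L2_on oOmega m2) (cG : R) :
  0 < alpha ->
  C2 K ->
  proper_fun f -> convex_fun f -> lower_semicontinuous f ->
  proto_differentiable (subdifferential (@dotv R m2) f) ->
  proper_fun (integral_functional f : L2_on oOmega m2 -> \bar R) ->
  0 <= gamma ->
  (forall v eta, subdiff_regularized gamma f v eta ->
     cone (V v eta) /\
     forall dv, conv_graph_deriv (subdiff_regularized gamma f) v eta dv =
       if dv \in V v eta then [set gamma *: dv + w | w in polar (V v eta)]
       else set0) ->
  optimality_conditions alpha K (subdiff_regularized gamma f) 0 uhat vhat ->
  0 < cG ->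
  (forall xi, alpha * `|xi| ^+ 2 + L2dot (adjoint_hessian K uhat vhat xi) xi
              >= cG * `|xi| ^+ 2) ->
  0 < gamma \/
  (0 < bbar (Bbar alpha K uhat vhat) (subdiff_regularized gamma f) V
         vhat (K uhat))%E ->
  exists rho ell : R, [/\ 0 < rho, 0 < ell &
    forall dy, `|dy| <= rho ->
      exists u v,
        optimality_conditions alpha K (subdiff_regularized gamma f) dy u v /\
        Num.sqrt (`|uhat - u| ^+ 2 + `|vhat - v| ^+ 2) <= ell * `|dy|].
Proof.
move=> alpha0 C2K pf cf lf df pF g0 hV opt cG0 coer gb.
have [rho [ell [rho0 ell0 h]]] := saddle_point_stability
  (lebesgue_on_sigma_finite oOmega) alpha0 C2K pf cf lf df pF g0
  (fun v eta veta => (hV v eta veta).2) opt cG0 coer gb.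
exists rho, ell; split => // dy /h[u [v [uv le]]]; exists u, v; split => //.
apply: le_trans le; rewrite -[leRHS]ger0_norm ?addr_ge0// -sqrtr_sqr ler_sqrt ?sqr_ge0//.
by rewrite sqrrD addrAC lerDl mulrn_wge0// mulr_ge0.
Qed.
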